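(* There are uncountably many pairwise non-isomorphic easy quantum groups.
   Context: A compact matrix quantum group (CMQG) of size $n$ is a pair $(A,u)$ of a unital $C^*$-algebra $A$ and a unitary $u=(u_{ij})\in M_n(A)$ such that the $u_{ij}$ generate $A$, there is a $*$-homomorphism $\Delta:A\to A\otimes A$ with $\Delta(u_{ij})=\sum_k u_{ik}\otimes u_{kj}$, and $u^t$ is invertible. It is orthogonal if $u_{ij}^*=u_{ij}$ for all $i,j$. Two CMQGs are isomorphic if there is a $*$-isomorphism between them mapping the fundamental corepresentation $u$ entrywise to the other fundamental corepresentation. Partitions: $P(k,l)$ is the set of set partitions (into blocks) of $k$ upper and $l$ lower points, each row ordered from left to right. Operations: tensor product (juxtaposition); composition $qp\in P(k,m)$ for $p\in P(k,l)$, $q\in P(l,m)$ (put $p$ above $q$, join along the $l$ middle points, delete the middle points and any blocks contained in them); involution (turn upside down); rotation (moving the leftmost, or rightmost, point of one row to the leftmost, resp. rightmost, position of the other row, keeping blocks). A category of partitions $\mathcal{C}$ is a collection of subsets $\mathcal{C}(k,l)\subset P(k,l)$, $k,l\ge0$, closed under these operations and containing the one-block pair partition on two points. For $p\in P(k,l)$, $T_p:(\mathbb{C}^n)^{\otimes k}\to(\mathbb{C}^n)^{\otimes l}$ is $T_p(e_{i_1}\otimes\cdots\otimes e_{i_k})=\sum_{j}\delta_p(i,j)\,e_{j_1}\otimes\cdots\otimes e_{j_l}$, where $\delta_p(i,j)=1$ if labelling the upper points by $i$ and the lower points by $j$ gives equal labels on each block of $p$, and $0$ otherwise. An orthogonal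 CMQG $(A,u)$ of size $n$ is called an easy quantum group if there is a category of partitions $\mathcal{C}$ such that for all $k,l$ the space $\{T: Tu^{\otimes k}=u^{\otimes l}T\}$ of intertwiners equals $\mathrm{span}\{T_p:p\in\mathcal{C}(k,l)\}$. Easy quantum groups are taken in their maximal version, i.e. $A$ is the universal enveloping $C^*$-algebra of the $*$-algebra generated by the $u_{ij}$. *)

(* Defs.v *)
From HB Require Import structures.
From mathcomp Require Import all_boot all_order all_algebra.
From mathcomp Require Import complex.
From mathcomp Require Import all_classical all_reals all_analysis.
Import numFieldNormedType.Exports.

Set Implicit Arguments.
Unset Strict Implicit.
Unset Printing Implicit Defensive.
Import Order.TTheory GRing.Theory Num.Theory.
Local Open Scope ring_scope.
Local Open Scope complex_scope.

Definition norm_complete (R : realType) (V : zmodType) (N : V -> R) : Prop :=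
  forall v : nat -> V,
    (forall e : R, 0 < e ->
       exists n0, forall m n, (n0 <= m)%N -> (n0 <= n)%N -> N (v m - v n) < e) ->
    exists l : V, forall e : R, 0 < e ->
       exists n0, forall n, (n0 <= n)%N -> N (v n - l) < e.

(* The norm is a real-valued field of the structure: the hierarchy has no join
   of the noncommutative rings with the normed modules, so an algType cannot
   also be a normedModType. *)
HB.mixin Record isCStarAlgebra (R : realType) (A : Type)
    of GRing.Algebra R[i] A := {
  star : A -> A;
  cnorm : A -> R;
  starK : involutive star;
  starD : {morph star : x y / x + y};
  starZ : forall (c : R[i]) (x : A), star (c *: x) = conjc c *: star x;
  starM : forall x y : A, star (x * y) = star y * star x;
  cnorm_eq0 : forall x : A, cnorm x = 0 -> x = 0;
  cnormD : forall x y : A, cnorm (x + y) <= cnorm x + cnorm y;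
  cnormZ : forall (c : R[i]) (x : A), (cnorm (c *: x))%:C = `|c| * (cnorm x)%:C;
  cnormM : forall x y : A, cnorm (x * y) <= cnorm x * cnorm y;
  cnorm_star : forall x : A, cnorm (star x * x) = cnorm x ^+ 2;
  cnorm_complete : norm_complete cnorm
}.

#[short(type="cstarAlgType")]
HB.structure Definition CStarAlgebra (R : realType) :=
  {A of GRing.Algebra R[i] A & isCStarAlgebra R A}.

Definition star_hom (R : realType) (A B : cstarAlgType R) (f : A -> B) : Prop :=
  {morph f : x / star x}.

Inductive star_subalg (R : realType) (A : cstarAlgType R) (S : A -> Prop) :
    A -> Prop :=
| star_subalg_gen x : S x -> star_subalg S x
| star_subalg_1 : star_subalg S 1
| star_subalg_D x y : star_subalg S x -> star_subalg S y -> star_subalg S (x + y)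
| star_subalg_Z c x : star_subalg S x -> star_subalg S (c *: x)
| star_subalg_M x y : star_subalg S x -> star_subalg S y -> star_subalg S (x * y)
| star_subalg_star x : star_subalg S x -> star_subalg S (star x).

Definition cdense (R : realType) (A : cstarAlgType R) (D : A -> Prop) : Prop :=
  forall (x : A) (e : R), 0 < e -> exists2 y, D y & cnorm (x - y) < e.

(* A is the universal enveloping C*-algebra of its unital *-subalgebra P: every
   unital *-homomorphism from P to a C*-algebra B (represented by the values on
   P of a function on A) extends to A.  When P is dense the extension is
   unique. *)
Definition enveloping (R : realType) (A : cstarAlgType R) (P : A -> Prop) : Prop :=
  cdense P /\
  forall (B : cstarAlgType R) (f : A -> B),
    f 1 = 1 ->
    (forall x y, P x -> P y -> f (x + y) = f x + f y) ->
    (forall c x, P x -> f (c *: x) = c *: f x) ->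
    (forall x y, P x -> P y -> f (x * y) = f x * f y) ->
    (forall x, P x -> f (star x) = star (f x)) ->
    exists F : {lrmorphism A -> B},
      star_hom F /\ forall x, P x -> F x = f x.

Record hilbert (R : realType) := Hilbert {
  hspace :> completeNormedModType R[i];
  hdot : hspace -> hspace -> R[i];
  hdotP : forall (c : R[i]) x y z, hdot (c *: x + y) z = c * hdot x z + hdot y z;
  hdotC : forall x y, hdot x y = conjc (hdot y x);
  hdot_norm : forall x, hdot x x = `|x| ^+ 2
}.

Record star_rep (R : realType) (A : cstarAlgType R) (H : hilbert R)
    (pi : A -> H -> H) : Prop := StarRep {
  rep_op_linear : forall a (c : R[i]) x y,
    pi a (c *: x + y) = c *: pi a x + pi a y;
  rep_op_bounded : forall a, exists M : R[i], forall x, `|pi a x| <= M * `|x|;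
  rep_linear : forall (c : R[i]) a b x, pi (c *: a + b) x = c *: pi a x + pi b x;
  rep_mul : forall a b x, pi (a * b) x = pi a (pi b x);
  rep_one : forall x, pi 1 x = x;
  rep_star : forall a x y, hdot (pi (star a) x) y = hdot x (pi a y)
}.

(* Elements of an algebraic tensor product are represented by lists of pairs,
   s standing for \sum_(p <- s) p.1 (x) p.2. *)
Definition tensor_norm2 (R : realType) (H K : hilbert R) (t : seq (H * K)) : R[i] :=
  \sum_(p <- t) \sum_(q <- t) hdot p.1 q.1 * hdot p.2 q.2.

Definition tensor_act (R : realType) (A B : cstarAlgType R) (H K : hilbert R)
    (pi : A -> H -> H) (rho : B -> K -> K) (s : seq (A * B)) (t : seq (H * K)) :
    seq (H * K) :=
  [seq (pi ab.1 xy.1, rho ab.2 xy.2) | ab <- s, xy <- t].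

(* The operator norm of (pi (x) rho)(s), computed on the dense subspace of
   algebraic tensors of the Hilbert space H (x) K, is at most M for all
   representations pi and rho. *)
Definition spatial_bound (R : realType) (A B : cstarAlgType R)
    (s : seq (A * B)) (M : R) : Prop :=
  forall (H K : hilbert R) (pi : A -> H -> H) (rho : B -> K -> K),
    star_rep pi -> star_rep rho ->
    forall t : seq (H * K),
      tensor_norm2 (tensor_act pi rho s t) <= (M ^+ 2)%:C * tensor_norm2 t.

(* (T, tens) is the spatial (minimal) C*-tensor product of A and B: the
   completion of the algebraic tensor product for the norm
   sup_(pi, rho) `|(pi (x) rho)(s)|. *)
Record spatial_tensor (R : realType) (A B T : cstarAlgType R)
    (tens : A -> B -> T) : Prop := SpatialTensor {
  tens_linearl : forall (c : R[i]) a a' b,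
    tens (c *: a + a') b = c *: tens a b + tens a' b;
  tens_linearr : forall (c : R[i]) a b b',
    tens a (c *: b + b') = c *: tens a b + tens a b';
  tens_mul : forall a a' b b', tens a b * tens a' b' = tens (a * a') (b * b');
  tens_one : tens 1 1 = 1;
  tens_star : forall a b, star (tens a b) = tens (star a) (star b);
  tens_dense :
    cdense (fun x : T => exists s : seq (A * B), x = \sum_(p <- s) tens p.1 p.2);
  tens_norm : forall (s : seq (A * B)) (M : R), 0 <= M ->
    (cnorm (\sum_(p <- s) tens p.1 p.2) <= M <-> spatial_bound s M)
}.

Definition star_mx (R : realType) (A : cstarAlgType R) (n : nat) (u : 'M[A]_n) :
  'M[A]_n := \matrix_(i, j) star (u j i).

Definition mx_coeff_alg (R : realType) (A : cstarAlgType R) (n : nat)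
    (u : 'M[A]_n) : A -> Prop :=
  star_subalg (fun x => exists i j, x = u i j).

Record is_cmqg (R : realType) (n : nat) (A : cstarAlgType R) (u : 'M[A]_n) :
    Prop := IsCMQG {
  cmqg_unitaryl : star_mx u *m u = 1%:M;
  cmqg_unitaryr : u *m star_mx u = 1%:M;
  cmqg_generated : cdense (mx_coeff_alg u);
  cmqg_comult : exists (T : cstarAlgType R) (tens : A -> A -> T),
    spatial_tensor tens /\
    exists Delta : {lrmorphism A -> T},
      star_hom Delta /\
      forall i j, Delta (u i j) = \sum_k tens (u i k) (u k j);
  cmqg_trmx_inv : exists v : 'M[A]_n, v *m u^T = 1%:M /\ u^T *m v = 1%:M
}.

Record cmqg (R : realType) := CMQG {
  qg_size : nat;
  qg_size_gt0 : (0 < qg_size)%N;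
  qg_alg : cstarAlgType R;
  qg_fund : 'M[qg_alg]_qg_size;
  qg_is_cmqg : is_cmqg qg_fund
}.

Definition cmqg_iso (R : realType) (G H : cmqg R) : Prop :=
  exists (e : qg_size G = qg_size H) (phi : {lrmorphism qg_alg G -> qg_alg H}),
    [/\ star_hom phi, bijective phi &
        forall i j,
          phi (qg_fund G i j) = qg_fund H (cast_ord e i) (cast_ord e j)].

Definition orthogonal_cmqg (R : realType) (G : cmqg R) : Prop :=
  forall i j, star (qg_fund G i j) = qg_fund G i j.

Definition maximal_cmqg (R : realType) (G : cmqg R) : Prop :=
  enveloping (mx_coeff_alg (qg_fund G)).

Definition setpart (X : finType) := {P : {set {set X}} | finset.partition P [set: X]%SET}.

Definition same_block (X : finType) (p : setpart X) : rel X :=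
  fun x y => y \in finset.pblock (val p) x.

Definition sym_closure (X : finType) (r : rel X) : rel X :=
  fun x y => r x y || r y x.

Lemma components_subproof (X : finType) (r : rel X) :
  finset.partition (equivalence_partition (connect (sym_closure r)) [set: X]%SET)
            [set: X]%SET.
Proof.
apply: equivalence_partitionP => x y z _ _ _; split; first exact: connect0.
have rC : connect_sym (sym_closure r).
  by apply: sym_connect_sym => a b; rewrite /sym_closure orbC.
by move=> xy; exact: (same_connect rC xy).
Qed.

(* the partition of X into the connected components of the graph r *)
Definition components (X : finType) (r : rel X) : setpart X :=
  exist (fun P => is_true (finset.partition P [set: X]%SET)) _
    (components_subproof r).

Definition partn (k l : nat) := setpart ('I_k + 'I_l)%type.

(* p, on X, and q, on Y, both transported to Z. *)
Definition overlay (X Y Z : finType) (f : X -> Z) (g : Y -> Z)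
    (p : setpart X) (q : setpart Y) : rel Z :=
  fun z z' =>
    [exists x, exists x', [&& f x == z, f x' == z' & same_block p x x']] ||
    [exists y, exists y', [&& g y == z, g y' == z' & same_block q y y']].

Definition part_tensor (k l k' l' : nat) (p : partn k l) (q : partn k' l') :
    partn (k + k') (l + l') :=
  components (overlay
    (fun x : 'I_k + 'I_l => match x with
       | inl i => inl (lshift k' i) | inr j => inr (lshift l' j) end)
    (fun x : 'I_k' + 'I_l' => match x with
       | inl i => inl (rshift k i) | inr j => inr (rshift l j) end)
    p q).

(* p is placed above q; the points of the joined diagram are
   upper + (middle + lower). *)
Definition part_comp (k l m : nat) (q : partn l m) (p : partn k l) : partn k m :=
  let joined : rel ('I_k + ('I_l + 'I_m))%type :=
    overlay (fun x : 'I_k + 'I_l => match x with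
               | inl i => inl i | inr j => inr (inl j) end)
            (fun x : 'I_l + 'I_m => inr x)
            p q in
  let outer (x : 'I_k + 'I_m) : 'I_k + ('I_l + 'I_m) :=
    match x with inl i => inl i | inr j => inr (inr j) end in
  components (fun x y => connect joined (outer x) (outer y)).

Definition part_pull (X Y : finType) (f : Y -> X) (p : setpart X) : setpart Y :=
  components (fun y y' => same_block p (f y) (f y')).

Definition part_inv (k l : nat) (p : partn k l) : partn l k :=
  part_pull (fun x : 'I_l + 'I_k => match x with
               | inl i => inr i | inr j => inl j end) p.

Definition end_pt (left : bool) (k : nat) : 'I_k.+1 :=
  if left then ord0 else ord_max.

(* moves the leftmost (left = true) or rightmost (left = false) upper point to
   the same end of the lower row *)
Definition part_rot_down (left : bool) (k l : nat) (p : partn k.+1 l) :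
    partn k l.+1 :=
  part_pull (fun x : 'I_k + 'I_l.+1 => match x with
    | inl i => inl (lift (end_pt left k) i)
    | inr j => match unlift (end_pt left l) j with
               | Some j' => inr j' | None => inl (end_pt left k) end
    end) p.

Definition part_rot_up (left : bool) (k l : nat) (p : partn k l.+1) :
    partn k.+1 l :=
  part_pull (fun x : 'I_k.+1 + 'I_l => match x with
    | inl i => match unlift (end_pt left k) i with
               | Some i' => inl i' | None => inr (end_pt left l) end
    | inr j => inr (lift (end_pt left l) j)
    end) p.

Definition pair_part : partn 0 2 := components (fun _ _ => true).

Record category_of_partitions (C : forall k l, {set partn k l}) : Prop :=
  CategoryOfPartitions {
  cat_tensor : forall k l k' l' (p : partn k l) (q : partn k' l'),
    p \in C k l -> q \in C k' l' -> part_tensor p q \in C (k + k')%N (l + l')%N;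
  cat_comp : forall k l m (p : partn k l) (q : partn l m),
    p \in C k l -> q \in C l m -> part_comp q p \in C k m;
  cat_inv : forall k l (p : partn k l), p \in C k l -> part_inv p \in C l k;
  cat_rot_down : forall left k l (p : partn k.+1 l),
    p \in C k.+1 l -> part_rot_down left p \in C k l.+1;
  cat_rot_up : forall left k l (p : partn k l.+1),
    p \in C k l.+1 -> part_rot_up left p \in C k.+1 l;
  cat_pair : pair_part \in C 0%N 2%N
}.

Definition multi_index (n k : nat) := {ffun 'I_k -> 'I_n}.

(* Linear maps (C^n)^{(x) k} -> (C^n)^{(x) l}, given by their matrix entries in
   the standard bases: T (j, i) is the coefficient of e_j in T (e_i). *)
Definition tensor_map (R : realType) (n k l : nat) :=
  {ffun multi_index n l * multi_index n k -> R[i]^o}.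

Definition part_delta (n k l : nat) (p : partn k l)
    (i : multi_index n k) (j : multi_index n l) : bool :=
  let label (x : 'I_k + 'I_l) : 'I_n :=
    match x with inl s => i s | inr t => j t end in
  [forall B in val p, forall x in B, forall y in B, label x == label y].

Definition part_map (R : realType) (n k l : nat) (p : partn k l) :
    tensor_map R n k l :=
  [ffun ji => (part_delta p ji.2 ji.1)%:R].

Definition mx_tensor_pow (A : pzRingType) (n : nat) (u : 'M[A]_n) (k : nat)
    (i j : multi_index n k) : A :=
  \prod_(s < k) u (i s) (j s).

(* T u^{(x) k} = u^{(x) l} T, entrywise *)
Definition intertwiner (R : realType) (A : cstarAlgType R) (n : nat)
    (u : 'M[A]_n) (k l : nat) (T : tensor_map R n k l) : Prop :=
  forall (j : multi_index n l) (i : multi_index n k),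
    \sum_(i' : multi_index n k) (T (j, i') : R[i]) *: mx_tensor_pow u i' i =
    \sum_(j' : multi_index n l) (T (j', i) : R[i]) *: mx_tensor_pow u j j'.

Definition is_easy (R : realType) (G : cmqg R) : Prop :=
  exists C : forall k l, {set partn k l},
    category_of_partitions C /\
    forall (k l : nat) (T : tensor_map R (qg_size G) k l),
      intertwiner (qg_fund G) T <->
      T \in <<[seq part_map R (qg_size G) p | p in C k l]>>%VS.

Record easy_quantum_group (R : realType) := EasyQuantumGroup {
  easy_cmqg :> cmqg R;
  easy_orthogonal : orthogonal_cmqg easy_cmqg;
  easy_maximal : maximal_cmqg easy_cmqg;
  easy_is_easy : is_easy easy_cmqg
}.

(* Main.v *)
(* Fix involutions g_1, ..., g_n in permutation groups.  Call two words in n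
   letters equivalent if they act equally after every map of the letters.  The
   tensors T that are S_n-invariant and satisfy T(j, i) = 0 unless the words j
   and i are equivalent are spanned by the T_p they contain: T_p minus the
   orbit of its generic labelling is supported on labellings with fewer labels.
   The universal C*-algebra generated by self-adjoint u_ij intertwined by all
   these T is an easy quantum group.  It has no other intertwiners, because
   u_ij = [i = s(j)], for s in S_n, and u_ij = delta_ij g_i are representations
   of its relations.  In particular the word relations are an isomorphism
   invariant.

   It remains to find, for n = 3, finite groups G_p generated by three
   involutions and words w_p such that w_p is nontrivial in G_p but trivial in
   G_q for q <> p under all maps of the letters.  Then every set J of indices
   gives the quantum group of the groups G_p, p in J, and J can be recovered.
   Take two reflections a, b of a cyclic group without fixed points and a
   transposition c exchanging 0 and (a b)^k 0, where k = 4 ^ (p + 1).  With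
   t = (a b)^k and q = [c, t c t^-1], the word w_p = [q, t q t^-1] detects
   whether the transposition c meets its translate by t. *)

Require Import Defs.
From mathcomp Require Import all_boot all_order all_algebra.
From mathcomp Require Import all_classical all_reals all_analysis.
From HB Require Import structures.
From mathcomp Require Import complex generic_quotient perm.
From mathcomp Require Import lra ring zify.
Import numFieldNormedType.Exports.

Set Implicit Arguments.
Unset Strict Implicit.
Unset Printing Implicit Defensive.
Import Order.TTheory GRing.Theory Num.Theory.
Local Open Scope ring_scope.
Local Open Scope complex_scope.

(** * Null sequences and C*-algebras *)

(** The test words must die in the other groups under every map of the three letters, and this
    shapes them. If the two rotation letters are identified, t is trivial. If z is identified with
    one of them, z inverts t and q is a power of t: the second commutator is there to kill this
    case. If an injective map turns z into a reflection, t is a power of a product of a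
    transposition and a reflection, an element of order 4, so k must be a multiple of 4. There
    remains translation by 2k or -2k. It has to vanish in the groups of smaller index, and in those
    of larger index to be too short for the transposition to meet its translate; hence k = 4^(p+1)
    and the modulus 8 * 4^(p+1).

    The universal norm is a supremum over all C*-algebras, the spatial norm one over all pairs of
    representations. Both must be finite, and nonzero at 1. Finiteness comes from u_ij^3 = u_ij, the
    relation of the one-block partition on one upper and three lower points, and, for tensors, from
    square roots of c^2 - a* a. The counit keeps both norms nonzero at 1. *)

Section NullSequences.
Variable R : realType.
Implicit Types a b : nat -> R.

(** No absolute value: the sequences are mostly norms of differences, and an upper bound
    [a n <= b n] alone then transfers nullity. A constant null sequence is only known to be
    nonpositive. *)
Definition null a := forall e, 0 < e -> exists n0, forall n, (n0 <= n)%N -> a n < e.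

Lemma nullD a b : null a -> null b -> null (fun n => a n + b n).
Proof.
move=> ha hb e e0; have e2 : 0 < e / 2 by lra.
have [m hm] := ha _ e2; have [m' hm'] := hb _ e2.
exists (maxn m m') => n; rewrite geq_max => /andP[h h'].
by have := hm _ h; have := hm' _ h'; lra.
Qed.

Lemma nullM a c : 0 <= c -> null a -> null (fun n => c * a n).
Proof.
move=> c0 ha e e0.
have c1 : 0 < c + 1 by lra.
have [m hm] := ha _ (divr_gt0 e0 c1); exists m => n /hm.
rewrite ltr_pdivlMr // => h; have [a0|a0] := lerP (a n) 0; last by lra.
by apply: le_lt_trans e0; rewrite mulr_ge0_le0.
Qed.

Lemma null_le a b : (forall n, a n <= b n) -> null b -> null a.
Proof.
move=> ab hb e /hb[m hm]; exists m => n /hm; exact: le_lt_trans.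
Qed.

Lemma null_cst_le0 c : null (fun=> c) -> c <= 0.
Proof.
move=> h; rewrite leNgt; apply/negP => /h[m /(_ m (leqnn m))].
by rewrite ltxx.
Qed.

Lemma null_geometric c q : 0 <= q < 1 -> null (fun n => c * q ^+ n).
Proof.
move=> /andP[q0 q1] e e0.
have /(cvg_geometric c)/cvgrPdist_lt /(_ _ e0)[m _ hm] : `|q| < 1 by rewrite ger0_norm.
exists m => n mn; have := hm n mn; rewrite /= sub0r normrN.
exact: le_lt_trans (ler_norm _).
Qed.

Lemma null_inv : null (fun n => n.+1%:R^-1).
Proof.
move=> e e0; have /cvgrPdist_lt /(_ _ e0)[m _ hm] := @cvg_harmonic R.
exists m => n mn; have := hm n mn; rewrite /= sub0r normrN.
exact: le_lt_trans (ler_norm _).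
Qed.

Definition tends a l := null (fun n => `|a n - l|).

Lemma tendsP a l : tends a l <-> (a n @[n --> \oo] --> l)%classic.
Proof.
split=> [h|/cvgrPdist_lt h e /h[m _ hm]].
  apply/cvgrPdist_lt => e /h[m hm]; exists m => // n /hm.
  by rewrite distrC.
by exists m => n /hm; rewrite distrC.
Qed.

Lemma tends_cst l : tends (fun=> l) l.
Proof. by apply/tendsP; apply: cvg_cst. Qed.

Lemma tendsD a b l m : tends a l -> tends b m -> tends (fun n => a n + b n) (l + m).
Proof. by move=> /tendsP ha /tendsP hb; apply/tendsP; apply: cvgD. Qed.

Lemma tendsM a b l m : tends a l -> tends b m -> tends (fun n => a n * b n) (l * m).
Proof. by move=> /tendsP ha /tendsP hb; apply/tendsP; apply: cvgM. Qed.

Lemma tends_le a b l m :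
  (forall n, a n <= b n) -> tends a l -> tends b m -> l <= m.
Proof.
move=> ab ha hb; rewrite -subr_le0; apply: null_cst_le0.
apply: null_le (nullD ha hb) => n; have := ab n.
have := ler_norm (l - a n); have := ler_norm (b n - m); rewrite (distrC l); lra.
Qed.

Lemma tends_eq a l m : tends a l -> tends a m -> l = m.
Proof.
by move=> al am; apply/eqP; rewrite eq_le !(tends_le (fun n => lexx (a n))).
Qed.

Lemma tends_close a b l : null (fun n => `|b n - a n|) -> tends a l -> tends b l.
Proof.
move=> ba al; apply: null_le (nullD ba al) => n.
by have := ler_normD (b n - a n) (a n - l); rewrite subrKA.
Qed.

Lemma tends_cauchy a :
  (forall e, 0 < e -> exists n0, forall n, (n0 <= n)%N -> `|a n - a n0| < e) ->
  exists l, tends a l.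
Proof.
move=> h; suff /cvg_ex[l /tendsP] : cvg (a n @[n --> \oo])%classic by exists l.
apply: cauchy_cvg; apply: cauchy_exP => e /h[m hm]; exists (a m), m => // n /hm.
by rewrite /= /ball /= distrC.
Qed.

End NullSequences.

Section ComplexModulus.
Variable R : realType.

(** The modulus as an element of [R]: in [R[i]] the norm of a complex number is itself complex. *)
Definition cabs (c : R[i]) : R := complex.Re `|c|.

Lemma cabsE c : (cabs c)%:C = `|c|.
Proof. by rewrite /cabs normc_def. Qed.

Lemma cabs_ge0 c : 0 <= cabs c.
Proof. by rewrite -lecR cabsE normr_ge0. Qed.

Lemma real_complex_inj (a b : R) : a%:C = b%:C -> a = b.
Proof. by case. Qed.

End ComplexModulus.

Section CStarTheory.
Variables (R : realType) (A : cstarAlgType R).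
Implicit Types x y h : A.

Lemma cnormZ_cabs c x : cnorm (c *: x) = cabs c * cnorm x.
Proof. by apply: real_complex_inj; rewrite cnormZ rmorphM /= cabsE. Qed.

Lemma cnorm0 : cnorm (0 : A) = 0.
Proof.
by apply: real_complex_inj; rewrite -[X in cnorm X](scale0r 0) cnormZ normr0 mul0r.
Qed.

Lemma cnormN x : cnorm (- x) = cnorm x.
Proof.
by apply: real_complex_inj; rewrite -scaleN1r cnormZ normrN normr1 mul1r.
Qed.

Lemma cnorm_ge0 x : 0 <= cnorm x.
Proof. by have := cnormD x (- x); rewrite subrr cnorm0 cnormN; lra. Qed.

Lemma cnorm_distC x y : cnorm (x - y) = cnorm (y - x).
Proof. by rewrite -cnormN opprB. Qed.

Lemma cnorm_triangle z x y : cnorm (x - y) <= cnorm (x - z) + cnorm (z - y).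
Proof. by have := cnormD (x - z) (z - y); rewrite subrKA. Qed.

Lemma cnorm_le_dist x y : cnorm x <= cnorm (x - y) + cnorm y.
Proof. by have := cnormD (x - y) y; rewrite subrK. Qed.

Lemma star0 : star (0 : A) = 0.
Proof. by have := @starZ R A 0 0; rewrite conjc0 !scale0r. Qed.

Lemma starN x : star (- x) = - star x.
Proof. by rewrite -scaleN1r starZ rmorphN1 scaleN1r. Qed.

Lemma starB x y : star (x - y) = star x - star y.
Proof. by rewrite starD starN. Qed.

Lemma star1 : star (1 : A) = 1.
Proof. by rewrite -[LHS]mulr1 -{2}(starK 1) -starM mulr1 starK. Qed.

Lemma star_sum (I : Type) (r : seq I) (P : pred I) (F : I -> A) :
  star (\sum_(i <- r | P i) F i) = \sum_(i <- r | P i) star (F i).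
Proof. exact: (big_morph star starD star0). Qed.

Lemma cnorm1 : cnorm (1 : A) = 1.
Proof.
have := cnorm_star (1 : A); rewrite star1 mulr1 => h.
have : cnorm (1 : A) * (cnorm (1 : A) - 1) = 0 by rewrite mulrBr mulr1 -expr2 -h subrr.
move/eqP; rewrite mulf_eq0 => /orP[/eqP/cnorm_eq0/eqP|]; first by rewrite oner_eq0.
by rewrite subr_eq0 => /eqP.
Qed.

Lemma cnorm_le_star x : cnorm x <= cnorm (star x).
Proof.
have [->|x0] := eqVneq (cnorm x) 0; first exact: cnorm_ge0.
have xp : 0 < cnorm x by rewrite lt_def x0 cnorm_ge0.
by have := cnormM (star x) x; rewrite cnorm_star expr2 ler_pM2r.
Qed.

Lemma cnorm_starE x : cnorm (star x) = cnorm x.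
Proof.
by apply/eqP; rewrite eq_le -{2}(starK x) !cnorm_le_star.
Qed.

Lemma cnormZ_real (c : R) x : 0 <= c -> cnorm (c%:C *: x) = c * cnorm x.
Proof.
move=> c0; apply: real_complex_inj.
by rewrite cnormZ ger0_norm ?lecR // -rmorphM.
Qed.

(* The fixed point of [y |-> (h + y ^ 2) / 2], a contraction of the ball of
   radius [cnorm h], satisfies [(1 - y) ^ 2 = 1 - h]. *)
Lemma cstar_sqrt_1B h : star h = h -> cnorm h < 1 ->
  exists b, star b = b /\ b * b = 1 - h.
Proof.
move=> hs h1; set q := cnorm h; have q0 : 0 <= q := cnorm_ge0 h.
pose phi y := (2^-1)%:C *: (h + y * y).
have half0 : 0 <= 2^-1 :> R by rewrite invr_ge0 ler0n.
have phi_ball y : cnorm y <= q -> cnorm (phi y) <= q.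
  move=> yq; rewrite cnormZ_real //.
  have := cnormD h (y * y); have := cnormM y y.
  have : cnorm y * cnorm y <= q * 1 by rewrite ler_pM ?cnorm_ge0 // (le_trans yq) ?ltW.
  by rewrite -/q; lra.
have phi_contr y z : cnorm y <= q -> cnorm z <= q ->
    cnorm (phi y - phi z) <= q * cnorm (y - z).
  move=> yq zq; rewrite -scalerBr cnormZ_real // opprD addrACA subrr add0r.
  have -> : y * y - z * z = y * (y - z) + (y - z) * z.
    by rewrite mulrBr mulrBl addrA subrK.
  have := cnormD (y * (y - z)) ((y - z) * z).
  have := cnormM y (y - z); have := cnormM (y - z) z.
  have := ler_wpM2r (cnorm_ge0 (y - z)) yq; have := ler_wpM2l (cnorm_ge0 (y - z)) zq.
  by rewrite [_ * q]mulrC; lra.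
pose v n := iter n phi 0.
have v_ball n : cnorm (v n) <= q.
  by elim: n => [|n IH]; rewrite /v /= ?cnorm0 //; apply: phi_ball.
(* The diameter bound [2 * q] of the ball shrinks by the factor [q] at each step. The starting
   points are arbitrary because [v m] and [v n] are the [n0]-th iterates of [v (m - n0)] and
   [v (n - n0)], which gives the Cauchy property without summing a series. *)
have v_contr n y z : cnorm y <= q -> cnorm z <= q ->
    cnorm (iter n phi y - iter n phi z) <= 2 * q * q ^+ n.
  have hball x k : cnorm x <= q -> cnorm (iter k phi x) <= q.
    by elim: k => [|k IH] //= /IH; apply: phi_ball.
  move=> yq zq; elim: n => [|n IH] /=.
    by rewrite expr0 mulr1; have := cnormD y (- z); rewrite cnormN; lra.
  apply: le_trans (phi_contr _ _ (hball _ _ yq) (hball _ _ zq)) _.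
  by rewrite exprS mulrCA; apply: ler_wpM2l.
have /cnorm_complete[y hy] : forall e : R, 0 < e ->
    exists n0, forall m n, (n0 <= m)%N -> (n0 <= n)%N -> cnorm (v m - v n) < e.
  move=> e e0.
  have [|n0 hn0] := @null_geometric R (2 * q) q _ e e0; first by apply/andP.
  exists n0 => m n nm nn; apply: le_lt_trans (hn0 n0 (leqnn _)).
  rewrite -(subnKC nm) -(subnKC nn) /v !iterD.
  by apply: v_contr; exact: v_ball.
have vy : null (fun n => cnorm (v n - y)) by [].
have yq : cnorm y <= q.
  suff : cnorm y - q <= 0 by lra.
  apply: null_cst_le0; apply: null_le vy => n.
  by have := cnorm_le_dist y (v n); rewrite cnorm_distC; have := v_ball n; lra.
have ys : star y = y.
  apply/eqP; rewrite -subr_eq0; apply/eqP/cnorm_eq0/eqP.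
  rewrite eq_le cnorm_ge0 andbT.
  apply: null_cst_le0; apply: null_le (nullD vy vy) => n.
  have vs : star (v n) = v n.
    elim: n => [|n IH]; first exact: star0.
    by rewrite /v /= starZ conjc_real starD starM -/(v n) IH hs.
  apply: le_trans (cnorm_triangle (v n) _ _) _; rewrite lerD2r.
  by rewrite -{1}vs -starB cnorm_starE cnorm_distC.
have yfix : y = phi y.
  apply/eqP; rewrite -subr_eq0; apply/eqP/cnorm_eq0/eqP.
  rewrite eq_le cnorm_ge0 andbT.
  have vy' : null (fun n => cnorm (v n.+1 - y)).
    by move=> e /vy[n0 hn]; exists n0 => n /leqW/hn.
  apply: null_cst_le0; apply: null_le (nullD vy vy') => n.
  apply: le_trans (cnorm_triangle (v n.+1) _ _) _.
  rewrite cnorm_distC addrC lerD2r.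
  apply: le_trans (phi_contr _ _ (v_ball n) yq) _.
  by have := cnorm_ge0 (v n - y); rewrite -/q in h1 *; nra.
have y2 : y + y = h + y * y.
  rewrite {1 2}yfix -scalerDl -rmorphD /=.
  by rewrite (_ : 2^-1 + 2^-1 = 1 :> R) ?scale1r //; lra.
exists (1 - y); split; first by rewrite starB star1 ys.
rewrite mulrBl mul1r mulrBr mulr1.
have -> : h = y + y - y * y by rewrite y2 addrK.
by rewrite !opprD !opprK !addrA.
Qed.

(** Writing c^2 - x* x as b* b turns a bound on the norm of [x] into an operator inequality in every
    representation ([star_rep_contract]). The element x* x / c^2 has norm below 1, so
    [cstar_sqrt_1B] applies to it. *)
Lemma cstar_sqrt_bound x (c : R) : cnorm x < c ->
  exists b, star b * b = (c ^+ 2)%:C *: 1 - star x * x.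
Proof.
move=> xc; have c0 : 0 < c by apply: le_lt_trans xc; apply: cnorm_ge0.
have c20 : 0 <= c ^- 2 by rewrite invr_ge0 exprn_ge0 // ltW.
have [||b [bs bb]] := @cstar_sqrt_1B ((c ^- 2)%:C *: (star x * x)).
- by rewrite starZ starM starK conjc_real.
- rewrite cnormZ_real // cnorm_star mulrC ltr_pdivrMr ?exprn_gt0 // mul1r.
  by rewrite ltr_pXn2r // nnegrE ?cnorm_ge0 // ltW.
exists (c%:C *: b); rewrite starZ conjc_real bs.
rewrite -scalerAl -scalerAr scalerA -rmorphM -expr2 /= bb scalerBr scalerA -rmorphM.
by rewrite mulfV ?scale1r // expf_neq0 // gt_eqF.
Qed.

End CStarTheory.

(** * Completion of a C*-seminormed *-algebra *)

(** [pc_norm] is only a seminorm; its null vectors are divided out by the completion. The last field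
    keeps 1 different from 0 there. *)
Record precstar (R : realType) := PreCStar {
  pc_alg :> algType R[i];
  pc_star : pc_alg -> pc_alg;
  pc_norm : pc_alg -> R;
  pc_starK : involutive pc_star;
  pc_starD : {morph pc_star : x y / x + y};
  pc_starZ : forall (c : R[i]) x, pc_star (c *: x) = conjc c *: pc_star x;
  pc_starM : forall x y, pc_star (x * y) = pc_star y * pc_star x;
  pc_normD : forall x y, pc_norm (x + y) <= pc_norm x + pc_norm y;
  pc_normZ : forall (c : R[i]) x, (pc_norm (c *: x))%:C = `|c| * (pc_norm x)%:C;
  pc_normM : forall x y, pc_norm (x * y) <= pc_norm x * pc_norm y;
  pc_norm_star : forall x, pc_norm (pc_star x * x) = pc_norm x ^+ 2;
  pc_norm1_neq0 : pc_norm 1 != 0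
}.

Section Completion.
Variables (R : realType) (P : precstar R).
Local Notation N := (@pc_norm R P).
Local Notation st := (@pc_star R P).
Implicit Types p q : P.

Lemma pc_norm0 : N 0 = 0.
Proof.
by apply: real_complex_inj; rewrite -[X in N X](scale0r 0) pc_normZ normr0 mul0r.
Qed.

Lemma pc_normZ_cabs c p : N (c *: p) = cabs c * N p.
Proof. by apply: real_complex_inj; rewrite pc_normZ rmorphM /= cabsE. Qed.

Lemma pc_normN p : N (- p) = N p.
Proof.
by apply: real_complex_inj; rewrite -scaleN1r pc_normZ normrN normr1 mul1r.
Qed.

Lemma pc_norm_ge0 p : 0 <= N p.
Proof. by have := pc_normD p (- p); rewrite subrr pc_norm0 pc_normN; lra. Qed.

Lemma pc_norm_distC p q : N (p - q) = N (q - p).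
Proof. by rewrite -pc_normN opprB. Qed.

Lemma pc_norm_triangle r p q : N (p - q) <= N (p - r) + N (r - q).
Proof. by have := pc_normD (p - r) (r - q); rewrite subrKA. Qed.

Lemma pc_norm_dist p q : `|N p - N q| <= N (p - q).
Proof.
rewrite ler_distlC; have := pc_normD (p - q) q; have := pc_normD (q - p) p.
by rewrite !subrK pc_norm_distC; lra.
Qed.

Lemma pc_starB p q : st (p - q) = st p - st q.
Proof. by rewrite pc_starD -scaleN1r pc_starZ rmorphN1 scaleN1r. Qed.

Lemma pc_norm_starE p : N (st p) = N p.
Proof.
have le q : N q <= N (st q).
  have [->|q0] := eqVneq (N q) 0; first exact: pc_norm_ge0.
  have qp : 0 < N q by rewrite lt_def q0 pc_norm_ge0.
  by have := pc_normM (st q) q; rewrite pc_norm_star expr2 ler_pM2r.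
by apply/eqP; rewrite eq_le -{2}(pc_starK p) !le.
Qed.

Record cseq := CSeq {
  cs_val :> nat -> P;
  cs_cauchy : forall e : R, 0 < e ->
    exists n0, forall m n, (n0 <= m)%N -> (n0 <= n)%N -> N (cs_val m - cs_val n) < e
}.

HB.instance Definition _ := gen_eqMixin cseq.
HB.instance Definition _ := gen_choiceMixin cseq.

Implicit Types x y z : cseq.

Lemma cseq_ext x y : (forall n, x n = y n) -> x = y.
Proof.
case: x => x hx; case: y => y hy /= /funext xy; move: hx hy.
by rewrite xy => hx hy; congr CSeq; exact: Prop_irrelevance.
Qed.

Lemma cs_bounded x : exists2 B, 0 < B & forall n, N (x n) <= B.
Proof.
have [n0 h] := @cs_cauchy x 1 ltr01.
have S0 : 0 <= \sum_(i < n0) N (x i) by apply: sumr_ge0 => i _; apply: pc_norm_ge0.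
exists (\sum_(i < n0) N (x i) + N (x n0) + 1).
  by have := pc_norm_ge0 (x n0); lra.
move=> n; have [lt|le] := ltnP n n0.
  have := pc_norm_ge0 (x n0); rewrite (bigD1 (Ordinal lt)) //=.
  suff : 0 <= \sum_(i < n0 | i != Ordinal lt) N (x i) by lra.
  by apply: sumr_ge0 => i _; apply: pc_norm_ge0.
have := h n n0 le (leqnn _); have := pc_norm_dist (x n) (x n0).
by have := ler_norm (N (x n) - N (x n0)); lra.
Qed.

(** The single estimate behind the closure of Cauchy sequences under sum, scaling, product and star.
    For the product, [B] and [C] are bounds of the opposite factors. *)
Lemma cauchy_dom (x y : cseq) (z : nat -> P) (B C : R) : 0 <= B -> 0 <= C ->
  (forall m n, N (z m - z n) <= B * N (x m - x n) + C * N (y m - y n)) ->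
  forall e : R, 0 < e ->
    exists n0, forall m n, (n0 <= m)%N -> (n0 <= n)%N -> N (z m - z n) < e.
Proof.
move=> B0 C0 dom e e0.
have d0 : 0 < e / (B + C + 1) by rewrite divr_gt0 //; lra.
have [m1 h1] := @cs_cauchy x _ d0; have [m2 h2] := @cs_cauchy y _ d0.
exists (maxn m1 m2) => m n; rewrite !geq_max => /andP[a1 a2] /andP[b1 b2].
apply: le_lt_trans (dom m n) _.
have := h1 _ _ a1 b1; have := h2 _ _ a2 b2.
rewrite !ltr_pdivlMr; [|lra|lra].
have := pc_norm_ge0 (x m - x n); have := pc_norm_ge0 (y m - y n).
by move: (N (x m - x n)) (N (y m - y n)) => s t *; nra.
Qed.

Lemma cs_add_cauchy x y (e : R) : 0 < e -> exists n0, forall m n,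
  (n0 <= m)%N -> (n0 <= n)%N -> N (x m + y m - (x n + y n)) < e.
Proof.
move: e; apply: (@cauchy_dom x y (fun n => x n + y n) 1 1) => // m n.
by rewrite !mul1r opprD addrACA pc_normD.
Qed.

Lemma cs_scale_cauchy (c : R[i]) x (e : R) : 0 < e -> exists n0, forall m n,
  (n0 <= m)%N -> (n0 <= n)%N -> N (c *: x m - c *: x n) < e.
Proof.
move: e; apply: (@cauchy_dom x x (fun n => c *: x n) (cabs c) 0) => //.
  exact: cabs_ge0.
by move=> m n; rewrite mul0r addr0 -scalerBr pc_normZ_cabs.
Qed.

Lemma cs_mul_cauchy x y (e : R) : 0 < e -> exists n0, forall m n,
  (n0 <= m)%N -> (n0 <= n)%N -> N (x m * y m - x n * y n) < e.
Proof.
have [B B0 hB] := cs_bounded x; have [C C0 hC] := cs_bounded y; move: e.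
apply: (@cauchy_dom x y (fun n => x n * y n) C B); rewrite ?ltW // => m n.
have -> : x m * y m - x n * y n = (x m - x n) * y m + x n * (y m - y n).
  by rewrite mulrBl mulrBr addrA subrK.
apply: le_trans (pc_normD _ _) _; apply: lerD; apply: le_trans (pc_normM _ _) _.
  by rewrite mulrC ler_wpM2r ?pc_norm_ge0.
by rewrite ler_wpM2r ?pc_norm_ge0.
Qed.

Lemma cs_star_cauchy x (e : R) : 0 < e -> exists n0, forall m n,
  (n0 <= m)%N -> (n0 <= n)%N -> N (st (x m) - st (x n)) < e.
Proof.
move: e; apply: (@cauchy_dom x x (fun n => st (x n)) 1 0) => // m n.
by rewrite mul0r addr0 mul1r -pc_starB pc_norm_starE.
Qed.

Lemma cs_cst_cauchy p (e : R) : 0 < e -> exists n0, forall m n,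
  (n0 <= m)%N -> (n0 <= n)%N -> N (p - p) < e.
Proof. by move=> e0; exists 0%N => *; rewrite subrr pc_norm0. Qed.

Definition cs_add x y := @CSeq (fun n => x n + y n) (@cs_add_cauchy x y).
Definition cs_scale c x := @CSeq (fun n => c *: x n) (@cs_scale_cauchy c x).
Definition cs_mul x y := @CSeq (fun n => x n * y n) (@cs_mul_cauchy x y).
Definition cs_star x := @CSeq (fun n => st (x n)) (@cs_star_cauchy x).
Definition cs_cst p := @CSeq (fun=> p) (@cs_cst_cauchy p).

Definition cs_close x y := null (fun n => N (x n - y n)).

Lemma cs_close_refl x : cs_close x x.
Proof. by move=> e e0; exists 0%N => n _; rewrite subrr pc_norm0. Qed.

Lemma cs_close_sym x y : cs_close x y -> cs_close y x.
Proof. by move=> h; apply: null_le h => n; rewrite pc_norm_distC. Qed.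

Lemma cs_close_trans y x z : cs_close x y -> cs_close y z -> cs_close x z.
Proof. by move=> xy yz; apply: null_le (nullD xy yz) => n; apply: pc_norm_triangle. Qed.

Definition cs_rel : rel cseq := fun x y => `[< cs_close x y >].

Lemma cs_rel_equiv : equiv_class_of cs_rel.
Proof.
split=> [x|x y|y x z]; first by apply/asboolP/cs_close_refl.
  by apply/asboolP/asboolP; apply: cs_close_sym.
by move=> /asboolP xy /asboolP yz; apply/asboolP/(cs_close_trans xy yz).
Qed.

Canonical cs_equiv := EquivRelPack cs_rel_equiv.

Definition completion := {eq_quot cs_equiv}%qT.
HB.instance Definition _ := Choice.on completion.

Definition cpi (x : cseq) : completion := \pi_({eq_quot cs_equiv})%qT x.
Definition crepr (v : completion) : cseq := repr v.

Lemma creprK v : cpi (crepr v) = v.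
Proof. exact: reprK. Qed.

Lemma cpiP x y : cpi x = cpi y <-> cs_close x y.
Proof.
split=> [/eqmodP/asboolP //|h].
by apply/eqmodP/asboolP.
Qed.

Lemma crepr_close x : cs_close (crepr (cpi x)) x.
Proof. by apply/cpiP; rewrite creprK. Qed.

Definition cp_add v w := cpi (cs_add (crepr v) (crepr w)).
Definition cp_scale c v := cpi (cs_scale c (crepr v)).
Definition cp_mul v w := cpi (cs_mul (crepr v) (crepr w)).
Definition cp_star v := cpi (cs_star (crepr v)).

Lemma cpiD x y : cp_add (cpi x) (cpi y) = cpi (cs_add x y).
Proof.
apply/cpiP; apply: null_le (nullD (crepr_close x) (crepr_close y)) => n /=.
by rewrite opprD addrACA pc_normD.
Qed.

Lemma cpiZ c x : cp_scale c (cpi x) = cpi (cs_scale c x).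
Proof.
apply/cpiP; apply: null_le (nullM (cabs_ge0 c) (crepr_close x)) => n /=.
by rewrite -scalerBr pc_normZ_cabs.
Qed.

Lemma cpiM x y : cp_mul (cpi x) (cpi y) = cpi (cs_mul x y).
Proof.
set x' := crepr (cpi x); set y' := crepr (cpi y).
have [B B0 hB] := cs_bounded x; have [C C0 hC] := cs_bounded y'.
apply/cpiP; rewrite -/x' -/y'.
apply: null_le (nullD (nullM (ltW C0) (crepr_close x)) (nullM (ltW B0) (crepr_close y))).
move=> n; rewrite -/x' -/y' /=.
have -> : x' n * y' n - x n * y n = (x' n - x n) * y' n + x n * (y' n - y n).
  by rewrite mulrBl mulrBr addrA subrK.
apply: le_trans (pc_normD _ _) _; apply: lerD; apply: le_trans (pc_normM _ _) _.
  by rewrite mulrC ler_wpM2r ?pc_norm_ge0.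
by rewrite ler_wpM2r ?pc_norm_ge0.
Qed.

Lemma cpi_star x : cp_star (cpi x) = cpi (cs_star x).
Proof.
apply/cpiP; apply: null_le (crepr_close x) => n /=.
by rewrite -pc_starB pc_norm_starE.
Qed.

Lemma completionW (Q : completion -> Prop) : (forall x, Q (cpi x)) -> forall v, Q v.
Proof. by move=> h v; rewrite -(creprK v). Qed.

Let cp_opp v := cp_scale (-1) v.
Let cp_cst p := cpi (cs_cst p).

Ltac pointwise := repeat (elim/completionW => ?);
  rewrite ?/cp_opp ?(cpiD, cpiZ, cpiM, cpi_star); congr cpi; apply: cseq_ext => n /=.

Fact cp_addA : associative cp_add.
Proof. by pointwise; rewrite addrA. Qed.
Fact cp_addC : commutative cp_add.
Proof. by pointwise; rewrite addrC. Qed.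
Fact cp_add0 : left_id (cp_cst 0) cp_add.
Proof. by pointwise; rewrite add0r. Qed.
Fact cp_addN : left_inverse (cp_cst 0) cp_opp cp_add.
Proof. by pointwise; rewrite scaleN1r addNr. Qed.

HB.instance Definition _ :=
  GRing.isZmodule.Build completion cp_addA cp_addC cp_add0 cp_addN.

Fact cp_mulA : associative cp_mul.
Proof. by pointwise; rewrite mulrA. Qed.
Fact cp_mul1l : left_id (cp_cst 1) cp_mul.
Proof. by pointwise; rewrite mul1r. Qed.
Fact cp_mul1r : right_id (cp_cst 1) cp_mul.
Proof. by pointwise; rewrite mulr1. Qed.
Fact cp_mulDl : left_distributive cp_mul cp_add.
Proof. by pointwise; rewrite mulrDl. Qed.
Fact cp_mulDr : right_distributive cp_mul cp_add.
Proof. by pointwise; rewrite mulrDr. Qed.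
Fact cp_oner_neq0 : cp_cst 1 != cp_cst 0.
Proof.
apply/eqP => /cpiP h; move/negP: (pc_norm1_neq0 P); apply; rewrite eq_le pc_norm_ge0 andbT.
by apply: null_cst_le0; apply: null_le h => n /=; rewrite subr0.
Qed.

HB.instance Definition _ := GRing.Zmodule_isNzRing.Build completion
  cp_mulA cp_mul1l cp_mul1r cp_mulDl cp_mulDr cp_oner_neq0.

Fact cp_scaleA (a b : R[i]) v : cp_scale a (cp_scale b v) = cp_scale (a * b) v.
Proof. by move: v; pointwise; rewrite scalerA. Qed.
Fact cp_scale1 : left_id 1 cp_scale.
Proof. by pointwise; rewrite scale1r. Qed.
Fact cp_scaleDr : right_distributive cp_scale cp_add.
Proof. by move=> c; pointwise; rewrite scalerDr. Qed.
Fact cp_scaleDl v : {morph cp_scale^~ v : a b / a + b >-> cp_add a b}.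
Proof. by move=> a b; move: v; pointwise; rewrite scalerDl. Qed.

HB.instance Definition _ := GRing.Zmodule_isLmodule.Build R[i] completion
  cp_scaleA cp_scale1 cp_scaleDr cp_scaleDl.

Fact cp_scaleAl (a : R[i]) (v w : completion) : a *: (v * w) = (a *: v) * w.
Proof. by rewrite -[LHS]/(cp_scale a (cp_mul v w)) -[RHS]/(cp_mul (cp_scale a v) w); move: v w; pointwise; rewrite scalerAl. Qed.
HB.instance Definition _ := GRing.Lmodule_isLalgebra.Build R[i] completion cp_scaleAl.
Fact cp_scaleAr (a : R[i]) (v w : completion) : a *: (v * w) = v * (a *: w).
Proof. by rewrite -[LHS]/(cp_scale a (cp_mul v w)) -[RHS]/(cp_mul v (cp_scale a w)); move: v w; pointwise; rewrite scalerAr. Qed.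
HB.instance Definition _ := GRing.Lalgebra_isAlgebra.Build R[i] completion cp_scaleAr.


Lemma cs_norm_tends x : exists l, tends (fun n => N (x n)) l.
Proof.
apply: tends_cauchy => e /(@cs_cauchy x)[m hm]; exists m => n mn.
exact: le_lt_trans (pc_norm_dist _ _) (hm _ _ mn (leqnn _)).
Qed.

Definition cp_norm (v : completion) : R := projT1 (cid (cs_norm_tends (crepr v))).

Lemma cp_normP x : tends (fun n => N (x n)) (cp_norm (cpi x)).
Proof.
apply: tends_close (projT2 (cid (cs_norm_tends (crepr (cpi x))))).
by apply: null_le (cs_close_sym (crepr_close x)) => n; apply: pc_norm_dist.
Qed.

Fact cp_starK : involutive cp_star.
Proof. by pointwise; rewrite pc_starK. Qed.
Fact cp_starD : {morph cp_star : v w / v + w}.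
Proof.
move=> v w; rewrite -[v + w]/(cp_add v w) -[RHS]/(cp_add (cp_star v) (cp_star w)).
by move: v w; pointwise; rewrite pc_starD.
Qed.
Fact cp_starZ (c : R[i]) (v : completion) : cp_star (c *: v) = conjc c *: cp_star v.
Proof.
rewrite -[c *: v]/(cp_scale c v) -[RHS]/(cp_scale _ (cp_star v)).
by move: v; pointwise; rewrite pc_starZ.
Qed.
Fact cp_starM v w : cp_star (v * w) = cp_star w * cp_star v.
Proof.
rewrite -[v * w]/(cp_mul v w) -[RHS]/(cp_mul (cp_star w) (cp_star v)).
by move: v w; pointwise; rewrite pc_starM.
Qed.

Fact cp_norm_eq0 v : cp_norm v = 0 -> v = 0.
Proof.
elim/completionW: v => x x0; apply/cpiP => /=.
have := cp_normP x; rewrite x0 => h; apply: null_le h => n.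
by rewrite !subr0 ler_norm.
Qed.

Fact cp_normD v w : cp_norm (v + w) <= cp_norm v + cp_norm w.
Proof.
elim/completionW: v => x; elim/completionW: w => y.
rewrite -[cpi x + cpi y]/(cp_add _ _) cpiD.
apply: tends_le (cp_normP _) (tendsD (cp_normP x) (cp_normP y)) => n.
exact: pc_normD.
Qed.

Fact cp_normM v w : cp_norm (v * w) <= cp_norm v * cp_norm w.
Proof.
elim/completionW: v => x; elim/completionW: w => y.
rewrite -[cpi x * cpi y]/(cp_mul _ _) cpiM.
apply: tends_le (cp_normP _) (tendsM (cp_normP x) (cp_normP y)) => n.
exact: pc_normM.
Qed.

Fact cp_normZ_cabs (c : R[i]) (v : completion) : cp_norm (c *: v) = cabs c * cp_norm v.
Proof.
elim/completionW: v => x; rewrite -[c *: cpi x]/(cp_scale _ _) cpiZ.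
apply: tends_eq (cp_normP _) _.
have -> : (fun n => N (cs_scale c x n)) = (fun n => cabs c * N (x n)).
  by apply/funext => n; rewrite -pc_normZ_cabs.
exact: tendsM (tends_cst _) (cp_normP x).
Qed.

Fact cp_normZ (c : R[i]) (v : completion) : (cp_norm (c *: v))%:C = `|c| * (cp_norm v)%:C.
Proof. by rewrite cp_normZ_cabs rmorphM /= cabsE. Qed.

Fact cp_norm_star v : cp_norm (cp_star v * v) = cp_norm v ^+ 2.
Proof.
elim/completionW: v => x.
rewrite -[cp_star (cpi x) * cpi x]/(cp_mul (cp_star (cpi x)) (cpi x)) cpi_star cpiM.
apply: tends_eq (cp_normP _) _.
have -> : (fun n => N (cs_mul (cs_star x) x n)) = (fun n => N (x n) * N (x n)).
  by apply/funext => n /=; rewrite pc_norm_star.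
exact: tendsM (cp_normP x) (cp_normP x).
Qed.

Lemma cp_norm_cst p : cp_norm (cp_cst p) = N p.
Proof. exact: tends_eq (cp_normP (cs_cst p)) (tends_cst (N p)). Qed.

Lemma cp_distC (v w : completion) : cp_norm (v - w) = cp_norm (w - v).
Proof.
rewrite -opprB -scaleN1r cp_normZ_cabs (_ : cabs _ = 1) ?mul1r //.
by apply: real_complex_inj; rewrite cabsE normrN1.
Qed.

Lemma cp_triangle u (v w : completion) : cp_norm (v - w) <= cp_norm (v - u) + cp_norm (u - w).
Proof. by have := cp_normD (v - u) (u - w); rewrite subrKA. Qed.

Lemma cp_cstB p q : cp_cst p - cp_cst q = cp_cst (p - q).
Proof.
rewrite -[LHS]/(cp_add (cp_cst p) (cp_scale (-1) (cp_cst q))) cpiZ cpiD.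
by congr cpi; apply: cseq_ext => n /=; rewrite scaleN1r.
Qed.

Lemma cp_tail x m (e : R) :
  (forall n, (m <= n)%N -> N (x m - x n) < e) -> cp_norm (cp_cst (x m) - cpi x) <= e.
Proof.
move=> h; rewrite -[_ - _]/(cp_add (cp_cst (x m)) (cp_scale (-1) (cpi x))) cpiZ cpiD.
set y := cs_add _ _; rewrite -subr_le0; apply: null_cst_le0 => d d0.
have [k hk] := cp_normP y d0.
exists k => n _; have kn : (k <= maxn m k)%N by rewrite leq_maxr.
have := hk _ kn; have := h _ (leq_maxl m k).
rewrite /= scaleN1r; set a := N _; move=> ae.
by have := ler_norm (cp_norm (cpi y) - a); rewrite distrC; lra.
Qed.

Lemma cp_dense v (e : R) : 0 < e -> exists p, cp_norm (v - cp_cst p) < e.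
Proof.
elim/completionW: v => x e0; have e2 : 0 < e / 2 by lra.
have [m hm] := cs_cauchy x e2; exists (x m); rewrite cp_distC.
have : cp_norm (cp_cst (x m) - cpi x) <= e / 2.
  by apply: cp_tail => n mn; apply: hm.
by lra.
Qed.

(** Diagonal argument: [v n] is replaced by a constant [p n] at distance below 1/(n+1). The sequence
    [p] is Cauchy in the original algebra, and its class is the limit. *)
Fact cp_complete : norm_complete cp_norm.
Proof.
move=> v vC; have inv0 n : 0 < n.+1%:R^-1 :> R by rewrite invr_gt0 ltr0n.
have [p hp] : {p : nat -> P & forall n, cp_norm (v n - cp_cst (p n)) < n.+1%:R^-1}.
  by apply: (choice (fun n => cp_dense (v n) (inv0 n))).
have pC e : 0 < e -> exists n0, forall m n,
    (n0 <= m)%N -> (n0 <= n)%N -> N (p m - p n) < e.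
  move=> e0; have e3 : 0 < e / 3 by lra.
  have [m1 h1] := vC _ e3; have [m2 h2] := null_inv e3.
  exists (maxn m1 m2) => m n; rewrite !geq_max => /andP[a1 a2] /andP[b1 b2].
  rewrite -cp_norm_cst -cp_cstB.
  have := cp_triangle (v m) (cp_cst (p m)) (cp_cst (p n)); rewrite (cp_distC _ (v m)).
  have := cp_triangle (v n) (v m) (cp_cst (p n)).
  have := lt_trans (hp m) (h2 _ a2); have := lt_trans (hp n) (h2 _ b2).
  have := h1 _ _ a1 b1.
  lra.
exists (cpi (CSeq pC)) => e e0; have e3 : 0 < e / 3 by lra.
have [m1 h1] := pC _ e3; have [m2 h2] := null_inv e3.
exists (maxn m1 m2) => n; rewrite !geq_max => /andP[a1 a2].
have := cp_triangle (cp_cst (p n)) (v n) (cpi (CSeq pC)).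
have := lt_trans (hp n) (h2 _ a2).
suff : cp_norm (cp_cst (p n) - cpi (CSeq pC)) <= e / 3 by lra.
apply: (@cp_tail (CSeq pC) n) => k nk; apply: h1 => //; exact: leq_trans nk.
Qed.

HB.instance Definition _ := isCStarAlgebra.Build R completion
  cp_starK cp_starD cp_starZ cp_starM cp_norm_eq0 cp_normD cp_normZ cp_normM
  cp_norm_star cp_complete.

End Completion.

Lemma lrmorphism_exists (K : comNzRingType) (A B : algType K) (f : A -> B) :
  f 1 = 1 -> {morph f : x y / x + y} -> (forall (c : K) x, f (c *: x) = c *: f x) ->
  {morph f : x y / x * y} -> exists F : {lrmorphism A -> B}, F =1 f.
Proof.
move=> f1 fD fZ fM.
have fB : zmod_morphism f by move=> x y; rewrite fD -scaleN1r fZ scaleN1r.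
have fmul : monoid_morphism f by split.
pose m1 := GRing.isZmodMorphism.Build A B f fB.
pose m2 := GRing.isMonoidMorphism.Build A B f fmul.
pose m3 := GRing.isScalable.Build K A B *:%R f fZ.
pose F : {lrmorphism A -> B} := HB.pack f m1 m2 m3.
by exists F.
Qed.

Section CStarLimits.
Variables (R : realType) (A : cstarAlgType R).
Implicit Types (a b : nat -> A) (l m : A).

Definition ctends a l := null (fun n => cnorm (a n - l)).

Lemma ctends_cst l : ctends (fun=> l) l.
Proof. by move=> e e0; exists 0%N => n _; rewrite subrr cnorm0. Qed.

Lemma ctends_eq a l m : ctends a l -> ctends a m -> l = m.
Proof.
move=> al am; apply/eqP; rewrite -subr_eq0; apply/eqP/cnorm_eq0/eqP.
rewrite eq_le cnorm_ge0 andbT; apply: null_cst_le0; apply: null_le (nullD al am) => n.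
by rewrite (cnorm_distC (a n) l); apply: cnorm_triangle.
Qed.

Lemma ctendsD a b l m : ctends a l -> ctends b m -> ctends (fun n => a n + b n) (l + m).
Proof.
by move=> al bm; apply: null_le (nullD al bm) => n; rewrite opprD addrACA cnormD.
Qed.

Lemma ctendsZ (c : R[i]) a l : ctends a l -> ctends (fun n => c *: a n) (c *: l).
Proof.
move=> al; apply: null_le (nullM (cabs_ge0 c) al) => n.
by rewrite -scalerBr cnormZ_cabs.
Qed.

Lemma ctends_star a l : ctends a l -> ctends (fun n => star (a n)) (star l).
Proof. by move=> al; apply: null_le al => n; rewrite -starB cnorm_starE. Qed.

Lemma ctends_norm a l : ctends a l -> tends (fun n => cnorm (a n)) (cnorm l).
Proof.
move=> al; apply: null_le al => n; rewrite ler_distlC.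
have := cnorm_le_dist (a n) l; have := cnorm_le_dist l (a n).
by rewrite cnorm_distC; lra.
Qed.

Lemma ctendsM a b l m : ctends a l -> ctends b m -> ctends (fun n => a n * b n) (l * m).
Proof.
move=> al bm.
have : tends (fun n => cnorm (a n - l) * cnorm (b n) + cnorm l * cnorm (b n - m)) 0.
  have h c r : ctends c r -> tends (fun n => cnorm (c n - r)) 0.
    by move=> hc; apply: null_le hc => n; rewrite subr0 ger0_norm ?cnorm_ge0.
  rewrite [X in tends _ X](_ : 0 = 0 * cnorm m + cnorm l * 0); last by rewrite mul0r mulr0 addr0.
  apply: tendsD; apply: tendsM; [exact: h|exact: ctends_norm|exact: tends_cst|exact: h].
apply: null_le => n; rewrite subr0; apply: le_trans (ler_norm _).
have -> : a n * b n - l * m = (a n - l) * b n + l * (b n - m).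
  by rewrite mulrBl mulrBr addrA subrK.
by apply: le_trans (cnormD _ _) _; apply: lerD; apply: cnormM.
Qed.

End CStarLimits.

Section Embedding.
Variables (R : realType) (P : precstar R).

Definition cembed (p : P) : completion P := cpi (cs_cst p).

Fact cembedD : {morph cembed : p q / p + q}.
Proof. by move=> p q; rewrite -[RHS]/(cp_add _ _) cpiD; congr cpi; apply: cseq_ext. Qed.
Fact cembedZ (c : R[i]) p : cembed (c *: p) = c *: cembed p.
Proof. by rewrite -[RHS]/(cp_scale _ _) cpiZ; congr cpi; apply: cseq_ext. Qed.
Fact cembedM : {morph cembed : p q / p * q}.
Proof. by move=> p q; rewrite -[RHS]/(cp_mul _ _) cpiM; congr cpi; apply: cseq_ext. Qed.
Fact cembedB : zmod_morphism cembed.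
Proof. by move=> p q; rewrite cembedD -scaleN1r cembedZ scaleN1r. Qed.
Fact cembed_monoid : monoid_morphism cembed.
Proof. by split; last exact: cembedM. Qed.

HB.instance Definition _ := GRing.isZmodMorphism.Build P (completion P) cembed cembedB.
HB.instance Definition _ := GRing.isMonoidMorphism.Build P (completion P) cembed cembed_monoid.
HB.instance Definition _ := GRing.isScalable.Build R[i] P (completion P) *:%R cembed cembedZ.

Lemma cembed_star p : cembed (pc_star p) = star (cembed p).
Proof. by rewrite -[RHS]/(cp_star _) cpi_star; congr cpi; apply: cseq_ext. Qed.

Lemma cnorm_cembed p : cnorm (cembed p) = pc_norm p.
Proof. exact: cp_norm_cst. Qed.

Lemma cembed_dense (v : completion P) (e : R) : 0 < e -> exists p, cnorm (v - cembed p) < e.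
Proof. exact: cp_dense. Qed.

(** Contractivity sends Cauchy sequences to Cauchy sequences. [FP] shows that the limit does not
    depend on the representative; after that each law is a passage to the limit. *)
Lemma cembed_extension (B : cstarAlgType R) (f : P -> B) :
  f 1 = 1 -> {morph f : x y / x + y} -> (forall (c : R[i]) x, f (c *: x) = c *: f x) ->
  {morph f : x y / x * y} -> (forall x, f (pc_star x) = star (f x)) ->
  (forall x, cnorm (f x) <= pc_norm x) ->
  exists F : {lrmorphism completion P -> B}, star_hom F /\ forall p, F (cembed p) = f p.
Proof.
move=> f1 fD fZ fM fS fN.
have fB p q : f p - f q = f (p - q) by rewrite fD -[- q]scaleN1r fZ scaleN1r.
have lim (x : cseq P) : exists l, ctends (fun n => f (x n)) l.
  apply: cnorm_complete => e /(cs_cauchy x)[m hm]; exists m => i j mi mj.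
  by rewrite fB; apply: le_lt_trans (fN _) (hm i j mi mj).
pose F v := projT1 (cid (lim (crepr v))).
have FP (x : cseq P) : ctends (fun n => f (x n)) (F (cpi x)).
  have := projT2 (cid (lim (crepr (cpi x)))); rewrite -/(F _) => h.
  apply: null_le (nullD (cs_close_sym (crepr_close x)) h) => n.
  apply: le_trans (cnorm_triangle (f (crepr (cpi x) n)) _ _) _.
  by rewrite lerD2r fB.
have Fcst p : F (cembed p) = f p by exact: (ctends_eq (FP (cs_cst p)) (ctends_cst (f p))).
have [|v w|c v|v w|G GF] := @lrmorphism_exists _ _ _ F; last first.
- exists G; split; last by move=> p; rewrite GF.
  move=> v /=; rewrite !GF; elim/completionW: v => x.
  rewrite -[star (cpi x)]/(cp_star _) cpi_star; apply: ctends_eq (FP _) _.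
  rewrite (_ : (fun n => _) = fun n => star (f (x n))); last by apply/funext => n /=.
  exact: ctends_star.
- elim/completionW: v => x; elim/completionW: w => y.
  rewrite -[cpi x * cpi y]/(cp_mul _ _) cpiM; apply: ctends_eq (FP _) _.
  rewrite (_ : (fun n => _) = fun n => f (x n) * f (y n)); last by apply/funext => n /=.
  exact: ctendsM.
- elim/completionW: v => x.
  rewrite -[c *: cpi x]/(cp_scale _ _) cpiZ; apply: ctends_eq (FP _) _.
  rewrite (_ : (fun n => _) = fun n => c *: f (x n)); last by apply/funext => n /=.
  exact: ctendsZ.
- elim/completionW: v => x; elim/completionW: w => y.
  rewrite -[cpi x + cpi y]/(cp_add _ _) cpiD; apply: ctends_eq (FP _) _.
  rewrite (_ : (fun n => _) = fun n => f (x n) + f (y n)); last by apply/funext => n /=.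
  exact: ctendsD.
- by rewrite -f1 -Fcst.
Qed.

End Embedding.

(** * Quotient of a *-algebra given by a presentation *)

(* A *-algebra with a C*-seminorm whose laws only hold up to an equivalence. *)
Record rawcstar (R : realType) := RawCStar {
  rc_sort :> Type;
  rc_add : rc_sort -> rc_sort -> rc_sort;
  rc_scale : R[i] -> rc_sort -> rc_sort;
  rc_mul : rc_sort -> rc_sort -> rc_sort;
  rc_one : rc_sort;
  rc_star : rc_sort -> rc_sort;
  rc_norm : rc_sort -> R;
  rc_eqv : rc_sort -> rc_sort -> Prop;
  rc_refl : forall x, rc_eqv x x;
  rc_sym : forall x y, rc_eqv x y -> rc_eqv y x;
  rc_trans : forall y x z, rc_eqv x y -> rc_eqv y z -> rc_eqv x z;
  rc_eqvD : forall x x' y y', rc_eqv x x' -> rc_eqv y y' ->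
    rc_eqv (rc_add x y) (rc_add x' y');
  rc_eqvZ : forall c x x', rc_eqv x x' -> rc_eqv (rc_scale c x) (rc_scale c x');
  rc_eqvM : forall x x' y y', rc_eqv x x' -> rc_eqv y y' ->
    rc_eqv (rc_mul x y) (rc_mul x' y');
  rc_eqv_star : forall x x', rc_eqv x x' -> rc_eqv (rc_star x) (rc_star x');
  rc_eqv_norm : forall x x', rc_eqv x x' -> rc_norm x = rc_norm x';
  rc_addA : forall x y z, rc_eqv (rc_add x (rc_add y z)) (rc_add (rc_add x y) z);
  rc_addC : forall x y, rc_eqv (rc_add x y) (rc_add y x);
  rc_add0 : forall x, rc_eqv (rc_add (rc_scale 0 rc_one) x) x;
  rc_addN : forall x, rc_eqv (rc_add (rc_scale (-1) x) x) (rc_scale 0 rc_one);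
  rc_mulA : forall x y z, rc_eqv (rc_mul x (rc_mul y z)) (rc_mul (rc_mul x y) z);
  rc_mul1l : forall x, rc_eqv (rc_mul rc_one x) x;
  rc_mul1r : forall x, rc_eqv (rc_mul x rc_one) x;
  rc_mulDl : forall x y z,
    rc_eqv (rc_mul (rc_add x y) z) (rc_add (rc_mul x z) (rc_mul y z));
  rc_mulDr : forall x y z,
    rc_eqv (rc_mul x (rc_add y z)) (rc_add (rc_mul x y) (rc_mul x z));
  rc_scaleA : forall a b x, rc_eqv (rc_scale a (rc_scale b x)) (rc_scale (a * b) x);
  rc_scale1 : forall x, rc_eqv (rc_scale 1 x) x;
  rc_scaleDr : forall c x y,
    rc_eqv (rc_scale c (rc_add x y)) (rc_add (rc_scale c x) (rc_scale c y));
  rc_scaleDl : forall x a b,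
    rc_eqv (rc_scale (a + b) x) (rc_add (rc_scale a x) (rc_scale b x));
  rc_scaleAl : forall c x y, rc_eqv (rc_scale c (rc_mul x y)) (rc_mul (rc_scale c x) y);
  rc_scaleAr : forall c x y, rc_eqv (rc_scale c (rc_mul x y)) (rc_mul x (rc_scale c y));
  rc_starK : forall x, rc_eqv (rc_star (rc_star x)) x;
  rc_starD : forall x y, rc_eqv (rc_star (rc_add x y)) (rc_add (rc_star x) (rc_star y));
  rc_starZ : forall c x, rc_eqv (rc_star (rc_scale c x)) (rc_scale (conjc c) (rc_star x));
  rc_starM : forall x y, rc_eqv (rc_star (rc_mul x y)) (rc_mul (rc_star y) (rc_star x));
  rc_normD : forall x y, rc_norm (rc_add x y) <= rc_norm x + rc_norm y;
  rc_normZ : forall c x, rc_norm (rc_scale c x) = cabs c * rc_norm x;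
  rc_normM : forall x y, rc_norm (rc_mul x y) <= rc_norm x * rc_norm y;
  rc_norm_star : forall x, rc_norm (rc_mul (rc_star x) x) = rc_norm x ^+ 2;
  rc_norm1_neq0 : rc_norm rc_one != 0
}.

Section RawQuotient.
Variables (R : realType) (P : rawcstar R).

Definition rcarrier : Type := P.
HB.instance Definition _ := gen_eqMixin rcarrier.
HB.instance Definition _ := gen_choiceMixin rcarrier.

Definition rc_rel : rel rcarrier := fun x y => `[< rc_eqv (x : P) y >].

Lemma rc_rel_equiv : equiv_class_of rc_rel.
Proof.
split=> [x|x y|y x z]; first by apply/asboolP/rc_refl.
  by apply/asboolP/asboolP; apply: rc_sym.
by move=> /asboolP xy /asboolP yz; apply/asboolP/(rc_trans xy yz).
Qed.

Canonical rc_equiv := EquivRelPack rc_rel_equiv.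

Definition rquot := {eq_quot rc_equiv}%qT.
HB.instance Definition _ := Choice.on rquot.

Definition rpi (x : P) : rquot := \pi_({eq_quot rc_equiv})%qT x.
Definition rrepr (v : rquot) : P := repr v.

Lemma rreprK v : rpi (rrepr v) = v.
Proof. exact: reprK. Qed.

Lemma rpiP (x y : P) : rpi x = rpi y <-> rc_eqv x y.
Proof. by split=> [/eqmodP/asboolP|h] //; apply/eqmodP/asboolP. Qed.

Lemma rreprP x : rc_eqv (rrepr (rpi x)) x.
Proof. by apply/rpiP; rewrite rreprK. Qed.

Lemma rquotW (Q : rquot -> Prop) : (forall x, Q (rpi x)) -> forall v, Q v.
Proof. by move=> h v; rewrite -(rreprK v). Qed.

Definition rq_add v w := rpi (rc_add (rrepr v) (rrepr w)).
Definition rq_scale c v := rpi (rc_scale c (rrepr v)).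
Definition rq_mul v w := rpi (rc_mul (rrepr v) (rrepr w)).
Definition rq_star v := rpi (rc_star (rrepr v)).
Definition rq_norm v := rc_norm (rrepr v).
Let rq_opp v := rq_scale (-1) v.

Lemma rpiD x y : rq_add (rpi x) (rpi y) = rpi (rc_add x y).
Proof. by apply/rpiP/rc_eqvD; apply: rreprP. Qed.
Lemma rpiZ c x : rq_scale c (rpi x) = rpi (rc_scale c x).
Proof. by apply/rpiP/rc_eqvZ/rreprP. Qed.
Lemma rpiM x y : rq_mul (rpi x) (rpi y) = rpi (rc_mul x y).
Proof. by apply/rpiP/rc_eqvM; apply: rreprP. Qed.
Lemma rpi_star x : rq_star (rpi x) = rpi (rc_star x).
Proof. by apply/rpiP/rc_eqv_star/rreprP. Qed.
Lemma rpi_norm x : rq_norm (rpi x) = rc_norm x.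
Proof. exact/rc_eqv_norm/rreprP. Qed.

Ltac lift lem := repeat (elim/rquotW => ?);
  rewrite ?/rq_opp ?(rpiD, rpiZ, rpiM, rpi_star); apply/rpiP; apply: lem.

Fact rq_addA : associative rq_add. Proof. by lift rc_addA. Qed.
Fact rq_addC : commutative rq_add. Proof. by lift rc_addC. Qed.
Fact rq_add0 : left_id (rpi (rc_scale 0 (rc_one P))) rq_add. Proof. by lift rc_add0. Qed.
Fact rq_addN : left_inverse (rpi (rc_scale 0 (rc_one P))) rq_opp rq_add.
Proof. by lift rc_addN. Qed.
HB.instance Definition _ := GRing.isZmodule.Build rquot rq_addA rq_addC rq_add0 rq_addN.

Fact rq_mulA : associative rq_mul. Proof. by lift rc_mulA. Qed.
Fact rq_mul1l : left_id (rpi (rc_one P)) rq_mul. Proof. by lift rc_mul1l. Qed.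
Fact rq_mul1r : right_id (rpi (rc_one P)) rq_mul. Proof. by lift rc_mul1r. Qed.
Fact rq_mulDl : left_distributive rq_mul rq_add. Proof. by lift rc_mulDl. Qed.
Fact rq_mulDr : right_distributive rq_mul rq_add. Proof. by lift rc_mulDr. Qed.
Fact rq_oner_neq0 : rpi (rc_one P) != rpi (rc_scale 0 (rc_one P)).
Proof.
apply/eqP => /rpiP/rc_eqv_norm h; move/negP: (rc_norm1_neq0 P); apply.
by rewrite h rc_normZ (_ : cabs 0 = 0) ?mul0r // /cabs normr0.
Qed.
HB.instance Definition _ := GRing.Zmodule_isNzRing.Build rquot
  rq_mulA rq_mul1l rq_mul1r rq_mulDl rq_mulDr rq_oner_neq0.

Fact rq_scaleA (a b : R[i]) v : rq_scale a (rq_scale b v) = rq_scale (a * b) v.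
Proof. by move: v; lift rc_scaleA. Qed.
Fact rq_scale1 : left_id 1 rq_scale. Proof. by lift rc_scale1. Qed.
Fact rq_scaleDr : right_distributive rq_scale rq_add.
Proof. by move=> c; lift rc_scaleDr. Qed.
Fact rq_scaleDl v : {morph rq_scale^~ v : a b / a + b >-> rq_add a b}.
Proof. by move=> a b; move: v; lift rc_scaleDl. Qed.
HB.instance Definition _ := GRing.Zmodule_isLmodule.Build R[i] rquot
  rq_scaleA rq_scale1 rq_scaleDr rq_scaleDl.

Fact rq_scaleAl (a : R[i]) (v w : rquot) : a *: (v * w) = (a *: v) * w.
Proof.
rewrite -[LHS]/(rq_scale a (rq_mul v w)) -[RHS]/(rq_mul (rq_scale a v) w).
by move: v w; lift rc_scaleAl.
Qed.
HB.instance Definition _ := GRing.Lmodule_isLalgebra.Build R[i] rquot rq_scaleAl.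
Fact rq_scaleAr (a : R[i]) (v w : rquot) : a *: (v * w) = v * (a *: w).
Proof.
rewrite -[LHS]/(rq_scale a (rq_mul v w)) -[RHS]/(rq_mul v (rq_scale a w)).
by move: v w; lift rc_scaleAr.
Qed.
HB.instance Definition _ := GRing.Lalgebra_isAlgebra.Build R[i] rquot rq_scaleAr.

Fact rq_starK : involutive rq_star. Proof. by lift rc_starK. Qed.
Fact rq_starD : {morph rq_star : v w / v + w}.
Proof.
move=> v w; rewrite -[LHS]/(rq_star (rq_add v w)) -[RHS]/(rq_add (rq_star v) (rq_star w)).
by move: v w; lift rc_starD.
Qed.
Fact rq_starZ (c : R[i]) (v : rquot) : rq_star (c *: v) = conjc c *: rq_star v.
Proof.
rewrite -[LHS]/(rq_star (rq_scale c v)) -[RHS]/(rq_scale (conjc c) (rq_star v)).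
by move: v; lift rc_starZ.
Qed.
Fact rq_starM (v w : rquot) : rq_star (v * w) = rq_star w * rq_star v.
Proof.
rewrite -[LHS]/(rq_star (rq_mul v w)) -[RHS]/(rq_mul (rq_star w) (rq_star v)).
by move: v w; lift rc_starM.
Qed.
Fact rq_normD (v w : rquot) : rq_norm (v + w) <= rq_norm v + rq_norm w.
Proof.
rewrite -[v + w]/(rq_add v w); move: v w; repeat elim/rquotW => ?.
by rewrite rpiD !rpi_norm rc_normD.
Qed.
Fact rq_normZ (c : R[i]) (v : rquot) : (rq_norm (c *: v))%:C = `|c| * (rq_norm v)%:C.
Proof.
rewrite -[c *: v]/(rq_scale c v); move: v; elim/rquotW => x.
by rewrite rpiZ !rpi_norm rc_normZ rmorphM /= cabsE.
Qed.
Fact rq_normM (v w : rquot) : rq_norm (v * w) <= rq_norm v * rq_norm w.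
Proof.
rewrite -[v * w]/(rq_mul v w); move: v w; repeat elim/rquotW => ?.
by rewrite rpiM !rpi_norm rc_normM.
Qed.
Fact rq_norm_star (v : rquot) : rq_norm (rq_star v * v) = rq_norm v ^+ 2.
Proof.
rewrite -[rq_star v * v]/(rq_mul (rq_star v) v); move: v; elim/rquotW => x.
by rewrite rpi_star rpiM !rpi_norm rc_norm_star.
Qed.
Fact rq_norm1_neq0 : rq_norm 1 != 0.
Proof. by rewrite -[1]/(rpi (rc_one P)) rpi_norm rc_norm1_neq0. Qed.

Definition rc_precstar : precstar R :=
  PreCStar rq_starK rq_starD rq_starZ rq_starM rq_normD rq_normZ rq_normM
    rq_norm_star rq_norm1_neq0.

Definition rc_cstar : cstarAlgType R := completion rc_precstar.

Definition rembed (x : P) : rc_cstar := cembed (rpi x : rc_precstar).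

Lemma rembedD x y : rembed (rc_add x y) = rembed x + rembed y.
Proof. by rewrite /rembed -rpiD -cembedD. Qed.
Lemma rembedZ c x : rembed (rc_scale c x) = c *: rembed x.
Proof. by rewrite /rembed -rpiZ -cembedZ. Qed.
Lemma rembedM x y : rembed (rc_mul x y) = rembed x * rembed y.
Proof. by rewrite /rembed -rpiM -cembedM. Qed.
Lemma rembed1 : rembed (rc_one P) = 1.
Proof. by []. Qed.
Lemma rembed_star x : rembed (rc_star x) = star (rembed x).
Proof. by rewrite /rembed -rpi_star -cembed_star. Qed.
Lemma cnorm_rembed x : cnorm (rembed x) = rc_norm x.
Proof. by rewrite /rembed cnorm_cembed -rpi_norm. Qed.
Lemma rembed_eqv x y : rc_eqv x y -> rembed x = rembed y.
Proof. by move/rpiP => h; rewrite /rembed h. Qed.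

Lemma rembed_dense (v : rc_cstar) (e : R) : 0 < e -> exists x, cnorm (v - rembed x) < e.
Proof. by move=> /(cembed_dense v)[p]; rewrite -(rreprK p); exists (rrepr p). Qed.

Lemma rembed_extension (B : cstarAlgType R) (f : P -> B) :
  (forall x y, rc_eqv x y -> f x = f y) ->
  f (rc_one P) = 1 -> (forall x y, f (rc_add x y) = f x + f y) ->
  (forall c x, f (rc_scale c x) = c *: f x) ->
  (forall x y, f (rc_mul x y) = f x * f y) -> (forall x, f (rc_star x) = star (f x)) ->
  (forall x, cnorm (f x) <= rc_norm x) ->
  exists F : {lrmorphism rc_cstar -> B}, star_hom F /\ forall x, F (rembed x) = f x.
Proof.
move=> fe f1 fD fZ fM fS fN; pose g (v : rc_precstar) := f (rrepr v).
have gE x : g (rpi x) = f x by apply/fe/rreprP.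
have [||||||F [FS FE]] := @cembed_extension R rc_precstar B g.
- by rewrite -[1]/(rpi (rc_one P)) gE.
- move=> v w; rewrite -[v + w]/(rq_add v w); move: v w; repeat elim/rquotW => ?.
  by rewrite rpiD !gE.
- move=> c v; rewrite -[c *: v]/(rq_scale c v); move: v; elim/rquotW => x.
  by rewrite rpiZ !gE.
- move=> v w; rewrite -[v * w]/(rq_mul v w); move: v w; repeat elim/rquotW => ?.
  by rewrite rpiM !gE.
- elim/rquotW => x; rewrite -[pc_star _]/(rq_star (rpi x)) rpi_star !gE; exact: fS.
- by elim/rquotW => x; rewrite gE -[pc_norm _]/(rq_norm (rpi x)) rpi_norm.
by exists F; split=> // x; rewrite FE gE.
Qed.

End RawQuotient.

(** * Seminorms defined by families of *-representations *)

(** A possibly degenerate inner product space whose operations are constrained only through the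
    form. No vector space laws are imposed, so that lists of elementary tensors under concatenation
    qualify. *)
Record sip (R : realType) := Sip {
  sip_sort :> Type;
  sip_add : sip_sort -> sip_sort -> sip_sort;
  sip_scale : R[i] -> sip_sort -> sip_sort;
  frm : sip_sort -> sip_sort -> R[i];
  frmDl : forall v w z, frm (sip_add v w) z = frm v z + frm w z;
  frmZl : forall c v z, frm (sip_scale c v) z = c * frm v z;
  frmC : forall v w, frm v w = conjc (frm w v);
  frm_ge0 : forall v, 0 <= frm v v
}.

Lemma quad_discriminant (R : realFieldType) (a b r : R) : 0 <= a -> 0 <= b ->
  (forall t, 0 <= a ^+ 2 + 2 * t * r + t ^+ 2 * b ^+ 2) -> r <= a * b.
Proof.
move=> a0 b0 quad.
have ab0 : 0 <= a * b by rewrite mulr_ge0.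
suff : r ^+ 2 <= (a * b) ^+ 2.
  by have [r0|r0] := lerP r 0; [lra|rewrite ler_pXn2r // nnegrE ltW].
have [b1|b1] := eqVneq b 0.
  have [->|r0] := eqVneq r 0; first by rewrite expr0n sqr_ge0.
  (* For b = 0 the polynomial is affine in t, and this t gives it the value -1. *)
  have := quad (- (a ^+ 2 + 1) / (2 * r)).
  rewrite (_ : 2 * (- (a ^+ 2 + 1) / (2 * r)) * r = - (a ^+ 2 + 1)); last by field.
  by rewrite b1 expr0n mulr0; lra.
(* The minimum of the parabola. *)
have := quad (- r / b ^+ 2).
rewrite (_ : a ^+ 2 + _ + _ = ((a * b) ^+ 2 - r ^+ 2) / b ^+ 2); last by field.
by rewrite pmulr_lge0 ?subr_ge0 // invr_gt0 exprn_even_gt0.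
Qed.

Section SemiInnerProduct.
Variables (R : realType) (V : sip R).
Implicit Types v w z : V.

Definition snorm2 v : R := complex.Re (frm v v).
Definition snorm v : R := Num.sqrt (snorm2 v).

Lemma snorm2E v : (snorm2 v)%:C = frm v v.
Proof.
rewrite /snorm2; have := frm_ge0 v; rewrite lecE /= => /andP[/eqP h _].
by case: (frm v v) h => a b /= ->.
Qed.

Lemma snorm2_ge0 v : 0 <= snorm2 v.
Proof. by rewrite -lecR snorm2E frm_ge0. Qed.

Lemma snorm_ge0 v : 0 <= snorm v.
Proof. exact: sqrtr_ge0. Qed.

Lemma snorm_sqr v : snorm v ^+ 2 = snorm2 v.
Proof. by rewrite sqr_sqrtr ?snorm2_ge0. Qed.

Lemma frmDr v w z : frm z (sip_add v w) = frm z v + frm z w.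
Proof. by rewrite frmC frmDl rmorphD /= -!frmC. Qed.

Lemma frmZr c v z : frm z (sip_scale c v) = conjc c * frm z v.
Proof. by rewrite frmC frmZl rmorphM /= -frmC. Qed.

Lemma snorm2D v w : snorm2 (sip_add v w) = snorm2 v + 2 * complex.Re (frm v w) + snorm2 w.
Proof.
rewrite /snorm2 frmDl !frmDr (frmC w v).
by case: (frm v v) (frm v w) (frm w w) => [a b] [c d] [e f] /=; ring.
Qed.

Lemma snorm2Z c v : snorm2 (sip_scale c v) = cabs c ^+ 2 * snorm2 v.
Proof.
apply: real_complex_inj; rewrite snorm2E frmZl frmZr mulrA -sqr_normc -cabsE.
by rewrite rmorphM rmorphXn /= snorm2E.
Qed.

Lemma frm_cauchy_schwarz v w : complex.Re (frm v w) <= snorm v * snorm w.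
Proof.
have quad (t : R) : 0 <= snorm2 v + 2 * t * complex.Re (frm v w) + t ^+ 2 * snorm2 w.
  have := snorm2_ge0 (sip_add v (sip_scale t%:C w)); rewrite snorm2D snorm2Z.
  rewrite frmZr conjc_real; case: (frm v w) => c d /=.
  have -> : cabs t%:C ^+ 2 = t ^+ 2.
    apply: real_complex_inj; rewrite rmorphXn /= cabsE sqr_normc conjc_real -rmorphM.
    by rewrite expr2.
  by rewrite mul0r subr0 mulrA.
apply: quad_discriminant; rewrite ?snorm_ge0 // => t.
by rewrite !snorm_sqr.
Qed.

Lemma snormD v w : snorm (sip_add v w) <= snorm v + snorm w.
Proof.
rewrite -(ler_pXn2r (_ : (0 < 2)%N)) // ?nnegrE ?addr_ge0 ?snorm_ge0 //.
rewrite snorm_sqr snorm2D sqrrD !snorm_sqr.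
by have := frm_cauchy_schwarz v w; lra.
Qed.

Lemma snormZ c v : snorm (sip_scale c v) = cabs c * snorm v.
Proof. by rewrite /snorm snorm2Z sqrtrM ?sqr_ge0 // sqrtr_sqr ger0_norm ?cabs_ge0. Qed.

End SemiInnerProduct.

Section RepresentationFamily.
Variables (R : realType) (P : Type).
Variables (padd : P -> P -> P) (pscale : R[i] -> P -> P) (pmul : P -> P -> P).
Variables (pone : P) (pstar : P -> P).
Variables (W : Type) (V : W -> sip R) (act : forall w, P -> V w -> V w).
Hypothesis actD : forall w x y (v z : V w),
  frm (act (padd x y) v) z = frm (act x v) z + frm (act y v) z.
Hypothesis actZ : forall w c x (v z : V w), frm (act (pscale c x) v) z = c * frm (act x v) z.
Hypothesis actM : forall w x y (v z : V w),
  frm (act (pmul x y) v) z = frm (act x (act y v)) z.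
Hypothesis act1 : forall w (v z : V w), frm (act pone v) z = frm v z.
Hypothesis act_star : forall w x (v z : V w), frm (act (pstar x) v) z = frm v (act x z).

Definition rep_bound x (M : R) := forall w (v : V w), snorm (act x v) <= M * snorm v.

Hypothesis act_bounded : forall x, exists2 M, 0 <= M & rep_bound x M.
Hypothesis act_nontrivial : exists w, exists v : V w, 0 < snorm v.

(** Equality of operators modulo the null vectors of the form, the only equality that a [sip] can
    express. *)
Definition rep_eqv x y := forall w (v z : V w), frm (act x v) z = frm (act y v) z.

Lemma act_starr w x (v z : V w) : frm v (act (pstar x) z) = frm (act x v) z.
Proof. by rewrite frmC act_star -frmC. Qed.

(** The supremum of the operator norms over the whole family, written as the least common bound. *)
Definition rep_norm x : R := inf [set M | 0 <= M /\ rep_bound x M]%classic.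

Lemma rep_norm_lbound x : has_inf [set M | 0 <= M /\ rep_bound x M]%classic.
Proof.
by split; [have [M] := act_bounded x; exists M|exists 0 => M []].
Qed.

Lemma rep_norm_ge0 x : 0 <= rep_norm x.
Proof. by apply: lb_le_inf; [case: (rep_norm_lbound x)|move=> M []]. Qed.

Lemma rep_normP x : rep_bound x (rep_norm x).
Proof.
move=> w v; have [v0|v0] := eqVneq (snorm v) 0.
  by have [M _ /(_ w v)] := act_bounded x; rewrite v0 !mulr0.
have vp : 0 < snorm v by rewrite lt_def v0 snorm_ge0.
rewrite -ler_pdivrMr //; apply: lb_le_inf; first by case: (rep_norm_lbound x).
by move=> M [_ /(_ w v)]; rewrite ler_pdivrMr.
Qed.

Lemma rep_norm_le x M : 0 <= M -> rep_norm x <= M <-> rep_bound x M.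
Proof.
move=> M0; split=> [h w v|h].
  by apply: le_trans (rep_normP x v) _; rewrite ler_wpM2r ?snorm_ge0.
by apply: ge_inf => //; case: (rep_norm_lbound x).
Qed.

Lemma snorm_eqv w (a b : V w) : (forall z, frm a z = frm b z) -> snorm a = snorm b.
Proof. by move=> h; rewrite /snorm /snorm2 h frmC h -frmC. Qed.

Lemma snorm_actM w x y (v : V w) : snorm (act (pmul x y) v) = snorm (act x (act y v)).
Proof. by apply: snorm_eqv => z; rewrite actM. Qed.

Fact rep_eqv_norm x x' : rep_eqv x x' -> rep_norm x = rep_norm x'.
Proof.
move=> h; rewrite /rep_norm; congr inf; apply/seteqP.
have e w (v : V w) : snorm (act x v) = snorm (act x' v) by apply: snorm_eqv => z.
by split=> M [M0 hM]; split=> // w v; [rewrite -e|rewrite e].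
Qed.

Fact rep_eqvD x x' y y' :
  rep_eqv x x' -> rep_eqv y y' -> rep_eqv (padd x y) (padd x' y').
Proof. by move=> hx hy w v z; rewrite !actD hx hy. Qed.
Fact rep_eqvZ c x x' : rep_eqv x x' -> rep_eqv (pscale c x) (pscale c x').
Proof. by move=> hx w v z; rewrite !actZ hx. Qed.
(** [act x'] is not assumed to respect the degeneracy of the form, so [y] cannot be replaced under
    it directly: the adjoint first moves [x'] to the other side. *)
Fact rep_eqvM x x' y y' :
  rep_eqv x x' -> rep_eqv y y' -> rep_eqv (pmul x y) (pmul x' y').
Proof. by move=> hx hy w v z; rewrite !actM hx -!(act_starr x') hy. Qed.
Fact rep_eqv_star x x' : rep_eqv x x' -> rep_eqv (pstar x) (pstar x').
Proof. by move=> hx w v z; rewrite !act_star frmC hx -frmC. Qed.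

Fact rep_addA x y z : rep_eqv (padd x (padd y z)) (padd (padd x y) z).
Proof. by move=> w v t; rewrite !actD addrA. Qed.
Fact rep_addC x y : rep_eqv (padd x y) (padd y x).
Proof. by move=> w v t; rewrite !actD addrC. Qed.
Fact rep_add0 x : rep_eqv (padd (pscale 0 pone) x) x.
Proof. by move=> w v t; rewrite actD actZ mul0r add0r. Qed.
Fact rep_addN x : rep_eqv (padd (pscale (-1) x) x) (pscale 0 pone).
Proof. by move=> w v t; rewrite actD !actZ mulN1r mul0r addNr. Qed.
Fact rep_mulA x y z : rep_eqv (pmul x (pmul y z)) (pmul (pmul x y) z).
Proof. by move=> w v t; rewrite actM -(act_starr x) !actM -!act_starr. Qed.
Fact rep_mul1l x : rep_eqv (pmul pone x) x.
Proof. by move=> w v t; rewrite actM act1. Qed.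
Fact rep_mul1r x : rep_eqv (pmul x pone) x.
Proof. by move=> w v t; rewrite actM -(act_starr x) act1 act_starr. Qed.
Fact rep_mulDl x y z : rep_eqv (pmul (padd x y) z) (padd (pmul x z) (pmul y z)).
Proof. by move=> w v t; rewrite actM !actD !actM. Qed.
Fact rep_mulDr x y z : rep_eqv (pmul x (padd y z)) (padd (pmul x y) (pmul x z)).
Proof. by move=> w v t; rewrite actM actD !actM -!(act_starr x) actD. Qed.
Fact rep_scaleA a b x : rep_eqv (pscale a (pscale b x)) (pscale (a * b) x).
Proof. by move=> w v t; rewrite !actZ mulrA. Qed.
Fact rep_scale1 x : rep_eqv (pscale 1 x) x.
Proof. by move=> w v t; rewrite actZ mul1r. Qed.
Fact rep_scaleDr c x y : rep_eqv (pscale c (padd x y)) (padd (pscale c x) (pscale c y)).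
Proof. by move=> w v t; rewrite actZ !actD !actZ mulrDr. Qed.
Fact rep_scaleDl x a b : rep_eqv (pscale (a + b) x) (padd (pscale a x) (pscale b x)).
Proof. by move=> w v t; rewrite actD !actZ mulrDl. Qed.
Fact rep_scaleAl c x y : rep_eqv (pscale c (pmul x y)) (pmul (pscale c x) y).
Proof. by move=> w v t; rewrite actZ !actM actZ. Qed.
Fact rep_scaleAr c x y : rep_eqv (pscale c (pmul x y)) (pmul x (pscale c y)).
Proof. by move=> w v t; rewrite actZ !actM -!(act_starr x) actZ. Qed.
Fact rep_starK x : rep_eqv (pstar (pstar x)) x.
Proof. by move=> w v t; rewrite act_star act_starr. Qed.
Fact rep_starD x y : rep_eqv (pstar (padd x y)) (padd (pstar x) (pstar y)).
Proof.
move=> w v t; rewrite actD !act_star frmC actD rmorphD /=.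
by rewrite -!frmC.
Qed.
Fact rep_starZ c x : rep_eqv (pstar (pscale c x)) (pscale (conjc c) (pstar x)).
Proof. by move=> w v t; rewrite actZ !act_star frmC actZ rmorphM /= -frmC. Qed.
Fact rep_starM x y : rep_eqv (pstar (pmul x y)) (pmul (pstar y) (pstar x)).
Proof. by move=> w v t; rewrite actM !act_star frmC actM -frmC. Qed.

Fact rep_normD x y : rep_norm (padd x y) <= rep_norm x + rep_norm y.
Proof.
apply/rep_norm_le; first by rewrite addr_ge0 ?rep_norm_ge0.
move=> w v; rewrite (@snorm_eqv _ _ (sip_add (act x v) (act y v))); last first.
  by move=> z; rewrite actD frmDl.
rewrite mulrDl; apply: le_trans (snormD _ _) _.
by rewrite lerD ?rep_normP.
Qed.

Lemma rep_normZ_le c x : rep_norm (pscale c x) <= cabs c * rep_norm x.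
Proof.
apply/rep_norm_le; first by rewrite mulr_ge0 ?rep_norm_ge0 ?cabs_ge0.
move=> w v; rewrite (@snorm_eqv _ _ (sip_scale c (act x v))); last first.
  by move=> z; rewrite actZ frmZl.
by rewrite snormZ -mulrA ler_wpM2l ?cabs_ge0 ?rep_normP.
Qed.

Fact rep_normZ c x : rep_norm (pscale c x) = cabs c * rep_norm x.
Proof.
apply/eqP; rewrite eq_le rep_normZ_le /=.
have [->|c0] := eqVneq c 0.
  by rewrite (_ : cabs 0 = 0) ?mul0r ?rep_norm_ge0 // /cabs normr0.
have := rep_normZ_le c^-1 (pscale c x).
have -> : rep_norm (pscale c^-1 (pscale c x)) = rep_norm x.
  apply: rep_eqv_norm => w v z; rewrite !actZ mulrA mulVf ?mul1r //.
have -> : cabs c^-1 = (cabs c)^-1.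
  by apply: real_complex_inj; rewrite cabsE fmorphV /= cabsE normfV.
rewrite mulrC ler_pdivlMr ?[_ * cabs c]mulrC // lt_def cabs_ge0 andbT.
by apply: contra_neq c0 => h; apply/eqP; rewrite -normr_eq0 -cabsE h.
Qed.

Fact rep_normM x y : rep_norm (pmul x y) <= rep_norm x * rep_norm y.
Proof.
apply/rep_norm_le; first by rewrite mulr_ge0 ?rep_norm_ge0.
move=> w v; rewrite snorm_actM; apply: le_trans (rep_normP _ _) _.
by rewrite -mulrA ler_wpM2l ?rep_norm_ge0 ?rep_normP.
Qed.

(** norm (x* v)^2 = <v, x x* v> is at most norm v times N(x) times norm (x* v), and one factor
    cancels. *)
Lemma rep_norm_star_le x : rep_norm (pstar x) <= rep_norm x.
Proof.
apply/rep_norm_le; first exact: rep_norm_ge0.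
move=> w v; have [->|s0] := eqVneq (snorm (act (pstar x) v)) 0.
  by rewrite mulr_ge0 ?rep_norm_ge0 ?snorm_ge0.
have sp : 0 < snorm (act (pstar x) v) by rewrite lt_def s0 snorm_ge0.
rewrite -(ler_pM2r sp) -expr2 snorm_sqr /snorm2 act_star.
apply: le_trans (frm_cauchy_schwarz _ _) _.
rewrite [X in _ <= X](_ : _ = snorm v * (rep_norm x * snorm (act (pstar x) v))); last by ring.
by rewrite ler_wpM2l ?snorm_ge0 ?rep_normP.
Qed.

(** One inequality is submultiplicativity. The other comes from norm (x v)^2 = <x* x v, v>, which is
    at most N(x* x) times norm (v)^2. *)
Fact rep_norm_star x : rep_norm (pmul (pstar x) x) = rep_norm x ^+ 2.
Proof.
apply/eqP; rewrite eq_le; apply/andP; split.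
  apply: le_trans (rep_normM _ _) _; rewrite expr2.
  by rewrite ler_wpM2r ?rep_norm_ge0 ?rep_norm_star_le.
set m := rep_norm (pmul _ _); have m0 : 0 <= m := rep_norm_ge0 _.
rewrite -[m]sqr_sqrtr // ler_pXn2r ?nnegrE ?rep_norm_ge0 ?sqrtr_ge0 //.
apply/rep_norm_le; first exact: sqrtr_ge0.
move=> w v; rewrite -(ler_pXn2r (_ : (0 < 2)%N)) // ?nnegrE ?mulr_ge0 ?snorm_ge0 ?sqrtr_ge0 //.
rewrite exprMn (sqr_sqrtr m0) snorm_sqr /snorm2 -act_star -actM.
apply: le_trans (frm_cauchy_schwarz _ _) _.
by rewrite expr2 mulrA ler_wpM2r ?snorm_ge0 ?rep_normP.
Qed.

Fact rep_norm1_neq0 : rep_norm pone != 0.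
Proof.
have [w [v v0]] := act_nontrivial; apply/eqP => h.
have := rep_normP pone v; rewrite h mul0r (@snorm_eqv _ _ v) ?act1 //.
by rewrite leNgt v0.
Qed.

Definition rep_rawcstar : rawcstar R :=
  @RawCStar R P padd pscale pmul pone pstar rep_norm rep_eqv
    (fun x w v z => erefl) (fun x y h w v z => esym (h w v z))
    (fun y x t h h' w v z => etrans (h w v z) (h' w v z))
    rep_eqvD rep_eqvZ rep_eqvM rep_eqv_star rep_eqv_norm rep_addA rep_addC rep_add0
    rep_addN rep_mulA rep_mul1l rep_mul1r rep_mulDl rep_mulDr rep_scaleA rep_scale1
    rep_scaleDr rep_scaleDl rep_scaleAl rep_scaleAr rep_starK rep_starD rep_starZ
    rep_starM rep_normD rep_normZ rep_normM rep_norm_star rep_norm1_neq0.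

End RepresentationFamily.

(** * Spatial tensor products *)

Section HilbertTheory.
Variables (R : realType) (H : hilbert R).
Implicit Types x y z : H.

Lemma hdot0l z : hdot 0 z = 0.
Proof.
have := hdotP 1 (0 : H) 0 z; rewrite scaler0 addr0 mul1r => /eqP.
by rewrite -subr_eq0 opprD addNKr oppr_eq0 => /eqP.
Qed.

Lemma hdotDl x y z : hdot (x + y) z = hdot x z + hdot y z.
Proof. by have := hdotP 1 x y z; rewrite scale1r mul1r. Qed.

Lemma hdotZl c x z : hdot (c *: x) z = c * hdot x z.
Proof. by have := hdotP c x 0 z; rewrite !addr0 hdot0l addr0. Qed.

Lemma hdotBl x y z : hdot (x - y) z = hdot x z - hdot y z.
Proof. by rewrite hdotDl -scaleN1r hdotZl mulN1r. Qed.

Lemma hdot_suml (I : Type) (r : seq I) (F : I -> H) z :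
  hdot (\sum_(i <- r) F i) z = \sum_(i <- r) hdot (F i) z.
Proof. exact: (big_morph (fun x => hdot x z) (fun x y => hdotDl x y z) (hdot0l z)). Qed.

Lemma hdotxx_ge0 x : 0 <= hdot x x.
Proof. by rewrite hdot_norm exprn_ge0. Qed.

Lemma hdotxx_eq0 x : (hdot x x == 0) = (x == 0).
Proof. by rewrite hdot_norm expf_eq0 normr_eq0. Qed.

End HilbertTheory.

Section TensorForm.
Variables (R : realType) (H K : hilbert R).
Implicit Types t s : seq (H * K).

(** The inner product of the algebraic tensor product, pulled back to lists; [tensor_norm2 t] is
    [tfrm t t]. *)
Definition tfrm t s : R[i] :=
  \sum_(p <- t) \sum_(q <- s) hdot p.1 q.1 * hdot p.2 q.2.

Lemma tfrmC t s : tfrm t s = conjc (tfrm s t).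
Proof.
rewrite /tfrm rmorph_sum exchange_big; apply: eq_bigr => q _.
rewrite rmorph_sum; apply: eq_bigr => p _.
by rewrite rmorphM /= -!hdotC.
Qed.

Lemma tfrm_eql t t0 s :
  (forall a b, \sum_(p <- t) hdot p.1 a * hdot p.2 b = \sum_(p <- t0) hdot p.1 a * hdot p.2 b) ->
  tfrm t s = tfrm t0 s.
Proof.
move=> h; rewrite /tfrm exchange_big [RHS]exchange_big.
by apply: eq_bigr => q _; apply: h.
Qed.

(* Splitting the second components along the first one, as in Gram-Schmidt,
   leaves an elementary tensor orthogonal to a shorter list. *)
Lemma tfrm_ge0 t : 0 <= tfrm t t.
Proof.
have [n] := ubnP (size t); elim: n t => // n IH [|[x y] t] /= tn.
  by rewrite /tfrm big_nil.
have [y0|y0] := eqVneq y 0.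
  have e s : tfrm ((x, y) :: t) s = tfrm t s.
    by apply: tfrm_eql => a b; rewrite big_cons /= y0 hdot0l mulr0 add0r.
  by rewrite e tfrmC e -tfrmC; apply: IH.
have yy0 : hdot y y != 0 by rewrite hdotxx_eq0.
(* [c p] is the coefficient of [p.2] along [y]. Replacing [p.2] by its part orthogonal to [y] moves
   [c p *: p.1] tensor [y] into the first elementary tensor, whose left factor becomes [X]. *)
pose c (p : H * K) := hdot p.2 y / hdot y y.
pose t1 := [seq (p.1, p.2 - c p *: y) | p <- t].
pose X := x + \sum_(p <- t) c p *: p.1.
have e s : tfrm ((x, y) :: t) s = tfrm ((X, y) :: t1) s.
  apply: tfrm_eql => a b; rewrite !big_cons /= big_map /= /X hdotDl hdot_suml mulrDl -addrA.
  congr (_ + _); rewrite mulr_suml -big_split; apply: eq_bigr => p _ /=.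
  by rewrite hdotZl hdotBl hdotZl; ring.
have orth : tfrm t1 [:: (X, y)] = 0.
  rewrite /tfrm big_map big1 // => p _; rewrite big_seq1 /=.
  by rewrite hdotBl hdotZl /c divfK // subrr mulr0.
have -> : tfrm ((x, y) :: t) ((x, y) :: t) = hdot X X * hdot y y + tfrm t1 t1.
  rewrite e tfrmC e -tfrmC.
  have split s : tfrm ((X, y) :: t1) s = tfrm [:: (X, y)] s + tfrm t1 s.
    by rewrite /tfrm big_cons big_seq1.
  have split' s : tfrm s ((X, y) :: t1) = tfrm s [:: (X, y)] + tfrm s t1.
    by rewrite tfrmC split rmorphD /= -!tfrmC.
  rewrite split !split' orth (tfrmC [:: _] t1) orth conjc0 addr0 add0r.
  by rewrite {1}/tfrm !big_seq1.
by rewrite addr_ge0 ?mulr_ge0 ?hdotxx_ge0 //; apply: IH; rewrite size_map.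
Qed.

Lemma tfrm_catl t t' s : tfrm (t ++ t') s = tfrm t s + tfrm t' s.
Proof. by rewrite /tfrm big_cat. Qed.

Lemma tfrm_scalel (c : R[i]) t s :
  tfrm [seq (c *: p.1, p.2) | p <- t] s = c * tfrm t s.
Proof.
rewrite /tfrm big_map mulr_sumr; apply: eq_bigr => p _; rewrite mulr_sumr.
by apply: eq_bigr => q _; rewrite hdotZl mulrA.
Qed.

Definition tensor_sip : sip R :=
  @Sip R (seq (H * K)) (@cat _) (fun c t => [seq (c *: p.1, p.2) | p <- t]) tfrm
    tfrm_catl tfrm_scalel tfrmC tfrm_ge0.

End TensorForm.

Section RepresentationBound.
Variables (R : realType) (A : cstarAlgType R) (H K : hilbert R).
Variables (pi : A -> H -> H).
Hypothesis piP : star_rep pi.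

Lemma star_repB a b x : pi (a - b) x = pi a x - pi b x.
Proof.
have := rep_linear piP (-1) b a x; rewrite !scaleN1r addrC => ->.
by rewrite addrC.
Qed.

Lemma star_repZ c a x : pi (c *: a) x = c *: pi a x.
Proof.
have := rep_linear piP c a 0 x; rewrite addr0 => ->.
have := star_repB 0 0 x; rewrite subrr subrr => ->.
by rewrite addr0.
Qed.

(** By [cstar_sqrt_bound] the difference of the two sides is the form of a list with itself, namely
    of [t] with [b] acting on the first components. Working on lists bounds a tensor 1 and not just
    a, and sharpens the unspecified constant of [rep_op_bounded] to any number above [cnorm a]. *)
Lemma star_rep_contract (a : A) (c : R) (t : seq (H * K)) : cnorm a < c ->
  tfrm [seq (pi a p.1, p.2) | p <- t] [seq (pi a p.1, p.2) | p <- t] <=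
  (c ^+ 2)%:C * tfrm t t.
Proof.
move=> /cstar_sqrt_bound[b bb].
have adj d : tfrm [seq (pi d p.1, p.2) | p <- t] [seq (pi d p.1, p.2) | p <- t] =
    \sum_(p <- t) \sum_(q <- t) hdot (pi (star d * d) p.1) q.1 * hdot p.2 q.2.
  rewrite /tfrm big_map; apply: eq_bigr => p _; rewrite big_map; apply: eq_bigr => q _ /=.
  by rewrite (rep_mul piP) (rep_star piP).
rewrite -subr_ge0; suff -> : (c ^+ 2)%:C * tfrm t t -
    tfrm [seq (pi a p.1, p.2) | p <- t] [seq (pi a p.1, p.2) | p <- t] =
    tfrm [seq (pi b p.1, p.2) | p <- t] [seq (pi b p.1, p.2) | p <- t] by exact: tfrm_ge0.
rewrite !adj bb /tfrm mulr_sumr -sumrB; apply: eq_bigr => p _.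
rewrite mulr_sumr -sumrB; apply: eq_bigr => q _.
by rewrite star_repB star_repZ (rep_one piP) hdotBl hdotZl; ring.
Qed.

End RepresentationBound.

Lemma tfrm_swap (R : realType) (H K : hilbert R) (t s : seq (H * K)) :
  tfrm [seq (p.2, p.1) | p <- t] [seq (p.2, p.1) | p <- s] = tfrm t s.
Proof.
rewrite /tfrm big_map; apply: eq_bigr => p _; rewrite big_map; apply: eq_bigr => q _.
by rewrite mulrC.
Qed.

Record birep (R : realType) (A B : cstarAlgType R) := BiRep {
  bi_left : hilbert R;
  bi_right : hilbert R;
  bi_pi : A -> bi_left -> bi_left;
  bi_rho : B -> bi_right -> bi_right;
  bi_piP : star_rep bi_pi;
  bi_rhoP : star_rep bi_rho
}.

Arguments bi_pi {R A B} w a x : rename.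
Arguments bi_rho {R A B} w b x : rename.
Arguments bi_piP {R A B} w : rename.
Arguments bi_rhoP {R A B} w : rename.

Section SpatialTensor.
Variables (R : realType) (A B : cstarAlgType R).
Hypothesis repA : exists (H : hilbert R) (pi : A -> H -> H), star_rep pi /\ exists x : H, x != 0.
Hypothesis repB : exists (H : hilbert R) (pi : B -> H -> H), star_rep pi /\ exists x : H, x != 0.

Definition ts_scale (c : R[i]) (s : seq (A * B)) := [seq (c *: p.1, p.2) | p <- s].
Definition ts_mul (s s' : seq (A * B)) := [seq (p.1 * q.1, p.2 * q.2) | p <- s, q <- s'].
Definition ts_one : seq (A * B) := [:: (1, 1)].
Definition ts_star (s : seq (A * B)) := [seq (star p.1, star p.2) | p <- s].
Definition bi_sip (w : birep A B) : sip R := tensor_sip (bi_left w) (bi_right w).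
Definition bi_act (w : birep A B) (s : seq (A * B)) (t : bi_sip w) : bi_sip w :=
  tensor_act (bi_pi w) (bi_rho w) s t.

Lemma bi_actE w s (t z : bi_sip w) : frm (bi_act s t) z =
  \sum_(ab <- s) \sum_(xy <- t) \sum_(q <- (z : seq _))
    hdot (bi_pi w ab.1 xy.1) q.1 * hdot (bi_rho w ab.2 xy.2) q.2.
Proof. by rewrite /= /tfrm /bi_act /tensor_act big_allpairs_dep. Qed.

Lemma bi_actD w s s' (v z : bi_sip w) :
  frm (bi_act (s ++ s') v) z = frm (bi_act s v) z + frm (bi_act s' v) z.
Proof. by rewrite !bi_actE big_cat. Qed.

Lemma bi_actZ w c s (v z : bi_sip w) :
  frm (bi_act (ts_scale c s) v) z = c * frm (bi_act s v) z.
Proof.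
rewrite !bi_actE big_map !mulr_sumr; apply: eq_bigr => ab _ /=.
rewrite !mulr_sumr; apply: eq_bigr => xy _; rewrite !mulr_sumr; apply: eq_bigr => q _.
by rewrite (star_repZ (bi_piP w)) hdotZl mulrA.
Qed.

Lemma bi_actM w s s' (v z : bi_sip w) :
  frm (bi_act (ts_mul s s') v) z = frm (bi_act s (bi_act s' v)) z.
Proof.
rewrite !bi_actE /ts_mul big_allpairs_dep; apply: eq_bigr => p _.
rewrite /bi_act /tensor_act big_allpairs_dep; apply: eq_bigr => q _.
apply: eq_bigr => xy _; apply: eq_bigr => r _ /=.
by rewrite (rep_mul (bi_piP w)) (rep_mul (bi_rhoP w)).
Qed.

Lemma bi_act1 w (v z : bi_sip w) : frm (bi_act ts_one v) z = frm v z.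
Proof.
rewrite bi_actE big_seq1; apply: eq_bigr => xy _; apply: eq_bigr => q _ /=.
by rewrite (rep_one (bi_piP w)) (rep_one (bi_rhoP w)).
Qed.

Lemma bi_act_star w s (v z : bi_sip w) : frm (bi_act (ts_star s) v) z = frm v (bi_act s z).
Proof.
rewrite bi_actE big_map /= /tfrm exchange_big; apply: eq_bigr => xy _.
rewrite /bi_act /tensor_act big_allpairs_dep; apply: eq_bigr => ab _.
by apply: eq_bigr => q _; rewrite /= (rep_star (bi_piP w)) (rep_star (bi_rhoP w)).
Qed.

Lemma snorm_leP (V V' : sip R) (v : V) (v' : V') (M : R) : 0 <= M ->
  (snorm v <= M * snorm v') <-> (frm v v <= (M ^+ 2)%:C * frm v' v').
Proof.
move=> M0; rewrite -(ler_pXn2r (_ : (0 < 2)%N)) // ?nnegrE ?mulr_ge0 ?snorm_ge0 //.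
by rewrite exprMn !snorm_sqr -lecR rmorphM /= !snorm2E.
Qed.

(** An elementary tensor acts as a tensor 1 after 1 tensor b. [star_rep_contract] bounds each factor
    uniformly in the representations, the second one through [tfrm_swap]. The summand 1 in [c] and
    [d] provides the strict inequality required there. *)
Lemma bi_act_bounded s : exists2 M, 0 <= M & rep_bound bi_act s M.
Proof.
elim: s => [|[a b] s [M M0 hM]].
  by exists 0 => // w v; apply/snorm_leP => //; rewrite bi_actE big_nil expr0n mul0r.
pose c := cnorm a + 1; pose d := cnorm b + 1.
have c0 : 0 <= c by rewrite addr_ge0 ?cnorm_ge0.
have d0 : 0 <= d by rewrite addr_ge0 ?cnorm_ge0.
exists (c * d + M); first by rewrite addr_ge0 ?mulr_ge0.
move=> w v; rewrite mulrDl -cat1s.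
rewrite (@snorm_eqv _ _ _ _ _ (sip_add (bi_act [:: (a, b)] v) (bi_act s v))); last first.
  by move=> z; rewrite bi_actD frmDl.
apply: le_trans (snormD _ _) _; apply: lerD; last exact: hM.
apply/snorm_leP; first exact: mulr_ge0.
pose v1 : seq (bi_left w * bi_right w) := [seq (p.1, bi_rho w b p.2) | p <- (v : seq _)].
have -> : bi_act [:: (a, b)] v = [seq (bi_pi w a p.1, p.2) | p <- v1].
  by rewrite /bi_act /tensor_act /= cats0 /v1 -map_comp.
have h1 := @star_rep_contract R A _ (bi_right w) _ (bi_piP w) a c v1.
apply: le_trans (h1 _) _; first by rewrite ltrDl.
rewrite (_ : ((c * d) ^+ 2)%:C = (c ^+ 2)%:C * (d ^+ 2)%:C); last by rewrite exprMn rmorphM.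
rewrite -mulrA; apply: ler_wpM2l; first by rewrite lecR exprn_ge0.
have := @star_rep_contract R B _ (bi_left w) _ (bi_rhoP w) b d [seq (p.2, p.1) | p <- (v : seq _)].
rewrite tfrm_swap => h2; apply: le_trans (h2 _); last by rewrite ltrDl.
rewrite -(tfrm_swap v1) /v1 -!map_comp.
by rewrite le_eqVlt; apply/orP; left; apply/eqP; congr tfrm; apply: eq_map.
Qed.

Lemma bi_act_nontrivial : exists w, exists v : bi_sip w, 0 < snorm v.
Proof.
have [H [pi [piP [x x0]]]] := repA; have [K [rho [rhoP [y y0]]]] := repB.
exists (BiRep piP rhoP), [:: (x, y)].
rewrite lt_def snorm_ge0 andbT; apply/eqP => h.
have : hdot x x * hdot y y = 0.
  have := snorm2E ([:: (x, y)] : bi_sip (BiRep piP rhoP)).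
  by rewrite -snorm_sqr h expr0n /= /tfrm !big_seq1.
by move/eqP; rewrite mulf_eq0 !hdotxx_eq0 (negPf x0) (negPf y0).
Qed.

Definition tensor_raw : rawcstar R :=
  rep_rawcstar bi_actD bi_actZ bi_actM bi_act1 bi_act_star bi_act_bounded bi_act_nontrivial.

Definition spatial_prod : cstarAlgType R := rc_cstar tensor_raw.
Definition tens (a : A) (b : B) : spatial_prod := rembed ([:: (a, b)] : tensor_raw).

Lemma rembed_tens (s : seq (A * B)) :
  rembed (s : tensor_raw) = \sum_(p <- s) tens p.1 p.2.
Proof.
elim: s => [|[a b] s IH].
  rewrite big_nil -(scale0r (rembed (rc_one tensor_raw))) -rembedZ; apply: rembed_eqv.
  by move=> w v z; rewrite [RHS]bi_actZ mul0r bi_actE big_nil.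
by rewrite big_cons -IH -rembedD.
Qed.

Lemma spatial_prodP : spatial_tensor tens.
Proof.
split.
- move=> c a a' b; rewrite /tens -rembedZ -rembedD; apply: rembed_eqv => w v z.
  rewrite [RHS]bi_actD bi_actZ !bi_actE !big_seq1 mulr_sumr -big_split.
  apply: eq_bigr => xy _; rewrite /= mulr_sumr -big_split; apply: eq_bigr => q _ /=.
  by rewrite (rep_linear (bi_piP w)) hdotDl hdotZl; ring.
- move=> c a b b'; rewrite /tens -rembedZ -rembedD; apply: rembed_eqv => w v z.
  rewrite [RHS]bi_actD bi_actZ !bi_actE !big_seq1 mulr_sumr -big_split.
  apply: eq_bigr => xy _; rewrite /= mulr_sumr -big_split; apply: eq_bigr => q _ /=.
  by rewrite (rep_linear (bi_rhoP w)) hdotDl hdotZl; ring.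
- by move=> a a' b b'; rewrite /tens -rembedM.
- by [].
- by move=> a b; rewrite /tens -rembed_star.
- move=> x e /(rembed_dense x)[s hs]; exists (rembed s) => //.
  by exists s; rewrite rembed_tens.
- move=> s M M0; rewrite -rembed_tens cnorm_rembed.
  have := rep_norm_le bi_act_bounded s M0.
  rewrite -/(rc_norm (s : tensor_raw)) => ->; split=> [h H K pi rho piP rhoP t|h w v].
    by apply/(@snorm_leP (bi_sip (BiRep piP rhoP)) (bi_sip (BiRep piP rhoP)) _ _ _ M0)/h.
  by apply/snorm_leP => //; apply: h; [apply: bi_piP|apply: bi_rhoP].
Qed.

End SpatialTensor.

(** * The complex numbers as a Hilbert space and a C*-algebra *)

Section ComplexHilbert.
Variable R : realType.
Implicit Types z w : R[i].

Lemma normc_le_parts z : `|z| <= (`|complex.Re z| + `|complex.Im z|)%:C.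
Proof.
rewrite normc_def lecR -(ler_pXn2r (_ : (0 < 2)%N)) // ?nnegrE ?addr_ge0 ?sqrtr_ge0 //.
rewrite sqr_sqrtr ?addr_ge0 ?sqr_ge0 // sqrrD !real_normK ?num_real //.
by rewrite addrAC lerDl mulrn_wge0 // mulr_ge0.
Qed.

Lemma normc_ge_Im z : `|complex.Im z|%:C <= `|z|.
Proof.
rewrite normc_def lecR -sqrtr_sqr ler_wsqrtr // lerDr sqr_ge0 //.
Qed.

Lemma cabs_ge_Re z : `|complex.Re z| <= cabs z.
Proof. by rewrite -lecR cabsE normc_ge_Re. Qed.

Lemma cabs_ge_Im z : `|complex.Im z| <= cabs z.
Proof. by rewrite -lecR cabsE normc_ge_Im. Qed.

Fact complex_cauchy_cvg (F : set_system R[i]^o) :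
  ProperFilter F -> cauchy F -> cvg F.
Proof.
move=> FF /cauchyP Fc.
have part (f : R[i] -> R) (fB : forall z w, f (z - w) = f z - f w)
    (fle : forall z, `|f z|%:C <= `|z|) : cvg (f @ F)%classic.
  apply: cauchy_cvg; apply: cauchy_exP => e e0.
  have [|z Fz] := Fc e%:C; first by rewrite ltcR.
  exists (f z); suff : F [set w | `|f z - f w| < e]%classic by [].
  apply: filterS Fz => w; rewrite -ball_normE /ball_ /= => h.
  by rewrite -fB -ltcR (le_lt_trans (fle _)).
have hRe : cvg ((fun z => complex.Re z) @ F)%classic.
  by apply: part => [[a b] [c d]|z] //; apply: normc_ge_Re.
have hIm : cvg ((fun z => complex.Im z) @ F)%classic.
  by apply: part => [[a b] [c d]|z] //; apply: normc_ge_Im.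
apply/cvg_ex; exists ((lim ((fun z => complex.Re z) @ F))%classic +i*
  (lim ((fun z => complex.Im z) @ F))%classic).
move/cvgrPdist_lt in hRe; move/cvgrPdist_lt in hIm.
apply/cvgrPdist_lt => e e0.
have [d d0 ->] : exists2 d : R, 0 < d & e = d%:C.
  exists (complex.Re e); move: e0; rewrite ltcE /= => /andP[/eqP i0 //].
  by case: e i0 => a b /= ->.
have d2 : 0 < d / 2 by lra.
have ReB (z w : R[i]) : complex.Re (z - w) = complex.Re z - complex.Re w by case: z; case: w.
have ImB (z w : R[i]) : complex.Im (z - w) = complex.Im z - complex.Im w by case: z; case: w.
near=> z; apply: le_lt_trans (normc_le_parts _) _; rewrite ltcR.
have : `|lim ((fun z => complex.Re z) @ F)%classic - complex.Re z| < d / 2.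
  by near: z; apply: hRe.
have : `|lim ((fun z => complex.Im z) @ F)%classic - complex.Im z| < d / 2.
  by near: z; apply: hIm.
rewrite ReB ImB /=; lra.
Unshelve. all: by end_near. Qed.

(* An alias, because [R^o] already carries the completeness of real types. *)
Definition cline : Type := R[i]^o.
HB.instance Definition _ := NormedModule.on cline.
HB.instance Definition _ := Uniform_isComplete.Build cline complex_cauchy_cvg.


Fact cline_dotP (c : R[i]) (x y z : cline) :
  ((c *: x + y : R[i]) * conjc z) = c * ((x : R[i]) * conjc z) + (y : R[i]) * conjc z.
Proof. by rewrite mulrDl -[c *: x]/(c * x) mulrA. Qed.
Fact cline_dotC (x y : cline) : (x : R[i]) * conjc y = conjc ((y : R[i]) * conjc x).
Proof. by rewrite rmorphM /= conjcK mulrC. Qed.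
Fact cline_dot_norm (x : cline) : (x : R[i]) * conjc x = `|x| ^+ 2.
Proof. by rewrite -sqr_normc. Qed.

Definition complex_hilbert : hilbert R := Hilbert cline_dotP cline_dotC cline_dot_norm.

Lemma cabsD z w : cabs (z + w) <= cabs z + cabs w.
Proof. by rewrite -lecR rmorphD /= !cabsE ler_normD. Qed.

Lemma cabsM z w : cabs (z * w) = cabs z * cabs w.
Proof. by apply: real_complex_inj; rewrite rmorphM /= !cabsE normrM. Qed.

Fact cabs_eq0 (z : R[i]^o) : cabs z = 0 -> z = 0.
Proof. by move=> h; apply/eqP; rewrite -normr_eq0 -[`|z|]cabsE h. Qed.
Fact cabsZ (c : R[i]) (z : R[i]^o) : (cabs (c *: z))%:C = `|c| * (cabs z)%:C.
Proof. by rewrite -[c *: z]/(c * z) cabsM rmorphM /= cabsE. Qed.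
Fact cabsM_le (z w : R[i]^o) : cabs (z * w) <= cabs z * cabs w.
Proof. by rewrite cabsM. Qed.
Fact cabs_conj_sqr (z : R[i]^o) : cabs (conjc z * z) = cabs z ^+ 2.
Proof.
rewrite cabsM expr2; congr (_ * _); apply: real_complex_inj.
by rewrite !cabsE normcJ.
Qed.
Fact conjZ (c : R[i]) (z : R[i]^o) : conjc (c *: z) = conjc c *: (conjc z : R[i]^o).
Proof. exact: rmorphM. Qed.
Fact conjM (z w : R[i]^o) : conjc (z * w) = conjc w * conjc z.
Proof. by rewrite rmorphM mulrC. Qed.
Fact conjD : {morph (@conjc R : R[i]^o -> R[i]^o) : z w / z + w}.
Proof. exact: rmorphD. Qed.
Fact cabs_complete : norm_complete (@cabs R : R[i]^o -> R).
Proof.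
move=> v vC.
have part (f : R[i] -> R) (fB : forall z w, f (z - w) = f z - f w)
    (fle : forall z, `|f z| <= cabs z) : exists l, tends (fun n => f (v n)) l.
  apply: tends_cauchy => e /vC[m hm]; exists m => n mn.
  by rewrite -fB; apply: le_lt_trans (fle _) (hm n m mn (leqnn _)).
have [||a ha] := part (fun z => complex.Re z); [by case=> ? ? []|exact: cabs_ge_Re|].
have [||b hb] := part (fun z => complex.Im z); [by case=> ? ? []|exact: cabs_ge_Im|].
exists (a +i* b : R[i]); apply: null_le (nullD ha hb) => n; rewrite -lecR cabsE.
by apply: le_trans (normc_le_parts _) _; case: (v n).
Qed.

HB.instance Definition _ := isCStarAlgebra.Build R R[i]^o (@conjcK R) conjD conjZ conjM
  cabs_eq0 cabsD cabsZ cabsM_le cabs_conj_sqr cabs_complete.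

(** The algebra acts on the complex line by multiplication. This supplies the nonzero
    representations that keep the spatial norm of 1 away from 0. *)
Lemma character_star_rep (A : cstarAlgType R) (chi : {lrmorphism A -> R[i]^o}) :
  star_hom chi ->
  exists (H : hilbert R) (pi : A -> H -> H), star_rep pi /\ exists x : H, x != 0.
Proof.
move=> chiS; exists complex_hilbert, (fun a (x : cline) => (chi a : R[i]) *: x).
split; last by exists (1 : R[i]); apply: oner_neq0.
split.
- by move=> a c x y; rewrite scalerDr !scalerA mulrC.
- by move=> a; exists `|chi a : R[i]| => x; rewrite normrZ.
- by move=> c a b x; rewrite linearP scalerDl scalerA.
- by move=> a b x; rewrite rmorphM scalerA.
- by move=> x; rewrite rmorph1 scale1r.
- move=> a x y; rewrite chiS /= -[_ *: x]/(conjc (chi a) * (x : R[i])).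
  by rewrite -[_ *: y]/((chi a : R[i]) * (y : R[i])) rmorphM /= mulrCA mulrA.
Qed.

End ComplexHilbert.

(** * Universal C*-algebras *)

Section UniversalAlgebra.
Variables (R : realType) (n : nat) (rel : forall k l, tensor_map R n k l -> Prop).

(** Unreduced noncommutative *-polynomials in the generators. The algebra laws and the defining
    relations are imposed together, through [term_eqv]. *)
Inductive term :=
| Gen of 'I_n & 'I_n
| One
| Add of term & term
| Scale of R[i] & term
| Mul of term & term
| Star of term.

Fixpoint teval (B : cstarAlgType R) (u : 'M[B]_n) (t : term) : B :=
  match t with
  | Gen i j => u i j
  | One => 1
  | Add s t => teval u s + teval u t
  | Scale c t => c *: teval u t
  | Mul s t => teval u s * teval u t
  | Star t => star (teval u t)
  end.

Definition admissible (B : cstarAlgType R) (u : 'M[B]_n) : Prop :=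
  (forall i j, star (u i j) = u i j) /\
  forall k l (T : tensor_map R n k l), rel T -> intertwiner u T.

Hypothesis adm_le1 : forall (B : cstarAlgType R) (u : 'M[B]_n),
  admissible u -> forall i j, cnorm (u i j) <= 1.
Hypothesis adm_exists : exists (B : cstarAlgType R) (u : 'M[B]_n), admissible u.

Definition term_bound t (M : R) :=
  forall (B : cstarAlgType R) (u : 'M[B]_n), admissible u -> cnorm (teval u t) <= M.

Definition term_eqv s t :=
  forall (B : cstarAlgType R) (u : 'M[B]_n), admissible u -> teval u s = teval u t.

(** The universal C*-norm, that is, the supremum of the norms of all evaluations at admissible
    matrices, again as a least bound. *)
Definition term_norm t : R := inf [set M | 0 <= M /\ term_bound t M]%classic.

Lemma term_bounded t : exists2 M, 0 <= M & term_bound t M.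
Proof.
elim: t => [i j||s [M M0 hM] t [L L0 hL]|c t [M M0 hM]|s [M M0 hM] t [L L0 hL]|t [M M0 hM]].
- by exists 1 => // B u au; apply: adm_le1.
- by exists 1 => // B u au; rewrite cnorm1.
- exists (M + L); first exact: addr_ge0.
  by move=> B u au; apply: le_trans (cnormD _ _) _; rewrite lerD ?hM ?hL.
- exists (cabs c * M); first by rewrite mulr_ge0 ?cabs_ge0.
  by move=> B u au /=; rewrite cnormZ_cabs ler_wpM2l ?cabs_ge0 ?hM.
- exists (M * L); first exact: mulr_ge0.
  by move=> B u au; apply: le_trans (cnormM _ _) _; rewrite ler_pM ?cnorm_ge0 ?hM ?hL.
- by exists M => // B u au /=; rewrite cnorm_starE hM.
Qed.

Lemma term_has_inf t : has_inf [set M | 0 <= M /\ term_bound t M]%classic.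
Proof. by split; [have [M] := term_bounded t; exists M|exists 0 => M []]. Qed.

Lemma term_norm_ge0 t : 0 <= term_norm t.
Proof. by apply: lb_le_inf; [case: (term_has_inf t)|move=> M []]. Qed.

Lemma term_normP t : term_bound t (term_norm t).
Proof.
move=> B u au; apply: lb_le_inf; first by case: (term_has_inf t).
by move=> M [_]; apply.
Qed.

Lemma term_norm_le t M : 0 <= M -> term_bound t M -> term_norm t <= M.
Proof. by move=> M0 h; apply: ge_inf => //; case: (term_has_inf t). Qed.

Fact term_eqv_norm s t : term_eqv s t -> term_norm s = term_norm t.
Proof.
move=> h; rewrite /term_norm; congr inf; apply/seteqP.
by split=> M [M0 hM]; split=> // B u au; [rewrite -h ?hM|rewrite h ?hM].
Qed.

Fact term_normD s t : term_norm (Add s t) <= term_norm s + term_norm t.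
Proof.
apply: term_norm_le => [|B u au]; first by rewrite addr_ge0 ?term_norm_ge0.
by apply: le_trans (cnormD _ _) _; rewrite lerD ?term_normP.
Qed.

Lemma term_normZ_le c t : term_norm (Scale c t) <= cabs c * term_norm t.
Proof.
apply: term_norm_le => [|B u au /=]; first by rewrite mulr_ge0 ?cabs_ge0 ?term_norm_ge0.
by rewrite cnormZ_cabs ler_wpM2l ?cabs_ge0 ?term_normP.
Qed.

Fact term_normZ c t : term_norm (Scale c t) = cabs c * term_norm t.
Proof.
apply/eqP; rewrite eq_le term_normZ_le /=.
have [->|c0] := eqVneq c 0.
  by rewrite (_ : cabs 0 = 0) ?mul0r ?term_norm_ge0 // /cabs normr0.
have cp : 0 < cabs c.
  rewrite lt_def cabs_ge0 andbT; apply: contra_neq c0 => h.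
  by apply/eqP; rewrite -normr_eq0 -cabsE h.
rewrite mulrC -ler_pdivlMr //; apply: term_norm_le => [|B u au].
  by rewrite divr_ge0 ?cabs_ge0 ?term_norm_ge0.
have := term_normP (Scale c t) au; rewrite /= cnormZ_cabs.
by rewrite ler_pdivlMr // mulrC.
Qed.

Fact term_normM s t : term_norm (Mul s t) <= term_norm s * term_norm t.
Proof.
apply: term_norm_le => [|B u au]; first by rewrite mulr_ge0 ?term_norm_ge0.
by apply: le_trans (cnormM _ _) _; rewrite ler_pM ?cnorm_ge0 ?term_normP.
Qed.

Fact term_norm_star t : term_norm (Mul (Star t) t) = term_norm t ^+ 2.
Proof.
apply/eqP; rewrite eq_le; apply/andP; split.
  apply: term_norm_le => [|B u au /=]; first exact: sqr_ge0.
  by rewrite cnorm_star ler_pXn2r ?nnegrE ?cnorm_ge0 ?term_norm_ge0 ?term_normP.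
set m := term_norm (Mul _ _); have m0 : 0 <= m := term_norm_ge0 _.
rewrite -[m]sqr_sqrtr // ler_pXn2r ?nnegrE ?term_norm_ge0 ?sqrtr_ge0 //.
apply: term_norm_le => [|B u au]; first exact: sqrtr_ge0.
rewrite -(ler_pXn2r (_ : (0 < 2)%N)) // ?nnegrE ?cnorm_ge0 ?sqrtr_ge0 //.
by rewrite sqr_sqrtr // -cnorm_star; apply: (term_normP (Mul (Star t) t)).
Qed.

Fact term_norm1_neq0 : term_norm One != 0.
Proof.
have [B [u au]] := adm_exists; apply/eqP => h.
by have := term_normP One au; rewrite h /= cnorm1 ler10.
Qed.

Definition term_raw : rawcstar R.
Proof.
refine (@RawCStar R term Add Scale Mul One Star term_norm term_eqv
  _ _ _ _ _ _ _ term_eqv_norm _ _ _ _ _ _ _ _ _ _ _ _ _ _ _ _ _ _ _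
  term_normD term_normZ term_normM term_norm_star term_norm1_neq0).
- by [].
- by move=> x y h B u au; rewrite h.
- by move=> y x z h h' B u au; rewrite h ?h'.
- by move=> x x' y y' h h' B u au /=; rewrite h ?h'.
- by move=> c x x' h B u au /=; rewrite h.
- by move=> x x' y y' h h' B u au /=; rewrite h ?h'.
- by move=> x x' h B u au /=; rewrite h.
- by move=> x y z B u _ /=; rewrite addrA.
- by move=> x y B u _ /=; rewrite addrC.
- by move=> x B u _ /=; rewrite scale0r add0r.
- by move=> x B u _ /=; rewrite scaleN1r addNr scale0r.
- by move=> x y z B u _ /=; rewrite mulrA.
- by move=> x B u _ /=; rewrite mul1r.
- by move=> x B u _ /=; rewrite mulr1.
- by move=> x y z B u _ /=; rewrite mulrDl.
- by move=> x y z B u _ /=; rewrite mulrDr.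
- by move=> a b x B u _ /=; rewrite scalerA.
- by move=> x B u _ /=; rewrite scale1r.
- by move=> c x y B u _ /=; rewrite scalerDr.
- by move=> x a b B u _ /=; rewrite scalerDl.
- by move=> c x y B u _ /=; rewrite scalerAl.
- by move=> c x y B u _ /=; rewrite scalerAr.
- by move=> x B u _ /=; rewrite starK.
- by move=> x y B u _ /=; rewrite starD.
- by move=> c x B u _ /=; rewrite starZ.
- by move=> x y B u _ /=; rewrite starM.
Defined.

Definition univ_alg : cstarAlgType R := rc_cstar term_raw.
Definition univ_mx : 'M[univ_alg]_n := \matrix_(i, j) rembed (Gen i j : term_raw).

Lemma teval_univ t : teval univ_mx t = rembed (t : term_raw).
Proof.
elim: t => [i j||s IHs t IHt|c t IHt|s IHs t IHt|t IHt] /=.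
- by rewrite mxE.
- by [].
- by rewrite IHs IHt -rembedD.
- by rewrite IHt -rembedZ.
- by rewrite IHs IHt -rembedM.
- by rewrite IHt -rembed_star.
Qed.

(** A construction is natural in the algebra when one term computes it everywhere. Both sides of an
    intertwining relation are of this kind, so a relation valid at all admissible matrices is an
    instance of [term_eqv]. *)
Definition term_repr (F : forall B : cstarAlgType R, 'M[B]_n -> B) :=
  exists t, forall (B : cstarAlgType R) (u : 'M[B]_n), F B u = teval u t.

Lemma term_repr_sum (I : Type) (r : seq I) (F : I -> forall B : cstarAlgType R, 'M[B]_n -> B) :
  (forall i, term_repr (F i)) -> term_repr (fun B u => \sum_(i <- r) F i B u).
Proof.
move=> h; elim: r => [|i r [t ht]].
  by exists (Scale 0 One) => B u; rewrite big_nil /= scale0r.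
by have [s hs] := h i; exists (Add s t) => B u; rewrite big_cons /= hs ht.
Qed.

Lemma term_repr_prod (I : Type) (r : seq I) (F : I -> forall B : cstarAlgType R, 'M[B]_n -> B) :
  (forall i, term_repr (F i)) -> term_repr (fun B u => \prod_(i <- r) F i B u).
Proof.
move=> h; elim: r => [|i r [t ht]].
  by exists One => B u; rewrite big_nil.
by have [s hs] := h i; exists (Mul s t) => B u; rewrite big_cons /= hs ht.
Qed.

Lemma term_repr_tensor_pow k (c : R[i]) (i j : multi_index n k) :
  term_repr (fun B u => c *: mx_tensor_pow u i j).
Proof.
have [t ht] : term_repr (fun B u => mx_tensor_pow u i j).
  by apply: term_repr_prod => s; exists (Gen (i s) (j s)).
by exists (Scale c t) => B u; rewrite ht.
Qed.

Lemma intertwiner_terms k l (T : tensor_map R n k l) j i : exists s t : term,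
  forall (B : cstarAlgType R) (u : 'M[B]_n),
    \sum_(i' : multi_index n k) (T (j, i') : R[i]) *: mx_tensor_pow u i' i = teval u s /\
    \sum_(j' : multi_index n l) (T (j', i) : R[i]) *: mx_tensor_pow u j j' = teval u t.
Proof.
have [|s hs] := @term_repr_sum _ (index_enum (multi_index n k))
    (fun i' B u => (T (j, i') : R[i]) *: mx_tensor_pow u i' i).
  by move=> i'; apply: term_repr_tensor_pow.
have [|t ht] := @term_repr_sum _ (index_enum (multi_index n l))
    (fun j' B u => (T (j', i) : R[i]) *: mx_tensor_pow u j j').
  by move=> j'; apply: term_repr_tensor_pow.
by exists s, t => B u; rewrite hs ht.
Qed.


Lemma univ_admissible : admissible univ_mx.
Proof.
split=> [i j|k l T rT j i].
  rewrite mxE -rembed_star; apply: (rembed_eqv (P := term_raw)) => B u au /=.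
  by case: au.
have [s [t st]] := intertwiner_terms T j i.
have [-> ->] := st _ univ_mx; rewrite !teval_univ.
apply: (rembed_eqv (P := term_raw)) => B u au; have [<- <-] := st _ u.
by case: au => _; apply.
Qed.

Lemma univ_property (B : cstarAlgType R) (u : 'M[B]_n) : admissible u ->
  exists F : {lrmorphism univ_alg -> B},
    star_hom F /\ forall t : term_raw, F (rembed t) = teval u t.
Proof.
move=> au; apply: rembed_extension => //.
- by move=> x y h; apply: h.
- by move=> t; apply: term_normP.
Qed.

Lemma univ_coeff_alg (t : term_raw) : mx_coeff_alg univ_mx (rembed t).
Proof.
elim: t => [i j||s IHs t IHt|c t IHt|s IHs t IHt|t IHt].
- by apply: star_subalg_gen; exists i, j; rewrite mxE.
- exact: star_subalg_1.
- by rewrite rembedD; apply: star_subalg_D.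
- by rewrite rembedZ; apply: star_subalg_Z.
- by rewrite rembedM; apply: star_subalg_M.
- by rewrite rembed_star; apply: star_subalg_star.
Qed.

Lemma coeff_alg_univ x : mx_coeff_alg univ_mx x -> exists t : term_raw, x = rembed t.
Proof.
elim=> [y [i [j ->]]||y z _ [s ->] _ [t ->]|c y _ [t ->]|y z _ [s ->] _ [t ->]|y _ [t ->]].
- by exists (Gen i j); rewrite mxE.
- by exists One.
- by exists (Add s t); rewrite -rembedD.
- by exists (Scale c t); rewrite -rembedZ.
- by exists (Mul s t); rewrite -rembedM.
- by exists (Star t); rewrite -rembed_star.
Qed.

Lemma univ_dense : cdense (mx_coeff_alg univ_mx).
Proof.
move=> x e /(rembed_dense x)[t ht]; exists (rembed t) => //.
exact: univ_coeff_alg.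
Qed.

(** The defining relations are equations inside the coefficient algebra, so a *-homomorphism defined
    only there still carries [univ_mx] to an admissible matrix, and the universal property extends
    it. *)
Lemma univ_enveloping : enveloping (mx_coeff_alg univ_mx).
Proof.
split; first exact: univ_dense.
move=> B f f1 fD fZ fM fS; pose u : 'M[B]_n := \matrix_(i, j) f (univ_mx i j).
have Pt := univ_coeff_alg.
have fu (t : term_raw) : f (rembed t) = teval u t.
  elim: t => [i j||s IHs t IHt|c t IHt|s IHs t IHt|t IHt] /=.
  - by rewrite !mxE.
  - exact: f1.
  - by rewrite rembedD fD // IHs IHt.
  - by rewrite rembedZ fZ // IHt.
  - by rewrite rembedM fM // IHs IHt.
  - by rewrite rembed_star fS // IHt.
have [uS uT] := univ_admissible.
have au : admissible u.
  split=> [i j|k l T rT j i].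
    by rewrite mxE -fS ?uS // mxE.
  have [s [t st]] := intertwiner_terms T j i.
  have [-> ->] := st _ u; rewrite -!fu; congr f; rewrite -!teval_univ.
  by have [<- <-] := st _ univ_mx; apply: uT.
have [F [FS FE]] := univ_property au; exists F; split=> // x /coeff_alg_univ[t ->].
by rewrite FE fu.
Qed.

End UniversalAlgebra.

(** * Matrices as a C*-algebra *)

Section MatrixAlgebra.
Variables (R : realType) (N : nat).
Notation mat := 'M[R[i]]_N.+1.
Notation vec := 'cV[R[i]]_N.+1.

Definition mx_frm (v w : vec) : R[i] := \sum_x v x 0 * conjc (w x 0).

Fact mx_frmDl v w z : mx_frm (v + w) z = mx_frm v z + mx_frm w z.
Proof. by rewrite /mx_frm -big_split; apply: eq_bigr => x _; rewrite mxE mulrDl. Qed.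
Fact mx_frmZl c v z : mx_frm (c *: v) z = c * mx_frm v z.
Proof. by rewrite /mx_frm mulr_sumr; apply: eq_bigr => x _; rewrite mxE mulrA. Qed.
Fact mx_frmC v w : mx_frm v w = conjc (mx_frm w v).
Proof.
rewrite /mx_frm rmorph_sum; apply: eq_bigr => x _.
by rewrite rmorphM /= conjcK mulrC.
Qed.
Fact mx_frm_ge0 v : 0 <= mx_frm v v.
Proof. by apply: sumr_ge0 => x _; apply: mulcJ_ge0. Qed.

Definition mx_sip : sip R := @Sip R vec +%R *:%R mx_frm mx_frmDl mx_frmZl mx_frmC mx_frm_ge0.

Definition mx_star (A : mat) : mat := \matrix_(i, j) conjc (A j i).
Definition mx_act (w : unit) (A : mat) (v : mx_sip) : mx_sip := (A *m (v : vec))%R.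

Fact mx_actD w A B (v z : mx_sip) :
  frm (mx_act w (A + B) v) z = frm (mx_act w A v) z + frm (mx_act w B v) z.
Proof. by rewrite /= /mx_act mulmxDl mx_frmDl. Qed.
Fact mx_actZ w c A (v z : mx_sip) : frm (mx_act w (c *: A) v) z = c * frm (mx_act w A v) z.
Proof. by rewrite /= /mx_act -scalemxAl mx_frmZl. Qed.
Fact mx_actM w A B (v z : mx_sip) :
  frm (mx_act w (A *m B) v) z = frm (mx_act w A (mx_act w B v)) z.
Proof. by rewrite /= /mx_act mulmxA. Qed.
Fact mx_act1 w (v z : mx_sip) : frm (mx_act w 1%:M v) z = frm v z.
Proof. by rewrite /= /mx_act mul1mx. Qed.
Fact mx_act_star w A (v z : mx_sip) : frm (mx_act w (mx_star A) v) z = frm v (mx_act w A z).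
Proof.
rewrite /= /mx_act /mx_frm.
under eq_bigr do rewrite mxE mulr_suml.
rewrite exchange_big; apply: eq_bigr => x _.
rewrite mxE rmorph_sum mulr_sumr; apply: eq_bigr => y _.
by rewrite mxE rmorphM /= mulrCA mulrA.
Qed.

Lemma mx_snorm2 (v : mx_sip) : snorm2 v = \sum_x cabs ((v : vec) x 0) ^+ 2.
Proof.
apply: real_complex_inj; rewrite snorm2E /= /mx_frm rmorph_sum; apply: eq_bigr => x _.
by rewrite rmorphXn /= cabsE sqr_normc.
Qed.

Lemma cabs_le_snorm (v : mx_sip) x : cabs ((v : vec) x 0) <= snorm v.
Proof.
rewrite -(ler_pXn2r (_ : (0 < 2)%N)) // ?nnegrE ?cabs_ge0 ?snorm_ge0 //.
rewrite snorm_sqr mx_snorm2 (bigD1 x) //= lerDl.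
by apply: sumr_ge0 => y _; apply: sqr_ge0.
Qed.

Fact mx_act_bounded A : exists2 M, 0 <= M & rep_bound mx_act A M.
Proof.
(* Each coordinate of v is at most its norm, so the coordinate x of A v is at most [m x] times the
   norm of v. *)
pose m x := \sum_y cabs (A x y).
have m0 x : 0 <= m x by apply: sumr_ge0 => y _; apply: cabs_ge0.
have S0 : 0 <= \sum_x m x ^+ 2 by apply: sumr_ge0 => x _; apply: sqr_ge0.
exists (Num.sqrt (\sum_x m x ^+ 2)); first exact: sqrtr_ge0.
move=> w v; rewrite -(ler_pXn2r (_ : (0 < 2)%N)) // ?nnegrE ?mulr_ge0 ?snorm_ge0 ?sqrtr_ge0 //.
rewrite exprMn (sqr_sqrtr S0) snorm_sqr mx_snorm2 mulr_suml; apply: ler_sum => x _.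
rewrite -exprMn ler_pXn2r ?nnegrE ?cabs_ge0 ?mulr_ge0 ?snorm_ge0 //.
rewrite mxE mulr_suml -lecR cabsE; apply: le_trans (ler_norm_sum _ _ _) _.
rewrite rmorph_sum; apply: ler_sum => y _.
by rewrite -cabsE lecR cabsM ler_wpM2l ?cabs_ge0 ?cabs_le_snorm.
Qed.

Fact mx_act_nontrivial : exists w : unit, exists v : mx_sip, 0 < snorm v.
Proof.
exists tt, (const_mx 1 : vec); rewrite lt_def snorm_ge0 andbT; apply/eqP => h.
have := cabs_le_snorm (const_mx 1 : vec) 0; rewrite h mxE /cabs normr1 /=.
by rewrite ler10.
Qed.

Definition mx_raw : rawcstar R :=
  rep_rawcstar mx_actD mx_actZ mx_actM mx_act1 mx_act_star mx_act_bounded mx_act_nontrivial.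

Definition mx_cstar : cstarAlgType R := rc_cstar mx_raw.
Definition mx_embed (A : mat) : mx_cstar := rembed (A : mx_raw).

Lemma mx_embed1 : mx_embed 1%:M = 1.
Proof. exact: (rembed1 mx_raw). Qed.

Lemma mx_embedM A B : mx_embed (A *m B) = mx_embed A * mx_embed B.
Proof. exact: (@rembedM R mx_raw A B). Qed.

Lemma mx_embed_star A : mx_embed (mx_star A) = star (mx_embed A).
Proof. exact: (@rembed_star R mx_raw A). Qed.

Lemma mx_embed_inj : injective mx_embed.
Proof.
move=> A B /eqP; rewrite -subr_eq0 -scaleN1r -rembedZ -rembedD => /eqP AB.
have := cnorm_rembed (rc_add (A : mx_raw) (rc_scale (-1) (B : mx_raw))).
rewrite AB cnorm0 => h.
apply/matrixP => x y; apply/eqP; rewrite -subr_eq0.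
have := rep_normP mx_act_bounded (A + (-1) *: B) (w := tt) (delta_mx y 0 : vec).
rewrite -[rep_norm _ _]h mul0r => le0.
have := le_trans (cabs_le_snorm _ x) le0.
rewrite /mx_act -colE mxE scaleN1r !mxE => c0.
rewrite -normr_eq0 -cabsE; apply/eqP; congr (_%:C); apply/eqP.
by rewrite eq_le c0 cabs_ge0.
Qed.

End MatrixAlgebra.

(** * Intertwiners defined by word relations *)

Section WordRelations.
Variables (n : nat) (K : Type) (N : K -> nat).
Variable g : forall k : K, 'I_n -> 'I_(N k).+1 -> 'I_(N k).+1.
Arguments g : clear implicits.
Hypothesis gK : forall k i, involutive (g k i).

Definition wact k (w : seq 'I_n) (x : 'I_(N k).+1) := foldr (g k) x w.

Arguments wact : clear implicits.

(* Quantifying over [f] makes the relation stable under identification of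
   letters, that is, under merging the blocks of a partition. *)
Definition weqv (s t : seq 'I_n) :=
  forall k (f : 'I_n -> 'I_n) x, wact k (map f s) x = wact k (map f t) x.

Lemma wact_cat k s t x : wact k (s ++ t) x = wact k s (wact k t x).
Proof. exact: foldr_cat. Qed.

Lemma weqv_refl s : weqv s s.
Proof. by []. Qed.

Lemma weqv_sym s t : weqv s t -> weqv t s.
Proof. by move=> h k f x; rewrite h. Qed.

Lemma weqv_trans t s r : weqv s t -> weqv t r -> weqv s r.
Proof. by move=> h h' k f x; rewrite h h'. Qed.

Lemma weqv_cat s s' t t' : weqv s s' -> weqv t t' -> weqv (s ++ t) (s' ++ t').
Proof. by move=> h h' k f x; rewrite !map_cat !wact_cat h h'. Qed.

Lemma weqv_sqr i : weqv [:: i; i] [::].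
Proof. by move=> k f x /=; rewrite /wact /= gK. Qed.

Lemma weqv_map (f : 'I_n -> 'I_n) s t : weqv s t -> weqv (map f s) (map f t).
Proof. by move=> h k f' x; rewrite -!map_comp h. Qed.

Definition word k (i : multi_index n k) : seq 'I_n := [seq i s | s <- enum 'I_k].

Lemma word0 (i : multi_index n 0) : word i = [::].
Proof. by rewrite /word (size0nil (size_enum_ord 0)). Qed.

Lemma wordS k (i : multi_index n k.+1) : word i = i ord0 :: word [ffun s => i (lift ord0 s)].
Proof.
rewrite /word enum_ordSl /= -map_comp; congr (_ :: _); apply: eq_map => s /=.
by rewrite ffunE.
Qed.

Lemma word_map k (f : 'I_n -> 'I_n) (i : multi_index n k) :
  word [ffun s => f (i s)] = map f (word i).
Proof. by rewrite /word -map_comp; apply: eq_map => s; rewrite /= ffunE. Qed.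

Variable R : realType.

Definition word_rel k l (T : tensor_map R n k l) : Prop :=
  (forall (p : {perm 'I_n}) (j : multi_index n l) (i : multi_index n k), T ([ffun s => p (j s)], [ffun s => p (i s)]) = T (j, i)) /\
  (forall j i, T (j, i) != 0 -> weqv (word j) (word i)).

Lemma tensor_pow_map (A B : algType R[i]) (F : {lrmorphism A -> B}) (u : 'M[A]_n) k
    (i j : multi_index n k) :
  mx_tensor_pow (\matrix_(a, b) F (u a b)) i j = F (mx_tensor_pow u i j).
Proof. by rewrite /mx_tensor_pow rmorph_prod; apply: eq_bigr => s _; rewrite mxE. Qed.

Lemma comb_tensor_pow_map (A B : algType R[i]) (F : {lrmorphism A -> B}) (u : 'M[A]_n) k
    (I : finType) (c : I -> R[i]) (i j : I -> multi_index n k) :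
  F (\sum_x c x *: mx_tensor_pow u (i x) (j x)) =
  \sum_x c x *: mx_tensor_pow (\matrix_(a, b) F (u a b)) (i x) (j x).
Proof.
by rewrite linear_sum; apply: eq_bigr => x _; rewrite linearZ tensor_pow_map.
Qed.

Lemma intertwiner_map (A B : cstarAlgType R) (F : {lrmorphism A -> B}) (u : 'M[A]_n) k l
    (T : tensor_map R n k l) :
  intertwiner u T -> intertwiner (\matrix_(a, b) F (u a b)) T.
Proof.
move=> uT j i; rewrite -(comb_tensor_pow_map F u _ id (fun=> i)).
by rewrite -(comb_tensor_pow_map F u _ (fun=> j) id) uT.
Qed.

Lemma intertwiner_map_inj (A B : cstarAlgType R) (F : {lrmorphism A -> B}) (u : 'M[A]_n) k l
    (T : tensor_map R n k l) : injective F ->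
  intertwiner (\matrix_(a, b) F (u a b)) T -> intertwiner u T.
Proof.
move=> F_inj uT j i; apply: F_inj; rewrite (comb_tensor_pow_map F u _ id (fun=> i)).
by rewrite (comb_tensor_pow_map F u _ (fun=> j) id) uT.
Qed.

Definition perm_char (p : {perm 'I_n}) : 'M[R[i]^o]_n := \matrix_(a, b) (a == p b)%:R.

Lemma perm_char_pow p k (i j : multi_index n k) :
  mx_tensor_pow (perm_char p) i j = (i == [ffun s => p (j s)])%:R.
Proof.
rewrite /mx_tensor_pow; have [->|neq] := eqVneq.
  by rewrite big1 // => s _; rewrite mxE ffunE eqxx.
have [s hs] : exists s, i s != p (j s).
  apply/existsP; apply: contra_neqT neq; rewrite negb_exists => /forallP h.
  by apply/ffunP => s; rewrite ffunE; apply/eqP; rewrite -[_ == _]negbK.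
by rewrite (bigD1 s) //= mxE (negPf hs) mul0r.
Qed.

Lemma perm_char_intertwiner p k l (T : tensor_map R n k l) :
  intertwiner (perm_char p) T <->
  forall (j : multi_index n l) (i : multi_index n k), T ([ffun s => p (j s)], [ffun s => p (i s)]) = T (j, i).
Proof.
have L (j : multi_index n l) i : \sum_(i' : multi_index n k) (T (j, i') : R[i]) *: mx_tensor_pow (perm_char p) i' i
    = T (j, [ffun s => p (i s)]).
  rewrite (bigD1 [ffun s => p (i s)]) //= perm_char_pow eqxx big1 ?addr0.
    by rewrite -[_ *: _]/(_ * _) mulr1.
  by move=> i' /negPf h; rewrite perm_char_pow h scaler0.
have Rr (j : multi_index n l) i : \sum_(j' : multi_index n l) (T (j', i) : R[i]) *:
    mx_tensor_pow (perm_char p) [ffun s => p (j s)] j' = T (j, i).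
  rewrite (bigD1 j) //= perm_char_pow eqxx big1 ?addr0.
    by rewrite -[_ *: _]/(_ * _) mulr1.
  move=> j' h; rewrite perm_char_pow (_ : _ == _ = false) ?scaler0 //.
  apply: contra_neqF h => /eqP/ffunP h; apply/ffunP => s.
  by have := h s; rewrite !ffunE => /perm_inj.
split=> [h j i|h j i]; first by have := h [ffun s => p (j s)] i; rewrite L Rr.
have -> : j = [ffun s => p ([ffun s => (p^-1)%g (j s)] s)].
  by apply/ffunP => s; rewrite !ffunE permKV.
by rewrite L Rr h.
Qed.

Definition gmx k i : 'M[R[i]]_((N k).+1) := \matrix_(x, y) (x == g k i y)%:R.

Definition wmx k (w : seq 'I_n) : 'M[R[i]]_((N k).+1) := \matrix_(x, y) (x == wact k w y)%:R.

Lemma wmx_cons k i w : wmx k (i :: w) = gmx k i *m wmx k w.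
Proof.
apply/matrixP => x y; rewrite !mxE (bigD1 (wact k w y)) //= !mxE eqxx mulr1.
by rewrite big1 ?addr0 // => z /negPf h; rewrite !mxE h mulr0.
Qed.

Lemma wmx_nil k : wmx k [::] = 1%:M.
Proof. by apply/matrixP => x y; rewrite !mxE. Qed.

Lemma wmx_inj k s t : wmx k s = wmx k t -> wact k s =1 wact k t.
Proof.
move=> /matrixP h x; have := h (wact k s x) x; rewrite !mxE eqxx.
by case: eqP => // _ /eqP; rewrite oner_eq0.
Qed.

Lemma gmx_star k i : mx_star (gmx k i) = gmx k i.
Proof.
apply/matrixP => x y; rewrite !mxE conjc_nat; congr _%:R.
by rewrite -[y == _](inj_eq (can_inj (gK i))) gK eq_sym.
Qed.

Arguments gmx : clear implicits.
Arguments wmx : clear implicits.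

(** One diagonal matrix for each map [f] of the letters: its intertwiners test exactly the instance
    of [weqv] at [k] and [f]. *)
Definition diag_rep k (f : 'I_n -> 'I_n) : 'M[mx_cstar R (N k)]_n :=
  \matrix_(a, b) if a == b then mx_embed (gmx k (f a)) else 0.

Lemma diag_rep_pow k f m (i j : multi_index n m) :
  mx_tensor_pow (diag_rep k f) i j =
  if i == j then mx_embed (wmx k (map f (word i))) else 0.
Proof.
rewrite /mx_tensor_pow; have [->|neq] := eqVneq.
  elim: m j {i} => [|m IH] j; first by rewrite big_ord0 word0 wmx_nil mx_embed1.
  rewrite big_ord_recl wordS /= wmx_cons mx_embedM !mxE eqxx.
  by rewrite -IH; congr (_ * _); apply: eq_bigr => s _; rewrite !ffunE.
have [s hs] : exists s, i s != j s.
  apply/existsP; apply: contra_neqT neq; rewrite negb_exists => /forallP h.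
  by apply/ffunP => s; apply/eqP; rewrite -[_ == _]negbK.
have h0 : diag_rep k f (i s) (j s) = 0 by rewrite mxE (negPf hs).
have : exists s, diag_rep k f (i s) (j s) = 0 by exists s.
elim: (index_enum 'I_m) (mem_index_enum s) => // r rs IH; rewrite inE big_cons.
case/orP => [/eqP <-|rs0] _; first by rewrite h0 mul0r.
by rewrite IH ?mulr0 //; exists s.
Qed.

Lemma diag_rep_intertwiner k f m l (T : tensor_map R n m l) :
  intertwiner (diag_rep k f) T <->
  forall (j : multi_index n l) (i : multi_index n m), T (j, i) != 0 -> wact k (map f (word j)) =1 wact k (map f (word i)).
Proof.
have L (j : multi_index n l) i : \sum_(i' : multi_index n m) (T (j, i') : R[i]) *: mx_tensor_pow (diag_rep k f) i' i
    = (T (j, i) : R[i]) *: mx_embed (wmx k (map f (word i))).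
  rewrite (bigD1 i) //= diag_rep_pow eqxx big1 ?addr0 // => i' /negPf h.
  by rewrite diag_rep_pow h scaler0.
have Rr (j : multi_index n l) i : \sum_(j' : multi_index n l) (T (j', i) : R[i]) *: mx_tensor_pow (diag_rep k f) j j'
    = (T (j, i) : R[i]) *: mx_embed (wmx k (map f (word j))).
  rewrite (bigD1 j) //= diag_rep_pow eqxx big1 ?addr0 // => j' /negPf h.
  by rewrite diag_rep_pow eq_sym h scaler0.
split=> [h j i T0|h j i]; last first.
  rewrite L Rr; have [->|/h e] := eqVneq (T (j, i)) 0; first by rewrite !scale0r.
  by congr (_ *: mx_embed _); apply/matrixP => x y; rewrite !mxE e.
have := h j i; rewrite L Rr => /(congr1 (fun x => (T (j, i) : R[i])^-1 *: x)).
by rewrite !scalerA mulVf // !scale1r => /mx_embed_inj/wmx_inj h' x; rewrite h'.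
Qed.

(** The two halves of [word_rel] are intertwining conditions at concrete admissible matrices. This
    is what forbids further intertwiners of the universal matrix. *)
Lemma word_relP k l (T : tensor_map R n k l) : word_rel T <->
  (forall p, intertwiner (perm_char p) T) /\ (forall k' f, intertwiner (diag_rep k' f) T).
Proof.
split=> [[Tp Tw]|[Tp Tw]].
  split=> [p|k' f]; first by apply/perm_char_intertwiner => j i; apply: Tp.
  by apply/diag_rep_intertwiner => j i /Tw h x; apply: h.
split=> [p|j i T0 k' f]; first by apply/perm_char_intertwiner.
by move/diag_rep_intertwiner: (Tw k' f) => /(_ j i T0).
Qed.

Lemma perm_char_admissible p : admissible word_rel (perm_char p).
Proof.
split=> [i j|k l T /word_relP[h _]]; last exact: h.
by rewrite mxE; apply: conjc_nat.
Qed.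

Lemma diag_rep_admissible k f : admissible word_rel (diag_rep k f).
Proof.
split=> [i j|m l T /word_relP[_ h]]; last exact: h.
rewrite mxE; case: eqP => _; last exact: star0.
by rewrite -mx_embed_star gmx_star.
Qed.

End WordRelations.

(** * Orthogonality of the generators and the bound on their norms *)

Section WordQuantumGroup.
Variables (R : realType) (n : nat) (K : Type) (N : K -> nat).
Variable g : forall k : K, 'I_n -> 'I_(N k).+1 -> 'I_(N k).+1.
Arguments g : clear implicits.
Hypothesis gK : forall k i, involutive (g k i).
Local Notation weqv := (weqv g).
Local Notation rel := (@word_rel n K N g R).

Definition pair_lower : tensor_map R n 0 2 :=
  [ffun ji : multi_index n 2 * multi_index n 0 => (ji.1 ord0 == ji.1 ord_max)%:R].
Definition pair_upper : tensor_map R n 2 0 :=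
  [ffun ji : multi_index n 0 * multi_index n 2 => (ji.2 ord0 == ji.2 ord_max)%:R].
(** The map of the one-block partition with one upper and three lower points. It is among the
    relations because the word aaa acts as a, and it yields [adm_cube]. *)
Definition fork : tensor_map R n 1 3 :=
  [ffun ji : multi_index n 3 * multi_index n 1 => [forall s, ji.1 s == ji.2 ord0]%:R].

Lemma word2 (i : multi_index n 2) : word i = [:: i ord0; i ord_max].
Proof.
rewrite wordS wordS word0 !ffunE; congr [:: _; i _]; exact/val_inj.
Qed.

Lemma pair_lower_rel : rel pair_lower.
Proof.
split=> [p j i|j i]; first by rewrite !ffunE /= ?ffunE (inj_eq perm_inj).
rewrite ffunE /= word2 word0; case: (j ord0 =P _) => [-> _|_]; last by rewrite eqxx.
exact: weqv_sqr.
Qed.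

Lemma pair_upper_rel : rel pair_upper.
Proof.
split=> [p j i|j i]; first by rewrite !ffunE /= ?ffunE (inj_eq perm_inj).
rewrite ffunE /= word2 word0; case: (i ord0 =P _) => [-> _|_]; last by rewrite eqxx.
exact/weqv_sym/weqv_sqr.
Qed.

Lemma fork_rel : rel fork.
Proof.
split=> [p j i|j i].
  rewrite !ffunE /=; congr _%:R; congr nat_of_bool; apply: eq_forallb => s.
  by rewrite !ffunE (inj_eq perm_inj).
rewrite ffunE /=; case: forallP => [h _|_]; last by rewrite eqxx.
rewrite !wordS !word0 !ffunE !(eqP (h _)).
by have := weqv_cat (weqv_sqr gK (i ord0)) (weqv_refl g [:: i ord0]).
Qed.

Variables (B : cstarAlgType R) (u : 'M[B]_n).
Hypothesis uadm : admissible (@word_rel n K N g R) u.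

Lemma sum_pairs (V : lmodType R[i]) (F : multi_index n 2 -> V) :
  \sum_(i : multi_index n 2) ((i ord0 == i ord_max)%:R : R[i]) *: F i = \sum_m F [ffun=> m].
Proof.
rewrite (bigID (fun i : multi_index n 2 => i ord0 == i ord_max)) /= [X in _ + X]big1 ?addr0.
  rewrite (reindex_onto (fun m : 'I_n => [ffun=> m] : multi_index n 2) (fun i => i ord0)) /=.
    apply: eq_big => [m|m _]; rewrite !ffunE !eqxx //.
    by rewrite scale1r.
  move=> i /eqP h; apply/ffunP => s; rewrite ffunE.
  have [->|] := eqVneq s ord0; first by [].
  by case: s => [[|[|]]] // hs _; rewrite h; congr (i _); apply: val_inj.
by move=> i /negPf ->; rewrite scale0r.
Qed.

Let two (a b : 'I_n) : multi_index n 2 := [ffun s => if s == ord0 then a else b].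

Lemma sum_index0 (V : nmodType) (a : 'I_n) (F : multi_index n 0 -> V) :
  \sum_i F i = F [ffun=> a].
Proof.
rewrite (bigD1 [ffun=> a]) //= big1 ?addr0 // => i /eqP h; case: h.
by apply/ffunP => -[].
Qed.

Lemma mx_tensor_pow2 (i j : multi_index n 2) :
  mx_tensor_pow u i j = u (i ord0) (j ord0) * u (i ord_max) (j ord_max).
Proof.
rewrite /mx_tensor_pow !big_ord_recl big_ord0 mulr1.
by congr (_ * u (i _) (j _)); apply: val_inj.
Qed.

Lemma adm_orth_row a b : \sum_m u a m * u b m = (a == b)%:R.
Proof.
have [_ /(_ _ _ _ pair_lower_rel (two a b) [ffun=> a])] := uadm.
rewrite (sum_index0 a) (eq_bigr (fun j' : multi_index n 2 =>
  ((j' ord0 == j' ord_max)%:R : R[i]) *: mx_tensor_pow u (two a b) j')); last first.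
  by move=> j' _; rewrite ffunE.
rewrite sum_pairs => h.
transitivity (\sum_m mx_tensor_pow u (two a b) [ffun=> m]).
  by apply: eq_bigr => m _; rewrite mx_tensor_pow2 !ffunE.
rewrite -h ffunE /= !ffunE /= /mx_tensor_pow big_ord0.
by case: eqP; rewrite ?scale1r ?scale0r.
Qed.

Lemma adm_orth_col a b : \sum_m u m a * u m b = (a == b)%:R.
Proof.
have [_ /(_ _ _ _ pair_upper_rel [ffun=> a] (two a b))] := uadm.
rewrite (sum_index0 a) (eq_bigr (fun j' : multi_index n 2 =>
  ((j' ord0 == j' ord_max)%:R : R[i]) *: mx_tensor_pow u j' (two a b))); last first.
  by move=> j' _; rewrite ffunE.
rewrite sum_pairs => h.
transitivity (\sum_m mx_tensor_pow u [ffun=> m] (two a b)).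
  by apply: eq_bigr => m _; rewrite mx_tensor_pow2 !ffunE.
rewrite h ffunE /= !ffunE /= /mx_tensor_pow big_ord0.
by case: eqP; rewrite ?scale1r ?scale0r.
Qed.

Lemma adm_cube a b : u a b * u a b * u a b = u a b.
Proof.
have [_ /(_ _ _ _ fork_rel [ffun=> a] [ffun=> b])] := uadm.
rewrite (bigD1 [ffun=> a]) //= big1 ?addr0; last first.
  move=> i /eqP h; rewrite ffunE /=; case: forallP => [/(_ ord0)|_]; last by rewrite scale0r.
  rewrite ffunE => /eqP e; case: h; apply/ffunP => s; rewrite ffunE e.
  by congr (i _); rewrite ord1.
rewrite [RHS](bigD1 [ffun=> b]) //= [X in _ + X]big1 ?addr0; last first.
  move=> j /eqP h; rewrite ffunE /=; case: forallP => [e|_]; last by rewrite scale0r.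
  by case: h; apply/ffunP => s; have /eqP := e s; rewrite !ffunE.
have T1 : fork ([ffun=> a], [ffun=> a]) = 1.
  by rewrite ffunE; case: forallP => // -[] s; rewrite !ffunE.
have T2 : fork ([ffun=> b], [ffun=> b]) = 1.
  by rewrite ffunE; case: forallP => // -[] s; rewrite !ffunE.
rewrite T1 T2 !scale1r /mx_tensor_pow !big_ord_recl !big_ord0 !ffunE !mulr1 => h.
by rewrite -mulrA -h.
Qed.

(** For the self-adjoint u_ab the number x = norm (u_ab)^2 satisfies x^2 = x, because u_ab^4 =
    u_ab^2. *)
Lemma adm_cnorm_le1 a b : cnorm (u a b) <= 1.
Proof.
have us : star (u a b) = u a b by case: uadm.
set x := cnorm (u a b * u a b).
have ux : cnorm (u a b) ^+ 2 = x by rewrite -cnorm_star us.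
have xx : x ^+ 2 = x.
  by rewrite /x -cnorm_star starM us mulrA adm_cube.
have x1 : x <= 1.
  rewrite leNgt; apply/negP => x1.
  have : 0 < x * (x - 1) by rewrite mulr_gt0 ?subr_gt0 // (lt_trans ltr01).
  by rewrite mulrBr mulr1 -expr2 xx subrr ltxx.
by rewrite -(@expr_le1 _ 2) ?cnorm_ge0 // ux.
Qed.

End WordQuantumGroup.

(** * Tensor products of admissible matrices *)

Section Comultiplication.
Variables (R : realType) (A B T : cstarAlgType R) (t : A -> B -> T).
Hypothesis tP : spatial_tensor t.

Lemma tens0l b : t 0 b = 0.
Proof.
have := tens_linearl tP 1 0 0 b; rewrite scaler0 addr0 scale1r => /eqP.
by rewrite -subr_eq0 opprD addNKr oppr_eq0 => /eqP.
Qed.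

Lemma tens0r a : t a 0 = 0.
Proof.
have := tens_linearr tP 1 a 0 0; rewrite scaler0 addr0 scale1r => /eqP.
by rewrite -subr_eq0 opprD addNKr oppr_eq0 => /eqP.
Qed.

Lemma tensDl a a' b : t (a + a') b = t a b + t a' b.
Proof. by have := tens_linearl tP 1 a a' b; rewrite !scale1r. Qed.

Lemma tensDr a b b' : t a (b + b') = t a b + t a b'.
Proof. by have := tens_linearr tP 1 a b b'; rewrite !scale1r. Qed.

Lemma tensZl c a b : t (c *: a) b = c *: t a b.
Proof. by have := tens_linearl tP c a 0 b; rewrite !addr0 tens0l addr0. Qed.

Lemma tensZr c a b : t a (c *: b) = c *: t a b.
Proof. by have := tens_linearr tP c a b 0; rewrite !addr0 tens0r addr0. Qed.

Lemma tens_suml (I : Type) (r : seq I) (F : I -> A) b :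
  t (\sum_(i <- r) F i) b = \sum_(i <- r) t (F i) b.
Proof. exact: (big_morph (fun a => t a b) (fun a a' => tensDl a a' b) (tens0l b)). Qed.

Lemma tens_sumr (I : Type) (r : seq I) (F : I -> B) a :
  t a (\sum_(i <- r) F i) = \sum_(i <- r) t a (F i).
Proof. exact: (big_morph (t a) (tensDr a) (tens0r a)). Qed.

Lemma tens_prod (I : Type) (r : seq I) (F : I -> A) (G : I -> B) :
  \prod_(i <- r) t (F i) (G i) = t (\prod_(i <- r) F i) (\prod_(i <- r) G i).
Proof.
elim: r => [|i r IH]; first by rewrite !big_nil (tens_one tP).
by rewrite !big_cons IH (tens_mul tP).
Qed.

Variables (n : nat) (u : 'M[A]_n) (v : 'M[B]_n).

Definition tens_mx : 'M[T]_n := \matrix_(i, j) \sum_k t (u i k) (v k j).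

Lemma tens_mx_pow k (i j : multi_index n k) :
  mx_tensor_pow tens_mx i j =
  \sum_(m : multi_index n k) t (mx_tensor_pow u i m) (mx_tensor_pow v m j).
Proof.
rewrite /mx_tensor_pow; under eq_bigr do rewrite mxE.
by rewrite bigA_distr_bigA; apply: eq_bigr => m _; rewrite tens_prod.
Qed.

(** [S] is pushed through the first leg by [uS] and through the second by [vS]; both computations
    reach the same double sum over the middle indices of lengths k and l. *)
Lemma tens_mx_intertwiner k l (S : tensor_map R n k l) :
  intertwiner u S -> intertwiner v S -> intertwiner tens_mx S.
Proof.
move=> uS vS j i.
transitivity (\sum_(m : multi_index n k) t (\sum_(i' : multi_index n k)
    (S (j, i') : R[i]) *: mx_tensor_pow u i' m) (mx_tensor_pow v m i)).
  under eq_bigr do rewrite tens_mx_pow scaler_sumr.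
  rewrite exchange_big; apply: eq_bigr => m _; rewrite tens_suml.
  by apply: eq_bigr => i' _; rewrite tensZl.
transitivity (\sum_(m : multi_index n l) t (mx_tensor_pow u j m)
    (\sum_(j' : multi_index n l) (S (j', i) : R[i]) *: mx_tensor_pow v m j')); last first.
  under [RHS]eq_bigr do rewrite tens_mx_pow scaler_sumr.
  rewrite [RHS]exchange_big; apply: eq_bigr => m _; rewrite tens_sumr.
  by apply: eq_bigr => j' _; rewrite tensZr.
under eq_bigr do rewrite (uS j) tens_suml.
under [RHS]eq_bigr do rewrite -(vS _ i) tens_sumr.
rewrite exchange_big; apply: eq_bigr => m _; apply: eq_bigr => m' _.
by rewrite tensZl tensZr.
Qed.

End Comultiplication.

(** * The quantum group of the word relations *)

Section WordCMQG.
Variables (R : realType) (n : nat) (K : Type) (N : K -> nat).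
Variable g : forall k : K, 'I_n -> 'I_(N k).+1 -> 'I_(N k).+1.
Arguments g : clear implicits.
Hypothesis gK : forall k i, involutive (g k i).
Hypothesis n_gt0 : (0 < n)%N.
Local Notation rel := (@word_rel n K N g R).

Lemma rel_admissible_exists : exists (B : cstarAlgType R) (u : 'M[B]_n), admissible rel u.
Proof. by exists R[i]^o, (perm_char R 1%g); apply: perm_char_admissible. Qed.

Definition word_alg : cstarAlgType R :=
  univ_alg (adm_cnorm_le1 gK) rel_admissible_exists.
Definition word_mx : 'M[word_alg]_n :=
  univ_mx (adm_cnorm_le1 gK) rel_admissible_exists.

Lemma word_mx_admissible : admissible rel word_mx.
Proof. exact: univ_admissible. Qed.

Lemma word_mx_extend (B : cstarAlgType R) (u : 'M[B]_n) : admissible rel u ->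
  exists F : {lrmorphism word_alg -> B},
    star_hom F /\ forall i j, F (word_mx i j) = u i j.
Proof.
move=> /(univ_property (adm_cnorm_le1 gK) rel_admissible_exists)[F [FS FE]].
by exists F; split=> // i j; rewrite mxE FE.
Qed.

(** The character given by the identity permutation is the counit. Acting on the line, it makes the
    spatial tensor square of the algebra available. *)
Lemma word_alg_rep : exists (H : hilbert R) (pi : word_alg -> H -> H),
  star_rep pi /\ exists x : H, x != 0.
Proof.
have [F [FS _]] := word_mx_extend (perm_char_admissible g R 1%g).
exact: character_star_rep FS.
Qed.

Lemma word_is_cmqg : is_cmqg word_mx.
Proof.
have [uS uT] := word_mx_admissible.
have row a b := adm_orth_row gK word_mx_admissible a b.
have col a b := adm_orth_col gK word_mx_admissible a b.
split.
- apply/matrixP => a b; rewrite !mxE -col; apply: eq_bigr => m _.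
  by rewrite [star_mx _ _ _]mxE uS.
- apply/matrixP => a b; rewrite !mxE -row; apply: eq_bigr => m _.
  by rewrite [star_mx _ _ _]mxE uS.
- exact: univ_dense.
- exists (spatial_prod word_alg_rep word_alg_rep), (tens word_alg_rep word_alg_rep).
  have tP := spatial_prodP word_alg_rep word_alg_rep; split=> //.
  (* The comultiplication exists by universality, since its prescribed values again form an
     admissible matrix. *)
  have [|F [FS FE]] := @word_mx_extend _ (tens_mx (tens word_alg_rep word_alg_rep) word_mx word_mx).
    split=> [i j|k l T rT]; last by apply: tens_mx_intertwiner => //; apply: uT.
    by rewrite mxE star_sum; apply: eq_bigr => m _; rewrite (tens_star tP) !uS.
  by exists F; split=> // i j; rewrite FE mxE.
(* The entries are self-adjoint, so unitarity says that [word_mx] itself inverts its transpose. *)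
- exists word_mx; split; apply/matrixP => a b.
  + by rewrite [RHS]mxE -row !mxE; apply: eq_bigr => m _; rewrite [_^T _ _]mxE.
  + by rewrite [RHS]mxE -col !mxE; apply: eq_bigr => m _; rewrite [_^T _ _]mxE.
Qed.

Definition word_cmqg : cmqg R := CMQG n_gt0 word_is_cmqg.

Lemma word_orthogonal : orthogonal_cmqg word_cmqg.
Proof. by case: word_mx_admissible. Qed.

Lemma word_maximal : maximal_cmqg word_cmqg.
Proof. exact: univ_enveloping. Qed.

(** A homomorphism sends an intertwiner of the universal matrix to one of every admissible matrix;
    the permutation and diagonal matrices among these recover [rel] by [word_relP]. *)
Lemma word_intertwinerP k l (T : tensor_map R n k l) :
  intertwiner word_mx T <-> rel T.
Proof.
split=> [uT|]; last by case: word_mx_admissible => _; apply.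
have tr (B : cstarAlgType R) (u : 'M[B]_n) : admissible rel u -> intertwiner u T.
  move=> /word_mx_extend[F [_ FE]].
  have -> : u = \matrix_(a, b) F (word_mx a b) by apply/matrixP => a b; rewrite mxE FE.
  exact: intertwiner_map.
apply/word_relP; split=> [p|k' f]; apply: tr; first exact: perm_char_admissible.
exact: diag_rep_admissible.
Qed.

End WordCMQG.

(** * Categories of partitions *)

Lemma same_block_sym (X : finType) (p : setpart X) a b : same_block p a b = same_block p b a.
Proof.
case: p => P PX; rewrite /same_block /=; have [/eqP cP tP _] := and3P PX.
have Pa c : c \in finset.cover P by rewrite cP inE.
by rewrite -!eq_pblock // eq_sym.
Qed.

Section Labellings.
Variables (X : finType) (D : eqType).
Implicit Types (p : setpart X) (L : X -> D).

Definition compat p L := forall a b, same_block p a b -> L a = L b.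

Lemma same_block_components (r : rel X) a b :
  same_block (components r) a b = connect (sym_closure r) a b.
Proof.
rewrite /same_block /=; apply: pblock_equivalence_partition; rewrite ?inE //.
have rC : connect_sym (sym_closure r).
  by apply: sym_connect_sym => x y; rewrite /sym_closure orbC.
move=> x y z _ _ _; split; first exact: connect0.
by move=> xy; exact: (same_connect rC xy).
Qed.

(** Labellings see only the generating graph and never its components. The operations on partitions,
    all defined by [components], thus become conditions on labellings. *)
Lemma compat_components (r : rel X) L :
  compat (components r) L <-> forall a b, r a b -> L a = L b.
Proof.
split=> [h a b rab|h a b].
  by apply: h; rewrite same_block_components connect1 // /sym_closure rab.
rewrite same_block_components => /connectP[s]; elim: s a => [a _ -> //|c s IH a] /=.
move=> /andP[/orP[ac|ca] cs] e; first by rewrite (h _ _ ac) (IH c).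
by rewrite -(h _ _ ca) (IH c).
Qed.


Lemma compat_overlay (Y Z : finType) (f : Y -> X) (h : Z -> X) (p : setpart Y) (q : setpart Z) L :
  (forall a b, overlay f h p q a b -> L a = L b) ->
  (forall a b, same_block p a b -> L (f a) = L (f b)) /\
  (forall a b, same_block q a b -> L (h a) = L (h b)).
Proof.
move=> H; split=> a b ab; apply: H; rewrite /overlay.
  by apply/orP; left; apply/existsP; exists a; apply/existsP; exists b; rewrite !eqxx.
by apply/orP; right; apply/existsP; exists a; apply/existsP; exists b; rewrite !eqxx.
Qed.

Lemma overlay_sym (Y Z : finType) (f : Y -> X) (h : Z -> X) (p : setpart Y) (q : setpart Z) :
  symmetric (overlay f h p q).
Proof.
move=> a b; congr (_ || _); apply/existsP/existsP =>
  -[x /existsP[y /and3P[fx fy xy]]]; exists y; apply/existsP; exists x;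
  by rewrite fx fy same_block_sym.
Qed.

End Labellings.

Lemma compat_pull (X Y : finType) (D : eqType) (f : X -> Y) (h : Y -> X) (p : setpart Y)
    (L : X -> D) :
  cancel h f -> compat (part_pull f p) L -> compat p (fun y => L (h y)).
Proof. by move=> hf /compat_components H a b ab; apply: H; rewrite !hf. Qed.

Section WordCategory.
Variables (n : nat) (K : Type) (N : K -> nat).
Variable g : forall k : K, 'I_n -> 'I_(N k).+1 -> 'I_(N k).+1.
Arguments g : clear implicits.
Hypothesis gK : forall k i, involutive (g k i).
Hypothesis n_gt0 : (0 < n)%N.
Local Notation weqv := (weqv g).

Definition upper k l (L : ('I_k + 'I_l)%type -> 'I_n) : multi_index n k := [ffun s => L (inl s)].
Definition lower k l (L : ('I_k + 'I_l)%type -> 'I_n) : multi_index n l := [ffun s => L (inr s)].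

(** The support condition of [word_rel] for T_p. The labellings may give several blocks the same
    label, which matches the stability of [weqv] under maps of the letters. *)
Definition good_part k l (p : Defs.partn k l) :=
  forall L : ('I_k + 'I_l)%type -> 'I_n, compat p L -> weqv (word (upper L)) (word (lower L)).

Definition word_cat k l : {set Defs.partn k l} := [set p | `[< good_part p >]].

Lemma word_catP k l (p : Defs.partn k l) : p \in word_cat k l <-> good_part p.
Proof. by rewrite inE; split=> /asboolP. Qed.

Definition cons_end (left : bool) (a : 'I_n) w := if left then a :: w else rcons w a.

Lemma word_end left k (i : multi_index n k.+1) :
  word i = cons_end left (i (end_pt left k)) (word [ffun s => i (lift (end_pt left k) s)]).
Proof.
case: left => /=; first exact: wordS.
rewrite /word enum_ordSr map_rcons -map_comp; congr rcons; apply: eq_map => s.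
by rewrite /= ffunE; congr (i _); apply: val_inj; rewrite /= /bump leqNgt ltn_ord.
Qed.

(** Letters act as involutions, so a letter can cross the equivalence while staying at its end of
    the word. This is rotation of partitions in terms of words. *)
Lemma weqv_end left a s t : weqv (cons_end left a s) t -> weqv s (cons_end left a t).
Proof.
have e (r : seq 'I_n) : weqv r (cons_end left a (cons_end left a r)).
  apply: weqv_sym; case: left => /=.
    exact: (weqv_cat (weqv_sqr gK a) (weqv_refl g r)).
  have := weqv_cat (weqv_refl g r) (weqv_sqr gK a).
  by rewrite cats0 -!cats1 -catA.
move=> h; apply: weqv_trans (e s) _; case: left h {e} => /= h.
  exact: (weqv_cat (weqv_refl g [:: a]) h).
by rewrite -(cats1 (rcons s a)) -(cats1 t); apply: weqv_cat h _.
Qed.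

Lemma enum_ordD a b :
  enum 'I_(a + b) = [seq lshift b s | s <- enum 'I_a] ++ [seq rshift a s | s <- enum 'I_b].
Proof.
apply: (inj_map (@ord_inj (a + b))).
rewrite -[LHS]/(map val _) val_enum_ord iotaD map_cat; congr cat.
  by rewrite -(map_comp _ (lshift b)) -val_enum_ord; apply: eq_map.
rewrite -(map_comp _ (@rshift a b)) addnC iotaDl -val_enum_ord -(map_comp (addn a)).
exact: eq_map.
Qed.

Lemma wordD a b (i : multi_index n (a + b)) :
  word i = word [ffun s => i (lshift b s)] ++ word [ffun s => i (rshift a s)].
Proof.
rewrite /word enum_ordD map_cat -!map_comp.
by congr cat; apply: eq_map => s; rewrite /= ffunE.
Qed.

Lemma eq_word a (i j : multi_index n a) : i =1 j -> word i = word j.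
Proof. by move=> /ffunP ->. Qed.

Lemma good_part_tensor k l k' l' (p : Defs.partn k l) (q : Defs.partn k' l') :
  good_part p -> good_part q -> good_part (part_tensor p q).
Proof.
move=> gp gq L /compat_components/compat_overlay[/gp hp /gq hq].
rewrite (wordD (upper L)) (wordD (lower L)).
have := weqv_cat hp hq; congr weqv; congr cat;
  by apply: eq_word => s; rewrite !ffunE.
Qed.

Lemma good_part_comp k l m (q : Defs.partn l m) (p : Defs.partn k l) :
  good_part p -> good_part q -> good_part (part_comp q p).
Proof.
move=> gp gq L LP0.
pose joined : rel ('I_k + ('I_l + 'I_m))%type :=
  overlay (fun x : ('I_k + 'I_l)%type => match x with inl i => inl i | inr j => inr (inl j) end)
    (fun x : ('I_l + 'I_m)%type => inr x) p q.
pose outer (x : ('I_k + 'I_m)%type) : ('I_k + ('I_l + 'I_m))%type :=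
  match x with inl i => inl i | inr j => inr (inr j) end.
have LP a b : connect joined (outer a) (outer b) -> L a = L b.
  by move/compat_components: LP0; apply.
(* The labelling is extended to the middle points along connected components. Components without
   outer points, which composition deletes, get an arbitrary label; here [n_gt0] provides one. The
   middle word then links the two equivalences. *)
pose L' z := if [pick x | connect joined z (outer x)] is Some x then L x
  else Ordinal n_gt0.
have jC : connect_sym joined by apply: sym_connect_sym; apply: overlay_sym.
have L'E a b : joined a b -> L' a = L' b.
  move=> /connect1 ab; rewrite /L'; rewrite (@eq_pick _ _ [pred x | connect joined b (outer x)]) //.
  by move=> x /=; apply: (same_connect jC ab).
have L'o x : L' (outer x) = L x.
  rewrite /L'; case: pickP => [y xy|/(_ x)]; last by rewrite connect0.
  by rewrite (LP _ _ xy).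
have [/gp hp /gq hq] := compat_overlay L'E.
have eu : word (upper L) =
    word (upper (fun x : ('I_k + 'I_l)%type => L' (match x with inl i => inl i | inr j => inr (inl j) end))).
  by apply: eq_word => s; rewrite !ffunE -L'o.
have el : word (lower L) = word (lower (fun x : ('I_l + 'I_m)%type => L' (inr x))).
  by apply: eq_word => s; rewrite !ffunE -L'o.
rewrite eu el; exact: weqv_trans hp hq.
Qed.

Lemma good_part_inv k l (p : Defs.partn k l) : good_part p -> good_part (part_inv p).
Proof.
move=> gp L; pose h (x : ('I_k + 'I_l)%type) : ('I_l + 'I_k)%type :=
  match x with inl i => inr i | inr j => inl j end.
move=> cL; have H : compat p (fun x => L (h x)) by apply: compat_pull cL; case.
move: {H}(gp _ H) => H; apply: weqv_sym; move: H; congr weqv; by apply: eq_word => s; rewrite !ffunE.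
Qed.

Lemma good_part_rot_down left k l (p : Defs.partn k.+1 l) :
  good_part p -> good_part (part_rot_down left p).
Proof.
move=> gp L; pose h (x : ('I_k.+1 + 'I_l)%type) : ('I_k + 'I_l.+1)%type :=
  match x with
  | inl i => match unlift (end_pt left k) i with
             | Some i' => inl i' | None => inr (end_pt left l) end
  | inr j => inr (lift (end_pt left l) j)
  end.
move=> cL; have H : compat p (fun x => L (h x)).
  apply: compat_pull cL => -[i|j] /=; last by rewrite liftK.
  by case: unliftP => [i' ->|->] //; rewrite unlift_none.
move: {H}(gp _ H); rewrite (word_end left (upper _)) (word_end left (lower L)) !ffunE /= unlift_none.
move=> /weqv_end; congr weqv; [|congr cons_end];
  by apply: eq_word => s; rewrite !ffunE /= ?liftK.
Qed.

Lemma good_part_rot_up left k l (p : Defs.partn k l.+1) :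
  good_part p -> good_part (part_rot_up left p).
Proof.
move=> gp L; pose h (x : ('I_k + 'I_l.+1)%type) : ('I_k.+1 + 'I_l)%type :=
  match x with
  | inl i => inl (lift (end_pt left k) i)
  | inr j => match unlift (end_pt left l) j with
             | Some j' => inr j' | None => inl (end_pt left k) end
  end.
move=> cL; have H : compat p (fun x => L (h x)).
  apply: compat_pull cL => -[i|j] /=; first by rewrite liftK.
  by case: unliftP => [i' ->|->] //; rewrite unlift_none.
move: {H}(gp _ H); rewrite (word_end left (upper L)) (word_end left (lower _)) !ffunE /= unlift_none.
move=> /weqv_sym/weqv_end H; apply: weqv_sym; move: H; congr weqv; [|congr cons_end];
  by apply: eq_word => s; rewrite !ffunE /= ?liftK.
Qed.

Lemma good_part_pair : good_part pair_part.
Proof.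
move=> L /compat_components h; rewrite word0 word2 !ffunE.
by rewrite (h (inr ord0) (inr ord_max)) //; apply/weqv_sym/weqv_sqr.
Qed.

Lemma word_cat_category : category_of_partitions word_cat.
Proof.
split=> [k l k' l' p q|k l m p q|k l p|left k l p|left k l p|]; rewrite ?word_catP.
- exact: good_part_tensor.
- exact: good_part_comp.
- exact: good_part_inv.
- exact: good_part_rot_down.
- exact: good_part_rot_up.
- exact: good_part_pair.
Qed.

End WordCategory.

(** * Easiness *)

(** Appending to each list the elements of [T] that it misses gives two enumerations of [T];
    matching them position by position is the permutation. *)
Lemma perm_of_uniq (T : finType) (s t : seq T) :
  uniq s -> uniq t -> size s = size t -> exists p : {perm T}, map p s = t.
Proof.
move=> us ut st.
pose ext (r : seq T) := r ++ [seq x <- enum T | x \notin r].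
have ext_perm r : uniq r -> perm_eq (ext r) (enum T).
  move=> ur; apply: uniq_perm; rewrite ?enum_uniq //.
    rewrite cat_uniq ur filter_uniq ?enum_uniq // andbT /=.
    by apply/hasPn => x; rewrite mem_filter => /andP[].
  by move=> x; rewrite mem_cat mem_filter !mem_enum andbT orbN.
have ext_in r x : uniq r -> x \in ext r by move=> /ext_perm/perm_mem ->; rewrite mem_enum.
have us' : uniq (ext s) by rewrite (perm_uniq (ext_perm s us)) enum_uniq.
have ut' : uniq (ext t) by rewrite (perm_uniq (ext_perm t ut)) enum_uniq.
have sz : size (ext s) = size (ext t).
  by rewrite (perm_size (ext_perm s us)) (perm_size (ext_perm t ut)).
pose f x := nth x (ext t) (index x (ext s)).
have fE x0 x : f x = nth x0 (ext t) (index x (ext s)).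
  by rewrite /f; apply: set_nth_default; rewrite -sz index_mem ext_in.
have f_inj : injective f.
  move=> x y; rewrite (fE x) (fE x y) => /eqP.
  rewrite nth_uniq -?sz ?index_mem ?ext_in // => /eqP h.
  by rewrite -(nth_index x (ext_in s x us)) h nth_index // ext_in.
exists (perm f_inj); case E: s => [|x0 s'].
  by rewrite E in st; rewrite (size0nil (esym st)).
rewrite -E; apply: (@eq_from_nth _ x0) => [|i]; rewrite size_map // => lt.
by rewrite (nth_map x0) // permE (fE x0) index_cat mem_nth // index_uniq // nth_cat -st lt.
Qed.

Section Easiness.
Variables (R : realType) (n : nat) (K : Type) (N : K -> nat).
Variable g : forall k : K, 'I_n -> 'I_(N k).+1 -> 'I_(N k).+1.
Arguments g : clear implicits.
Hypothesis gK : forall k i, involutive (g k i).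
Hypothesis n_gt0 : (0 < n)%N.
Local Notation rel := (@word_rel n K N g R).
Local Notation weqv := (weqv g).

Section Fixed.
Variables k l : nat.
Local Notation X := ('I_k + 'I_l)%type.
Local Notation index := (multi_index n l * multi_index n k)%type.
Implicit Types (T : tensor_map R n k l) (y : index) (p : Defs.partn k l).

Definition label y (x : X) : 'I_n :=
  match x with inl s => y.2 s | inr t => y.1 t end.

Lemma label_lower y : lower (label y) = y.1.
Proof. by apply/ffunP => s; rewrite ffunE. Qed.

Lemma label_upper y : upper (label y) = y.2.
Proof. by apply/ffunP => s; rewrite ffunE. Qed.

Lemma labelP y y' : label y =1 label y' -> y = y'.
Proof.
case: y y' => [j i] [j' i'] h; congr pair; apply/ffunP => s.
  exact: (h (inr s)).
exact: (h (inl s)).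
Qed.

Lemma part_deltaP p y : reflect (compat p (label y)) (part_delta p y.2 y.1).
Proof.
have PX := valP p; have [/eqP cP tP _] := and3P PX.
have Pa c : c \in finset.cover (val p) by rewrite cP inE.
apply: (iffP idP) => [/forallP h a b ab|h].
  have /implyP/(_ (pblock_mem (Pa a)))/forallP/(_ a)/implyP := h (finset.pblock (val p) a).
  by rewrite mem_pblock Pa => /(_ isT)/forallP/(_ b)/implyP/(_ ab)/eqP.
apply/forallP => B; apply/implyP => BP; apply/forallP => a; apply/implyP => aB.
apply/forallP => b; apply/implyP => bB; apply/eqP; apply: h.
by rewrite /same_block (def_pblock tP BP aB).
Qed.

Lemma part_mapE p y : part_map R n p y = (part_delta p y.2 y.1)%:R.
Proof. by rewrite ffunE. Qed.

Lemma rel0 : rel (0 : tensor_map R n k l).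
Proof. by split=> [p j i|j i]; rewrite !ffunE ?eqxx. Qed.

Lemma relD T T' : rel T -> rel T' -> rel (T + T').
Proof.
move=> [Tp Tw] [Tp' Tw']; split=> [p j i|j i]; first by rewrite !ffunE Tp Tp'.
rewrite ffunE; have [T0|/Tw h _] := eqVneq (T (j, i)) 0; last exact: h.
by rewrite T0 add0r; apply: Tw'.
Qed.

Lemma relZ (c : R[i]) T : rel T -> rel (c *: T).
Proof.
move=> [Tp Tw]; split=> [p j i|j i]; first by rewrite !ffunE Tp.
rewrite ffunE; have [T0|/Tw h _] := eqVneq (T (j, i)) 0; last exact: h.
by rewrite T0 scaler0 eqxx.
Qed.

Lemma rel_sum (I : Type) (r : seq I) (P : pred I) (F : I -> tensor_map R n k l) :
  (forall i, P i -> rel (F i)) -> rel (\sum_(i <- r | P i) F i).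
Proof. by move=> h; elim/big_ind: _ => //; [apply: rel0|apply: relD]. Qed.

Lemma part_map_rel p : good_part g p -> rel (part_map R n p).
Proof.
move=> gp; split=> [q j i|j i].
  rewrite !part_mapE; congr _%:R; congr nat_of_bool.
  apply/(part_deltaP p (_, _))/(part_deltaP p (_, _)) => h a b /h; last first.
    by case: a => s; case: b => t /= e; rewrite !ffunE e.
  by case: a => s; case: b => t /=; rewrite !ffunE => /perm_inj.
rewrite part_mapE; case: part_deltaP => [/gp|_]; last by rewrite eqxx.
by rewrite label_upper label_lower => /weqv_sym.
Qed.

Definition kernel y : Defs.partn k l := components (fun a b => label y a == label y b).

Lemma kernel_same y a b : same_block (kernel y) a b = (label y a == label y b).
Proof.
rewrite same_block_components; apply/idP/idP => [/connectP[s]|ab].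
  elim: s a => [a _ -> //|c s IH a] /= /andP[ac cs] e.
  by move: ac; rewrite /sym_closure [X in _ || X]eq_sym orbb => /eqP ->; apply: IH.
by rewrite connect1 // /sym_closure ab.
Qed.

Lemma kernel_good y : weqv (word y.1) (word y.2) -> good_part g (kernel y).
Proof.
move=> yw L cL.
pose f v := if [pick a | label y a == v] is Some a then L a else v.
have LE a : L a = f (label y a).
  rewrite /f; case: pickP => [b /eqP ba|/(_ a)]; last by rewrite eqxx.
  by apply: cL; rewrite kernel_same ba.
have -> : word (upper L) = map f (word y.2).
  by rewrite -word_map; apply: eq_word => s; rewrite !ffunE LE.
have -> : word (lower L) = map f (word y.1).
  by rewrite -word_map; apply: eq_word => s; rewrite !ffunE LE.
exact/weqv_map/weqv_sym.
Qed.

Definition nlabels y := size (undup (codom (label y))).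

(** The induced map from the labels of [y'] onto those of [y] must be injective by the count, hence
    extends to a permutation. In particular, labellings with the same kernel form one orbit. *)
Lemma coarser_perm y y' : compat (kernel y') (label y) -> (nlabels y' <= nlabels y)%N ->
  exists q : {perm 'I_n}, label y =1 (fun a => q (label y' a)).
Proof.
move=> cy le.
pose f v := if [pick a | label y' a == v] is Some a then label y a else v.
have fE a : label y a = f (label y' a).
  rewrite /f; case: pickP => [b /eqP ba|/(_ a)]; last by rewrite eqxx.
  by apply: cy; rewrite kernel_same ba.
pose s := undup (codom (label y')).
have sub : {subset undup (codom (label y)) <= map f s}.
  move=> v; rewrite mem_undup => /codomP[a ->]; rewrite fE; apply: map_f.
  by rewrite mem_undup codom_f.
have [|q hq] := @perm_of_uniq _ s (map f s) (undup_uniq _) _ (esym (size_map _ _)).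
  by apply: leq_size_uniq sub _; rewrite ?undup_uniq // size_map.
exists q => a; rewrite fE; move/eq_in_map: hq => /(_ (label y' a)) -> //.
by rewrite mem_undup codom_f.
Qed.

Lemma rel_label_perm T y y' (q : {perm 'I_n}) : rel T ->
  label y =1 (fun a => q (label y' a)) -> T y = T y'.
Proof.
move=> [Tp _] h; rewrite [y'](_ : _ = (y'.1, y'.2)); last by case: (y').
rewrite -(Tp q); congr (T _); apply: labelP => -[] s; rewrite h /= ffunE //.
Qed.

Lemma kernel_perm y y' (q : {perm 'I_n}) :
  label y =1 (fun a => q (label y' a)) -> kernel y = kernel y'.
Proof.
move=> h; rewrite /kernel (_ : (fun a b => _) = (fun a b => label y' a == label y' b)) //.
by apply/funext => a; apply/funext => b; rewrite !h (inj_eq perm_inj).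
Qed.

Definition span_cat := <<[seq part_map R n p | p in word_cat g k l]>>%VS.

(** Induction on the number of labels in the support. [S] is chosen to agree with [T] on labellings
    with m or more labels, so that [T - S] falls under the induction hypothesis. *)
Lemma rel_span_bounded m T : rel T ->
  (forall y, T y != 0 -> (nlabels y < m)%N) -> T \in span_cat.
Proof.
elim: m T => [|m IH] T rT Tm.
  suff -> : T = 0 by apply: mem0v.
  by apply/ffunP => y; rewrite ffunE; apply/eqP; apply: contraT => /Tm.
(* The value of [T] on a generic labelling of [p], provided that such a labelling uses exactly m
   labels. *)
pose c p : R[i] := if [pick y | (kernel y == p) && (nlabels y == m)] is Some y then T y else 0.
pose S := \sum_(p in word_cat g k l) c p *: part_map R n p.
have SC : S \in span_cat.
  apply: memv_suml => p pC; apply: memvZ; apply: memv_span; apply: map_f.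
  by rewrite mem_enum.
have rS : rel S by apply: rel_sum => p /word_catP gp; apply/relZ/part_map_rel.
suff h : T - S \in span_cat by rewrite -[T](subrK S) memvD.
apply: IH => [|y]; first by rewrite -scaleN1r; apply/relD/relZ.
apply: contra_neqT; rewrite -leqNgt => my.
rewrite !ffunE sum_ffunE; apply/eqP; rewrite subr_eq0; apply/eqP.
have self : compat (kernel y) (label y) by move=> a b; rewrite kernel_same => /eqP.
(* If [y] is compatible with [p], the kernel of some [y'] with m labels, then [y] has at least as
   many labels as [y'], and [coarser_perm] forces [p] to be the kernel of [y]. *)
have only p : p != kernel y -> (c p *: part_map R n p : tensor_map R n k l) y = 0.
  rewrite ffunE part_mapE; case: part_deltaP => [cy|_]; last by rewrite scaler0.
  rewrite /c; case: pickP => [y' /andP[/eqP ky' /eqP ny']|_]; last by rewrite scale0r.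
  have [||q /kernel_perm e] := @coarser_perm y y'; rewrite ?ky' ?ny' //.
  by rewrite e ky' eqxx.
(* The choice made in [c] is harmless by invariance of [T]. If there was nothing to choose, [y] has
   more than m labels and both sides vanish. *)
have ck : T y = c (kernel y).
  rewrite /c; case: pickP => [y' /andP[/eqP ky' /eqP ny']|/(_ y)].
    by have [||q /(rel_label_perm rT)] := @coarser_perm y y'; rewrite ?ky' ?ny' //.
  rewrite eqxx /= => /negbT ny; apply/eqP; apply: contraNT ny => /Tm.
  by rewrite ltnS eqn_leq my andbT.
have [kC|kC] := boolP (kernel y \in word_cat g k l).
  rewrite (bigD1 (kernel y)) //= big1 ?addr0; last by move=> p /andP[_]; apply: only.
  rewrite ffunE part_mapE; case: part_deltaP => // _.
  by rewrite -[_ *: _]/(_ * _) mulr1.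
rewrite big1; last by move=> p pC; apply: only; apply: contraNneq kC => <-.
(* Outside the category [T y] vanishes: a nonzero value would make the two words of [y] equivalent,
   and the kernel good. *)
apply/eqP; apply: contraNT kC => Ty0; apply/word_catP/kernel_good.
by case: rT => _; apply; case: (y) Ty0.
Qed.

Lemma rel_spanP T : rel T <-> T \in span_cat.
Proof.
split=> [rT|].
  apply: (@rel_span_bounded #|{: X}|.+1 T rT) => y _.
  by rewrite ltnS; apply: leq_trans (size_undup _) _; rewrite size_codom.
move/coord_span => ->; apply: rel_sum => i _; apply: relZ.
have /mapP[p] : [seq part_map R n p | p in word_cat g k l]`_i \in
    [seq part_map R n p | p in word_cat g k l].
  by apply: mem_nth; rewrite size_map -cardE.
by rewrite mem_enum => /word_catP gp ->; apply: part_map_rel.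
Qed.

End Fixed.

Lemma word_is_easy : is_easy (word_cmqg R gK n_gt0).
Proof.
exists (word_cat g); split; first exact: word_cat_category.
by move=> k l T; rewrite word_intertwinerP rel_spanP.
Qed.

Definition word_easy : easy_quantum_group R :=
  EasyQuantumGroup (@word_orthogonal R n K N g gK n_gt0) (@word_maximal R n K N g gK n_gt0)
    word_is_easy.

End Easiness.

(** * Commutator words *)

Section CommutatorWords.
Variable A : Type.
Implicit Types x y z : A.

Definition rot_word x y k : seq A := flatten (nseq k [:: x; y]).

(** Since z is an involution and [rot_word y x k] inverts t = (x y)^k, the word z t z t^-1 z t z
    t^-1 is the commutator of z and t z t^-1. *)
Definition comm_word x y z k : seq A :=
  z :: rot_word x y k ++ z :: rot_word y x k ++ z :: rot_word x y k ++ z :: rot_word y x k.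

Definition comm_word_inv x y z k : seq A :=
  rot_word x y k ++ z :: rot_word y x k ++ z :: rot_word x y k ++ z :: rot_word y x k ++ [:: z].

(* With [t = (x y)^k] and [q = [z, t z t^-1]], this is the commutator of [q]
   and [t q t^-1]. *)
Definition test_word x y z k : seq A :=
  comm_word x y z k ++ (rot_word x y k ++ comm_word x y z k ++ rot_word y x k) ++
  comm_word_inv x y z k ++ (rot_word x y k ++ comm_word_inv x y z k ++ rot_word y x k).

End CommutatorWords.

Lemma map_rot_word (A B : Type) (f : A -> B) x y k :
  map f (rot_word x y k) = rot_word (f x) (f y) k.
Proof. by rewrite /rot_word map_flatten map_nseq. Qed.

Lemma map_test_word (A B : Type) (f : A -> B) x y z k :
  map f (test_word x y z k) = test_word (f x) (f y) (f z) k.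
Proof.
by rewrite /test_word /comm_word /comm_word_inv; rewrite !(map_cat, map_cons, map_rot_word).
Qed.

Section CommutatorAction.
Variables (A X : Type) (a : A -> X -> X).
Hypothesis aK : forall i, involutive (a i).
Variables (x y z : A) (k : nat).

Local Notation run w v := (foldr a v w).

Lemma run_rot x' y' j v : run (rot_word x' y' j) v = iter j (a x' \o a y') v.
Proof. by rewrite /rot_word; elim: j => //= j ->. Qed.

Lemma run_rotK x' y' j v : run (rot_word x' y' j) (run (rot_word y' x' j) v) = v.
Proof.
by rewrite !run_rot; elim: j v => // j IH v; rewrite iterSr /= !aK IH.
Qed.

Let t v := run (rot_word x y k) v.
Let t' v := run (rot_word y x k) v.
Let q v := run (comm_word x y z k) v.
Let q' v := run (comm_word_inv x y z k) v.

Let tK v : t (t' v) = v. Proof. exact: run_rotK. Qed.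
Let t'K v : t' (t v) = v. Proof. exact: run_rotK. Qed.

Lemma run_comm v : q v = a z (t (a z (t' (a z (t (a z (t' v))))))).
Proof. by rewrite /q /comm_word /= foldr_cat /= foldr_cat /= foldr_cat. Qed.

Lemma run_comm_inv v : q' v = t (a z (t' (a z (t (a z (t' (a z v))))))).
Proof. by rewrite /q' /comm_word_inv foldr_cat /= foldr_cat /= foldr_cat /= foldr_cat. Qed.

Lemma run_commK v : q' (q v) = v.
Proof. by rewrite run_comm run_comm_inv !(aK, tK, t'K). Qed.

Lemma run_test v : run (test_word x y z k) v = q (t (q (t' (q' (t (q' (t' v))))))).
Proof.
rewrite /test_word /q /q' /t /t'.
move: (comm_word _ _ _ _) (comm_word_inv _ _ _ _) (rot_word x y k) (rot_word y x k).
by move=> c c' r r'; rewrite !foldr_cat.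
Qed.

Lemma run_test_comm_id v : (forall v, q v = v) -> run (test_word x y z k) v = v.
Proof.
move=> qid; have q'id u : q' u = u by rewrite -{1}(qid u) run_commK.
by rewrite run_test !(q'id, qid, tK).
Qed.

Lemma run_test_rot_id v : (forall v, t v = v) -> run (test_word x y z k) v = v.
Proof.
move=> tid; have t'id u : t' u = u by rewrite -{1}(tid u) t'K.
by apply: run_test_comm_id => u; rewrite run_comm !(t'id, tid, aK).
Qed.

(** If z t z = t^-1, then q = t^-4 commutes with t, so q and t q t^-1 coincide. *)
Lemma run_test_inverted v : (forall v, a z (t (a z v)) = t' v) ->
  run (test_word x y z k) v = v.
Proof.
move=> inv; have q4 u : q u = t' (t' (t' (t' u))) by rewrite run_comm !inv.
have q4' u : q' u = t (t (t (t u))).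
  have -> : u = q (t (t (t (t u)))) by rewrite q4 !t'K.
  by rewrite run_commK q4 !t'K.
by rewrite run_test !(q4, q4', tK, t'K).
Qed.

End CommutatorAction.

Section InvertedRotations.
Variables (A X : Type) (a : A -> X -> X).
Hypothesis aK : forall i, involutive (a i).

Lemma run_rot_conjl x y k v :
  a x (foldr a (a x v) (rot_word x y k)) = foldr a v (rot_word y x k).
Proof.
rewrite !run_rot; elim: k v => [|k IH] v /=; first by rewrite aK.
by rewrite aK; congr (a y _); rewrite -IH aK.
Qed.

Lemma run_rot_conjr x y k v :
  a y (foldr a (a y v) (rot_word x y k)) = foldr a v (rot_word y x k).
Proof.
rewrite !run_rot; elim: k v => [|k IH] v /=; first by rewrite aK.
by rewrite IH.
Qed.

(** Disposes of all non-injective maps of the letters, in any action by involutions: either t is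
    trivial or z inverts it. *)
Lemma run_test_collapsed x y z k v : [\/ x = y, z = x | z = y] ->
  foldr a v (test_word x y z k) = v.
Proof.
case=> [->|->|->].
- apply: run_test_rot_id => // u; rewrite run_rot.
  by elim: k => //= k ->; rewrite aK.
- by apply: run_test_inverted => // u; apply: run_rot_conjl.
- by apply: run_test_inverted => // u; apply: run_rot_conjr.
Qed.

End InvertedRotations.

(** * Two reflections of a cyclic group and a transposition *)

Section ReflectionAction.
Variables (V : zmodType) (d : V).

Definition swap_pt (v : V) := if v == 0 then d else if v == d then 0 else v.

Lemma swap_ptK : involutive swap_pt.
Proof.
move=> v; rewrite /swap_pt; have [->|v0] := eqVneq v 0.
  by rewrite eqxx; case: eqP.
have [->|vd] := eqVneq v d; first by rewrite eqxx.
by rewrite (negPf v0) (negPf vd).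
Qed.

Lemma swap_pt_fix v : v != 0 -> v != d -> swap_pt v = v.
Proof. by rewrite /swap_pt => /negPf -> /negPf ->. Qed.

(* A transposition and a fixed-point-free reflection generate a dihedral group
   of order 8: the nontrivial orbit of the product is a 4-cycle. *)
Lemma swap_reflection4 (e v : V) : e != 0 -> e != d -> e != d + d ->
  iter 4 (swap_pt \o (fun w => e - w)) v = v.
Proof.
move=> e0 ed edd; set h := _ \o _.
have h0 : h 0 = e by rewrite /h /= subr0 swap_pt_fix.
have h1 : h e = d by rewrite /h /= subrr /swap_pt eqxx.
have h2 : h d = e - d.
  by rewrite /h /= swap_pt_fix ?subr_eq0 // subr_eq.
have h3 : h (e - d) = 0.
  rewrite /h /= opprB addrC subrK /swap_pt eqxx.
  by case: eqP.
have [->|v0] := eqVneq v 0; first by rewrite /= h0 h1 h2 h3.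
have [->|ve] := eqVneq v e; first by rewrite /= h1 h2 h3 h0.
have [->|vd] := eqVneq v d; first by rewrite /= h2 h3 h0 h1.
have [->|ved] := eqVneq v (e - d); first by rewrite /= h3 h0 h1 h2.
(* Off the cycle 0, e, d, e - d the swap does not move e - v, so two steps already return to v. *)
have hv w : e - w != 0 -> e - w != d -> h w = e - w by move=> *; rewrite /h /= swap_pt_fix.
have h_v : h v = e - v.
  by apply: hv; [rewrite subr_eq0 eq_sym|rewrite subr_eq addrC -subr_eq eq_sym].
have h_ev : h (e - v) = v by rewrite hv !subKr.
by rewrite /= h_v h_ev h_v h_ev.
Qed.

End ReflectionAction.

Section ReflectionGroups.
Variable p : nat.

(* The modulus [8 * 4 ^ p.+1] is four times the translation length
   [2 * 4 ^ p.+1] of [(a b) ^ (4 ^ p.+1)]. *)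
Definition refl_size : nat := (8 * 4 ^ p.+1).-1.
Notation X := 'I_refl_size.+1.

Lemma refl_sizeE : refl_size.+1 = (8 * 4 ^ p.+1)%N.
Proof. by rewrite /refl_size prednK // muln_gt0 expn_gt0. Qed.

Definition elt (k : nat) : X := inZp k.

Lemma eltD j k : elt (j + k) = elt j + elt k.
Proof. by apply: val_inj; rewrite /= modnDm. Qed.

Lemma elt_eq0 k : (elt k == 0) = (8 * 4 ^ p.+1 %| k)%N.
Proof. by rewrite -val_eqE /= refl_sizeE. Qed.

Lemma elt0 : elt 0 = 0.
Proof. exact/val_inj/mod0n. Qed.

Lemma elt_inj j k : elt j = elt k -> j = k %[mod 8 * 4 ^ p.+1].
Proof. by move/(congr1 val) => /=; rewrite refl_sizeE. Qed.

Definition shift : X := elt (2 * 4 ^ p.+1).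

(** The modulus is even, so both reflections exchange parities and have no fixed point, while 0 and
    [shift] are even: the inequalities asked by [swap_reflection4] are parity statements. The
    product of the reflections is translation by 2. *)
Definition refl_act (i : 'I_3) (v : X) : X :=
  match val i with
  | 0 => elt 1 - v
  | 1 => - elt 1 - v
  | _ => swap_pt shift v
  end.

Lemma refl_actK i : involutive (refl_act i).
Proof.
by case: i => [[|[|[|]]]] //= lt v; rewrite /refl_act /= ?subKr ?swap_ptK.
Qed.

Notation l0 := (inord 0 : 'I_3).
Notation l1 := (inord 1 : 'I_3).
Notation l2 := (inord 2 : 'I_3).
Notation run w v := (foldr refl_act v w).

Lemma letters (i : 'I_3) : [\/ i = l0, i = l1 | i = l2].
Proof.
by case: i => [[|[|[|]]]] // lt; [constructor 1|constructor 2|constructor 3];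
  apply: ord_inj; rewrite inordK.
Qed.

Lemma refl_act0 v : refl_act l0 v = elt 1 - v.
Proof. by rewrite /refl_act /= inordK. Qed.
Lemma refl_act1 v : refl_act l1 v = - elt 1 - v.
Proof. by rewrite /refl_act /= inordK. Qed.
Lemma refl_act2 v : refl_act l2 v = swap_pt shift v.
Proof. by rewrite /refl_act /= inordK. Qed.

Lemma run_translation k v : run (rot_word l0 l1 k) v = v + elt (2 * k).
Proof.
rewrite run_rot; elim: k => [|k IH] /=; first by rewrite elt0 addr0.
rewrite IH refl_act0 refl_act1 opprB opprK mulnS eltD (eltD 1 1).
by rewrite addrC -!addrA; congr (_ + _); rewrite addrC -addrA.
Qed.

Lemma run_translationV k v : run (rot_word l1 l0 k) v = v - elt (2 * k).
Proof. by rewrite -{2}(run_rotK refl_actK l0 l1 k v) run_translation addrK. Qed.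

(** The three inequalities say that the pair 0, [shift] is disjoint from its translate by [s]. The
    transposition [c] and its conjugate [c'] then commute and q is trivial. *)
Lemma run_test_shifted x y k s v :
  (forall u, run (rot_word x y k) u = u + s) -> s != 0 -> s != shift -> s != - shift ->
  run (test_word x y l2 k) v = v.
Proof.
move=> xy s0 s1 s2; apply: (run_test_comm_id refl_actK) => u.
have yx w : run (rot_word y x k) w = w - s.
  by rewrite -{2}(run_rotK refl_actK x y k w) xy addrK.
rewrite (run_comm _ x) !xy !yx !refl_act2.
set c := swap_pt shift; pose c' w := c (w - s) + s.
have cK : involutive c := swap_ptK shift.
have c'K : involutive c' by move=> w; rewrite /c' addrK cK subrK.
have disj w : c w = w \/ c' w = w.
  have [w0|w0] := eqVneq w 0.
    right; rewrite /c' /c swap_pt_fix ?subrK // w0 sub0r ?oppr_eq0 //.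
    by rewrite eqr_oppLR.
  have [wd|wd] := eqVneq w shift; last by left; apply: swap_pt_fix.
  right; rewrite /c' /c swap_pt_fix ?subrK // wd; first by rewrite subr_eq0 eq_sym.
  by rewrite -subr_eq0 addrAC subrr sub0r oppr_eq0.
rewrite -[c (_ - s) + s]/(c' _) -[c (u - s) + s]/(c' u).
have [e|e] := disj u; last first.
  rewrite e; have [|e'] := disj (c u); last by rewrite e' cK.
  by rewrite cK => h; rewrite -h e -h.
have [e'|e'] := eqVneq (c' u) u; first by rewrite e' e e' e.
have [->|] := disj (c' u); first by rewrite c'K.
by rewrite c'K => h; rewrite -h eqxx in e'.
Qed.

Lemma elt1_neq_even k : elt 1 != elt (2 * k).
Proof.
apply/eqP => /elt_inj/(congr1 odd).
have ev : (2 %| 8 * 4 ^ p.+1)%N by rewrite dvdn_mulr.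
have oddm m : odd (m %% (8 * 4 ^ p.+1)) = odd m.
  by have := modn_dvdm m ev; rewrite !modn2; do 2 case: odd.
by rewrite !oddm oddM.
Qed.

(** The product of the transposition and either reflection has fourth power 1. For this reason the
    exponents of the test words are multiples of 4. *)
Lemma run_swap_refl (i : 'I_3) j v : i != l2 -> run (rot_word l2 i (4 * j)) v = v.
Proof.
move=> i2; rewrite run_rot mulnC iterM.
suff h4 w : iter 4 (refl_act l2 \o refl_act i) w = w.
  by elim: j => // j IH; rewrite iterS IH h4.
have e1 : elt 1 != 0 by rewrite -elt0 -[0%N]/(2 * 0)%N elt1_neq_even.
have e2 : elt 1 != shift by apply: elt1_neq_even.
have e3 : elt 1 != shift + shift by rewrite -eltD -mulnDr elt1_neq_even.
have even_neg k : - elt 1 != elt (2 * k).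
  rewrite -subr_eq0 -opprD oppr_eq0 -eltD elt_eq0.
  apply/negP => h; have : (2 %| 1 + 2 * k)%N by apply: dvdn_trans h; rewrite dvdn_mulr.
  by rewrite dvdn2 oddD oddM.
have -> : refl_act l2 \o refl_act i =
    swap_pt shift \o (fun w => (if i == l0 then elt 1 else - elt 1) - w).
  apply/funext => u; rewrite /= refl_act2; congr swap_pt.
  have [->|i0] := eqVneq i l0; first exact: refl_act0.
  by move: i0 i2; case: (letters i) => ->; rewrite ?eqxx // refl_act1.
have [_|_] := eqVneq i l0; apply: swap_reflection4 => //.
- by rewrite -elt0 -[0%N]/(2 * 0)%N even_neg.
- exact: even_neg.
- by rewrite -eltD -mulnDr even_neg.
Qed.

Lemma run_test_other p' (f : 'I_3 -> 'I_3) v : p' != p ->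
  run (test_word (f l0) (f l1) (f l2) (4 ^ p'.+1)) v = v.
Proof.
move=> pp'; move: (f l0) (f l1) (f l2) => x y z.
have [->|xy] := eqVneq x y; first by apply: run_test_collapsed; [apply: refl_actK|constructor 1].
have [->|zx] := eqVneq z x.
  by apply: run_test_collapsed; [apply: refl_actK|constructor 2].
have [->|zy] := eqVneq z y.
  by apply: run_test_collapsed; [apply: refl_actK|constructor 3].
have k4 : (4 ^ p'.+1 = 4 * 4 ^ p')%N by rewrite expnS.
(* The letters are now distinct. If z is not the transposition, then x or y is, and t is trivial
   because its exponent is a multiple of 4. *)
have [z2|z2] := eqVneq z l2; last first.
  apply: (run_test_rot_id refl_actK) => u; rewrite k4.
  have [x2|x2] := eqVneq x l2.
    by rewrite x2; apply: run_swap_refl; apply: contra_neq xy => ->.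
  have y2 : y = l2.
    move: xy zx zy z2 x2; case: (letters x) => ->; case: (letters y) => ->;
    case: (letters z) => ->; by rewrite ?eqxx.
  by rewrite y2 -{1}(run_swap_refl (4 ^ p') u x2) (run_rotK refl_actK).
(* Now t is translation by 2 * 4^(p'+1) in one direction or the other. For p < p' this is a multiple
   of the modulus 8 * 4^(p+1). *)
have [p'p|pp] := ltnP p p'.
  apply: (run_test_rot_id refl_actK) => u.
  have e0 : elt (2 * 4 ^ p'.+1) = 0.
    apply/eqP; rewrite elt_eq0 (expnS 4 p') -{1}(subnKC p'p) expnD !mulnA.
    exact: dvdn_mulr.
  move: xy zx zy; rewrite z2; case: (letters x) => ->; case: (letters y) => ->;
    by rewrite ?eqxx // ?run_translation ?run_translationV e0 ?addr0 ?subr0.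
(* For p' < p the translation is at most a quarter of [shift], so it is neither 0 nor [shift], and
   adding [shift] to it does not reach the modulus. *)
have p'lt : (p' < p)%N by rewrite ltn_neqAle pp' pp.
have small : (4 * 4 ^ p'.+1 <= 4 ^ p.+1)%N by rewrite -expnS leq_exp2l.
have pos : (0 < 4 ^ p'.+1)%N by rewrite expn_gt0.
have ndvd k : (0 < k)%N -> (k < 8 * 4 ^ p.+1)%N -> elt k != 0.
  by move=> k0 kM; rewrite elt_eq0; apply/negP => /(dvdn_leq k0); rewrite leqNgt kM.
have s0 : elt (2 * 4 ^ p'.+1) != 0 by apply: ndvd; lia.
have s1 : elt (2 * 4 ^ p'.+1) != shift.
  apply/eqP => /elt_inj; rewrite !modn_small; lia.
have s2 : elt (2 * 4 ^ p'.+1) != - shift.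
  by rewrite -addr_eq0 -eltD; apply: ndvd; lia.
rewrite z2; move: xy zx zy; rewrite z2; case: (letters x) => ->; case: (letters y) => ->;
  rewrite ?eqxx // => _ _ _.
- by apply: (run_test_shifted _ (run_translation _)).
- apply: (run_test_shifted _ (run_translationV _)); rewrite ?oppr_eq0 //.
  + by rewrite eqr_oppLR.
  + by rewrite eqr_opp.
Qed.

(** The points [d 0], ..., [d 3] form one cycle of t, and z swaps the first two. So q is a 3-cycle
    on [d 0], [d 1], [d 2] and t q t^-1 one on [d 1], [d 2], [d 3]; these do not commute, and their
    commutator sends [d 0] to [d 3]. *)
Lemma run_test_same : run (test_word l0 l1 l2 (4 ^ p.+1)) 0 != 0.
Proof.
pose d j := elt (j * (2 * 4 ^ p.+1)).
have pos : (0 < 4 ^ p.+1)%N by rewrite expn_gt0.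
have d_neq i j : (i < j < 4)%N -> d i != d j.
  have pos2 : (0 < 2 * 4 ^ p.+1)%N by rewrite muln_gt0.
  have lt h : (h < 4)%N -> (h * (2 * 4 ^ p.+1) < 8 * 4 ^ p.+1)%N.
    by rewrite -[8%N]/(4 * 2)%N -mulnA ltn_pmul2r.
  move=> /andP[ij j4]; apply/eqP => /elt_inj/eqP.
  by rewrite !modn_small ?lt ?(ltn_trans ij) // eqn_pmul2r // ltn_eqF.
have dS j : d j + shift = d j.+1 by rewrite /d (mulSn j) addnC eltD.
have d4 : d 4 = d 0.
  apply/eqP; rewrite /d mul0n elt0 elt_eq0; apply/dvdnP; exists 1%N; lia.
have d1E : d 1 = shift by rewrite /d mul1n.
have d0E : d 0 = 0 by rewrite /d mul0n elt0.
have tE v : run (rot_word l0 l1 (4 ^ p.+1)) v = v + shift by rewrite run_translation.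
have tVE v : run (rot_word l1 l0 (4 ^ p.+1)) v = v - shift by rewrite run_translationV.
have dB j : d j.+1 - shift = d j by rewrite -dS addrK.
have dB0 : d 0 - shift = d 3 by rewrite -d4 dB.
have c0 : refl_act l2 (d 0) = d 1 by rewrite refl_act2 d0E /swap_pt eqxx d1E.
have c1 : refl_act l2 (d 1) = d 0.
  by rewrite refl_act2 /swap_pt -d0E eq_sym (negPf (d_neq 0 1 _)) // d1E eqxx.
have c2 : refl_act l2 (d 2) = d 2.
  by rewrite refl_act2 swap_pt_fix // -?d0E -?d1E eq_sym d_neq.
have c3 : refl_act l2 (d 3) = d 3.
  by rewrite refl_act2 swap_pt_fix // -?d0E -?d1E eq_sym d_neq.
rewrite -d0E run_test !(run_comm, run_comm_inv) !(tE, tVE).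
rewrite !(c0, c1, c2, c3, dB0, dB, dS, d4).
by rewrite eq_sym d_neq.
Qed.

End ReflectionGroups.

(** * Uncountability *)

Section OrbitMap.
Variables (R : realType) (n : nat) (K : Type) (N : K -> nat).
Variable g : forall k : K, 'I_n -> 'I_(N k).+1 -> 'I_(N k).+1.
Arguments g : clear implicits.
Hypothesis n_gt0 : (0 < n)%N.

Definition letters_of (w : seq 'I_n) : multi_index n (size w) :=
  [ffun s => tnth (in_tuple w) s].

Lemma word_letters_of w : word (letters_of w) = w.
Proof.
rewrite /word -[RHS](map_tnth_enum (in_tuple w)); apply: eq_map => s.
by rewrite ffunE.
Qed.

(** The indicator of the orbit of [w] under permutations of the letters. Its invariance is
    automatic, so it satisfies [word_rel] precisely when [w] is equivalent to the empty word. *)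
Definition orbit_map (w : seq 'I_n) : tensor_map R n 0 (size w) :=
  [ffun ji : multi_index n (size w) * multi_index n 0 =>
    [exists p : {perm 'I_n}, ji.1 == [ffun s => p (letters_of w s)]]%:R].

Lemma orbit_map_rel w : word_rel g (orbit_map w) <-> weqv g w [::].
Proof.
split=> [[_ /(_ (letters_of w) [ffun=> Ordinal n_gt0])]|h].
  rewrite ffunE word_letters_of word0; case: existsP => [_|[]]; first by apply; rewrite oner_neq0.
  by exists 1%g; apply/eqP/ffunP => s; rewrite !ffunE perm1.
split=> [p j i|j i].
  rewrite !ffunE /=; congr _%:R; congr nat_of_bool.
  apply/existsP/existsP => -[q /eqP/ffunP jq].
    exists (q * p^-1)%g; apply/eqP/ffunP => s; have := jq s.
    by rewrite !ffunE permM => <-; rewrite permK.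
  exists (q * p)%g; apply/eqP/ffunP => s; have := jq s.
  by rewrite !ffunE permM => ->.
rewrite ffunE /=; case: existsP => [[q /eqP ->] _|_]; last by rewrite eqxx.
by rewrite word0 word_map word_letters_of; apply: (weqv_map q h).
Qed.

End OrbitMap.

(** An isomorphism matches the fundamental matrices entrywise and is injective, so both have the
    same intertwiners; [orbit_map w] reads off the relation [w] from them. *)
Lemma word_easy_iso (R : realType) (n : nat) (K K' : Type) (N : K -> nat) (N' : K' -> nat)
    (g : forall k : K, 'I_n -> 'I_(N k).+1 -> 'I_(N k).+1)
    (g' : forall k : K', 'I_n -> 'I_(N' k).+1 -> 'I_(N' k).+1)
    (gK : forall k i, involutive (g k i)) (gK' : forall k i, involutive (g' k i))
    (n_gt0 : (0 < n)%N) (w : seq 'I_n) :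
  cmqg_iso (word_easy R gK n_gt0) (word_easy R gK' n_gt0) ->
  weqv g w [::] <-> weqv g' w [::].
Proof.
move=> [e [phi [_ /bij_inj phi_inj phiE]]].
have phi_mx : word_mx R gK' = \matrix_(a, b) phi (word_mx R gK a b).
  apply/matrixP => a b; rewrite [RHS]mxE [RHS]phiE.
  by congr (word_mx R gK' _ _); apply: ord_inj.
rewrite -(orbit_map_rel R g n_gt0) -(orbit_map_rel R g' n_gt0).
rewrite -(word_intertwinerP gK) -(word_intertwinerP gK') phi_mx.
by split; [apply: intertwiner_map|apply: intertwiner_map_inj].
Qed.

(** Cantor's diagonal argument: [D] collects the codes of the sets that do not contain their own
    code. *)
Lemma set_nat_uncountable : ~ countable [set: set nat]%classic.
Proof.
case/countable_injP => f f_inj.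
pose D : set nat := fun i => exists S : set nat, f S = i /\ ~ S i.
have [DD|nDD] := pselect (D (f D)).
  have [S [SD nS]] := DD; apply: nS.
  by rewrite (f_inj _ _ _ _ SD) ?inE.
by apply: (nDD); exists D.
Qed.

Section Family.
Variables (R : realType) (J : set nat).

Definition family_act (k : {p | J p}) : 'I_3 -> 'I_(refl_size (sval k)).+1 ->
  'I_(refl_size (sval k)).+1 := @refl_act (sval k).
Arguments family_act : clear implicits.

Lemma family_actK k i : involutive (family_act k i).
Proof. exact: refl_actK. Qed.

Definition family_qg : easy_quantum_group R :=
  word_easy R (N := fun k : {p | J p} => refl_size (sval k)) family_actK (isT : (0 < 3)%N).

(** Membership of [p] in [J] is thus visible in the word relations. The group of index [p] itself
    detects the word at the identity map and the point 0, and every other group kills it. *)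
Lemma family_test p :
  weqv family_act (test_word (inord 0) (inord 1) (inord 2) (4 ^ p.+1)) [::] <-> ~ J p.
Proof.
split=> [h Jp|nJ [q Jq] f v].
  have := h (exist _ p Jp) id 0; rewrite map_id => e.
  by have /eqP := run_test_same p; apply; exact: e.
rewrite map_test_word; apply: (@run_test_other q p f v).
by apply: contra_notN nJ => /eqP ->.
Qed.

End Family.

Theorem theorem3 (R : realType) :
  exists (I : Type) (G : I -> easy_quantum_group R),
    ~ countable [set: I]%classic /\
    forall s t : I, s <> t -> ~ cmqg_iso (G s) (G t).
Proof.
exists (set nat), (family_qg R); split; first exact: set_nat_uncountable.
move=> s t st iso; apply: st; apply/seteqP; split=> p.
  move=> sp; apply: contrapT => /family_test/(word_easy_iso _ iso)/family_test; exact.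
move=> tp; apply: contrapT => /family_test/(word_easy_iso _ iso)/family_test; exact.
Qed.
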